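(* Let $\mathcal S\le\mathcal R$ be discrete, probability measure-preserving equivalence relations over a standard probability space $(X,\mu)$. Suppose that $\nu\in\mathrm{Prob}([\mathcal R])$ is countably supported, symmetric, and generates $\mathcal R$, and that $\langle\mathrm{supp}(\nu)\rangle\curvearrowright(X,\mu)$ has spectral gap. Given an $\mathcal S$-invariant measurable $E\subseteq X$ with positive measure, we have that $\mathcal S|_E$ is coamenable in $\mathcal R|_E$ if and only if $\rho_E(\mathcal R/\mathcal S,\nu)=1$.
   Context: A discrete, probability measure-preserving (pmp) equivalence relation on $(X,\mu)$ is a Borel set $\mathcal R\subseteq X\times X$ which is an equivalence relation with countable classes $[x]_{\mathcal R}$ satisfying $\int_X\sum_{y\in[x]_{\mathcal R}}f(x,y)\,d\mu(x)=\int_X\sum_{y\in[x]_{\mathcal R}}f(y,x)\,d\mu(x)$ for all Borel $f\colon\mathcal R\to[0,\infty]$. $\mathcal S\le\mathcal R$ means $\mathcal S$ is a Borel subset of $\mathcal R$ that is an equivalence relation on $X$. $[\mathcal R]$ is the group of bimeasurable bijections $\gamma$ of $X$ with $\gamma(x)\in[x]_{\mathcal R}$ for a.e. $x$, modulo a.e. equality. For measurable $E$ with $\mu(E)>0$, $\mathcal R|_E=\mathcal R\cap(E\times E)$ is a discrete pmp relation on $(E,\mu(E\cap\cdot)/\mu(E))$. $[x]_{\mathcal R}/\mathcal S$ is the set of $\mathcal S$-classes contained in $[x]_{\mathcal R}$; $\mathcal R/\mathcal S=\{(x,c):x\in X,c\in[x]_{\mathcal R}/\mathcal S\}$, with the standard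 Borel structure in which $B$ is Borel iff $\{x:(x,[\gamma(x)]_{\mathcal S})\in B\}$ is Borel for every Borel $\gamma\in[\mathcal R]$, and with the measure $\mu_{\mathcal R/\mathcal S}(B)=\int_X|\{c:(x,c)\in B\}|\,d\mu(x)$. For $\xi\in L^2(\mathcal R/\mathcal S)$ put $\xi_x(c)=\xi(x,c)$. $(\lambda_{\mathcal R/\mathcal S}(\gamma)\xi)(x,c)=\xi(\gamma^{-1}(x),c)$ and $\lambda_{\mathcal R/\mathcal S}(\nu)=\sum_\gamma\nu(\{\gamma\})\lambda_{\mathcal R/\mathcal S}(\gamma)$. $\mathcal S$ is coamenable in $\mathcal R$ if there is a sequence $\xi^{(n)}\in L^2(\mathcal R/\mathcal S)$ with $\|\xi^{(n)}_x\|_2=1$ for a.e. $x\in X$ and $\|\xi^{(n)}_x-\xi^{(n)}_y\|_2\to_{n\to\infty}0$ for $\mu_{\mathcal R}$-a.e. $(x,y)\in\mathcal R$, where $\mu_{\mathcal R}(B)=\int_X|\{y:(x,y)\in B\}|\,d\mu(x)$; apply the same definition to $\mathcal S|_E\le\mathcal R|_E$. A countably supported $\nu$ is symmetric if $\nu(\{\gamma\})=\nu(\{\gamma^{-1}\})$ for all $\gamma$; it generates $\mathcal R$ if $\langle\mathrm{supp}(\nu)\rangle x=[x]_{\mathcal R}$ for a.e. $x$. For symmetric $\nu$, consider the random walk on $[x]_{\mathcal R}$ started at $x$ with transition probabilities $p_{y,z}=\nu(\{\gamma:\gamma(y)=z\})$, let $p_{k,x,\mathcal S}$ be the probability that it lies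 in $[x]_{\mathcal S}$ after $k$ steps, and $\rho^{\mathcal S}_\nu(x)=\lim_{k\to\infty}p_{2k,x,\mathcal S}^{1/2k}$, which exists a.e. For measurable $E$ of positive measure, $\rho_E(\mathcal R/\mathcal S,\nu):=\|\rho^{\mathcal S}_\nu1_E\|_\infty=\lim_{k\to\infty}\langle\lambda_{\mathcal R/\mathcal S}(\nu)^{2k}\zeta_E,\zeta_E\rangle^{1/2k}$, where $\zeta_E(x,c)=\mu(E)^{-1/2}1_{x\in c\cap E}$ (existence and equality are known theorems of Abért–Frączyk–Hayes). A pmp action $\Gamma\curvearrowright(X,\mu)$ of a countable group has spectral gap if the representation $(\alpha(\gamma)f)(x)=f(\gamma^{-1}x)$ on $\{f\in L^2(X,\mu):\int f\,d\mu=0\}$ has no sequence of almost invariant unit vectors; i.e. there is no sequence of unit vectors $f_n$ in it with $\|\alpha(\gamma)f_n-f_n\|_2\to0$ for all $\gamma\in\Gamma$. *)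

(* Defs.v *)
From HB Require Import structures.
From mathcomp Require Import all_boot all_order all_algebra.
From mathcomp Require Import complex.
From mathcomp Require Import all_classical all_reals all_analysis.
From mathcomp Require Import measurable_realfun.

Set Implicit Arguments.
Unset Strict Implicit.
Unset Printing Implicit Defensive.

Import Order.TTheory GRing.Theory Num.Theory.
Import numFieldNormedType.Exports.
Import ComplexField.Normc.

Local Open Scope classical_set_scope.
Local Open Scope ring_scope.
Local Open Scope ereal_scope.
Local Open Scope complex_scope.
Local Open Scope quotient_scope.

Section relations.
Context (T : Type).
Implicit Types (Rel Sub : set (T * T)) (D : set T).

Definition is_equivalence Rel :=
  [/\ forall x, Rel (x, x),
      forall x y, Rel (x, y) -> Rel (y, x) &
      forall x y z, Rel (x, y) -> Rel (y, z) -> Rel (x, z)].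

Definition cls Rel (x : T) : set T := [set y | Rel (x, y)].

Definition rel_restrict Rel D : set (T * T) := Rel `&` (D `*` D).

Definition rel_invariant Rel D := forall x y, Rel (x, y) -> D x -> D y.

(* [x]_Rel / Sub; for Sub contained in Rel these are the Sub-classes that lie
   inside the Rel-class of x *)
Definition cosets Rel Sub (x : T) : set (set T) := cls Sub @` cls Rel x.

Definition coset_space D Rel Sub : set (T * set T) :=
  [set p | D p.1 /\ cosets Rel Sub p.1 p.2].

End relations.

(* T is isomorphic, as a measurable space, to a Polish space with its Borel
   sets. *)
Definition standard_borel (R : realType) d (T : measurableType d) :=
  exists (U : completePseudoMetricType R) (f : T -> U),
    [/\ hausdorff_space U, @second_countable U, bijective f &
        forall A : set T, measurable A <-> <<s @open U >> (f @` A)].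

Section pmp_relations.
Context {R : realType} d {T : measurableType d}.
Variable P : {measure set T -> \bar R}.
Implicit Types (Rel : set (T * T)) (D : set T).

Definition pmp_eqrel Rel :=
  [/\ measurable Rel,
      is_equivalence Rel,
      forall x, countable (cls Rel x) &
      forall f : T * T -> \bar R,
        measurable_fun Rel f -> (forall p, Rel p -> 0 <= f p) ->
        \int[P]_x (\esum_(y in cls Rel x) f (x, y)) =
        \int[P]_x (\esum_(y in cls Rel x) f (y, x))].

Definition rel_measure D Rel (B : set (T * T)) : \bar R :=
  \int[P]_(x in D) counting (cls Rel x `&` [set y | B (x, y)]).

End pmp_relations.

(* A relation on a measurable subset D, with P concentrated on D, is handled
   through functions on T restricted to D. Bimeasurable bijections are strict;
   only the condition of moving points inside their Rel-class is almost
   everywhere. *)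
Section full_group.
Context {R : realType} d {T : measurableType d}.
Variables (P : {measure set T -> \bar R}) (D : set T) (Rel : set (T * T)).

Record full_auto := FullAuto {
  fa_fun :> T -> T ;
  fa_inv : T -> T ;
  fa_funS : forall x, D x -> D (fa_fun x) ;
  fa_invS : forall x, D x -> D (fa_inv x) ;
  fa_funK : {in D, cancel fa_fun fa_inv} ;
  fa_invK : {in D, cancel fa_inv fa_fun} ;
  fa_fun_meas : measurable_fun D fa_fun ;
  fa_inv_meas : measurable_fun D fa_inv ;
  fa_rel : {ae P, forall x, D x -> Rel (x, fa_fun x)}
}.

HB.instance Definition _ := gen_eqMixin full_auto.
HB.instance Definition _ := gen_choiceMixin full_auto.

Definition fa_equiv (g h : full_auto) : bool :=
  `[< {ae P, forall x, D x -> g x = h x} >].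

Let fa_equiv_refl : reflexive fa_equiv.
Proof. by move=> g; apply/asboolP; exact: nearW. Qed.

Let fa_equiv_sym : symmetric fa_equiv.
Proof.
move=> g h; apply/idP/idP => /asboolP gh; apply/asboolP;
  by apply: filterS gh => x + Dx => /(_ Dx) ->.
Qed.

Let fa_equiv_trans : transitive fa_equiv.
Proof.
move=> h g k /asboolP gh /asboolP hk; apply/asboolP.
by apply: filterS2 gh hk => x + + Dx => /(_ Dx) -> /(_ Dx).
Qed.

Canonical fa_equiv_canonical :=
  EquivRel fa_equiv fa_equiv_refl fa_equiv_sym fa_equiv_trans.

Definition full_group : Type := {eq_quot fa_equiv}.
HB.instance Definition _ := Choice.on full_group.
HB.instance Definition _ := EqQuotient.on full_group.

Definition fg_rep (g : full_group) : full_auto := repr g.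
Coercion fg_rep : full_group >-> full_auto.

(* The group operations on classes modulo a.e. equality, given by their graphs:
   that composition is compatible with a.e. equality depends on the elements
   preserving P, which holds for pmp Rel. *)
Definition is_one (g : full_group) := {ae P, forall x, D x -> g x = x}.
Definition is_inv (g h : full_group) :=
  {ae P, forall x, D x -> h x = fa_inv g x}.
Definition is_mul (g h k : full_group) :=
  {ae P, forall x, D x -> k x = g (h x)}.

Inductive generated (A : set full_group) : full_group -> Prop :=
| generated_in g : A g -> generated A g
| generated_one g : is_one g -> generated A g
| generated_inv g h : is_inv g h -> generated A g -> generated A h
| generated_mul g h k : is_mul g h k -> generated A g -> generated A h ->
    generated A k.

End full_group.

Section coamenable.
Context {R : realType} d {T : measurableType d}.
Variables (P : {measure set T -> \bar R}) (D : set T) (Rel Sub : set (T * T)).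
Implicit Types (xi : T -> set T -> R[i]).

(* The Borel structure of Rel / Sub. Points x with g x outside the Rel-class of
   x do not contribute, as B lies in the coset space. *)
Definition coset_borel (B : set (T * set T)) :=
  B `<=` coset_space D Rel Sub /\
  forall g : full_auto P D Rel,
    measurable [set x | D x /\ B (x, cls Sub (g x))].

Definition coset_mfun xi :=
  forall U : set R, measurable U ->
    coset_borel (coset_space D Rel Sub `&`
      [set p | U (complex.Re (xi p.1 p.2))]) /\
    coset_borel (coset_space D Rel Sub `&`
      [set p | U (complex.Im (xi p.1 p.2))]).

Definition coset_L2 xi :=
  coset_mfun xi /\
  \int[P]_(x in D) (\esum_(c in cosets Rel Sub x) (normc (xi x c) ^+ 2)%:E)
    < +oo.

Definition l2norm (C : set (set T)) (f : set T -> R[i]) : \bar R :=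
  (\esum_(c in C) (normc (f c) ^+ 2)%:E) `^ 2^-1.

Definition coamenable :=
  exists xi : nat -> T -> set T -> R[i],
    [/\ forall n, coset_L2 (xi n),
        forall n, {ae P, forall x, D x ->
          l2norm (cosets Rel Sub x) (xi n x) = 1} &
        (rel_measure P D Rel).-negligible
          (Rel `&` ~` [set p |
             l2norm (cosets Rel Sub p.1) (fun c => xi n p.1 c - xi n p.2 c)%R
               @[n --> \oo] --> 0])].

End coamenable.

Section random_walk.
Context {R : realType} d {T : measurableType d}.
Variables (mu : {measure set T -> \bar R}) (Rel Sub : set (T * T)).
Local Notation FG := (full_group mu [set: T] Rel).
Implicit Types (nu : FG -> R) (G : set FG).

Definition supp nu : set FG := [set g | nu g != 0%R].

(* A countably supported probability measure on [Rel] is determined by, and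
   encoded as, its mass function. *)
Definition countable_prob nu :=
  [/\ forall g, (0 <= nu g)%R, countable (supp nu) &
      \esum_(g in [set: FG]) (nu g)%:E = 1].

Definition symmetric_prob nu := forall g h : FG, is_inv g h -> nu g = nu h.

Definition generates_rel nu :=
  {ae mu, forall x,
    [set (g : FG) x | g in generated (supp nu)] = cls Rel x}.

Definition transition nu (y z : T) : \bar R :=
  \esum_(g in [set g : FG | g y = z]) (nu g)%:E.

(* For y outside a null set every step stays in the Rel-class of y almost
   surely, so restricting the sum to that class loses no mass. *)
Fixpoint walk_prob nu (k : nat) (y z : T) : \bar R :=
  if k is k'.+1
  then \esum_(w in cls Rel y) (transition nu y w * walk_prob nu k' w z)
  else (\1_[set y] z)%:E.

Definition return_prob nu (k : nat) (x : T) : \bar R :=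
  \esum_(z in cls Sub x) walk_prob nu k x z.

(* The limit exists almost everywhere; limn takes a default value elsewhere. *)
Definition rho nu (x : T) : \bar R :=
  limn (fun k => return_prob nu (2 * k) x `^ ((2 * k)%:R^-1)).

Definition rho_set nu (E : set T) : \bar R :=
  Lnorm mu +oo (fun x => rho nu x * (\1_E x)%:E).

(* T has finite measure in our use, so an L^2 function is integrable and its
   mean is that of its real and imaginary parts. *)
Definition spectral_gap G :=
  ~ exists f : nat -> T -> R[i],
    [/\ forall n, measurable_fun [set: T] (fun x => complex.Re (f n x)) /\
                  measurable_fun [set: T] (fun x => complex.Im (f n x)),
        forall n, \int[mu]_x (complex.Re (f n x))%:E = 0 /\
                  \int[mu]_x (complex.Im (f n x))%:E = 0,
        forall n, Lnorm mu 2%:E (fun x => (normc (f n x))%:E) = 1 &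
        forall g : FG, G g ->
          Lnorm mu 2%:E (fun x => (normc (f n (fa_inv g x) - f n x)%R)%:E)
            @[n --> \oo] --> 0].

End random_walk.

(* Main.v *)
Require Import Defs.
From mathcomp Require Import all_boot all_order all_algebra.
From mathcomp Require Import complex.
From mathcomp Require Import all_classical all_reals all_analysis.
From mathcomp Require Import measurable_realfun ess_sup_inf.
From mathcomp Require Import ring lra.

Set Implicit Arguments.
Unset Strict Implicit.
Unset Printing Implicit Defensive.
Import Order.TTheory GRing.Theory Num.Theory.
Import numFieldNormedType.Exports.
Local Open Scope classical_set_scope.
Local Open Scope ring_scope.
Local Open Scope ereal_scope.

(** Let $\lambda$ be the averaging operator of the walk on functions on $\mathcal R/\mathcal S$
    ([avgc]). Symmetry of [nu] and invariance of [mu] make it self-adjoint for the pairing [cip],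
    and $2\langle\xi,\xi\rangle-2\langle\lambda\xi,\xi\rangle$ is the weighted sum of the squared
    displacements of $\xi$ under the letters ([avg_dist_cip]). So unit vectors with small mean
    displacement are those with $\langle\lambda\xi,\xi\rangle$ close to 1, while integrating return
    probabilities over $E$ gives the moments $\langle\lambda^k\zeta_E,\zeta_E\rangle$ up to the
    factor $\mu(E)$. All work is done with nonnegative functions: their sums and integrals always
    exist, and positive supersolutions become operator bounds through a Schur test ([cip_schur]).

    The limit defining [rho] comes from [ret_dichotomy]: for rates $u<v$ with $0<u<1$, at almost
    every $x$ either [ret (2 * k) x] is at least $e\,u^k$ for some $e>0$ and all $k$, or it is at
    most $Cv^k$ for some $C$ and all $k$. Rational rates then give convergence of the roots
    ([ret_cvg]).

    Suppose $\rho_E\neq 1$. The return probabilities from points of $E$ decay at a common rate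
    $s<1$, so for $s<t<1$ the Green function $\sum_m t^{-m}\lambda^m$ is finite on cosets inside $E$
    and is a positive $t$-supersolution. The Schur test yields $\langle\lambda F,F\rangle\le
    t\langle F,F\rangle$ for nonnegative $F$ carried by such cosets ([green_bound]). A sequence
    witnessing coamenability would violate this: by the spectral gap almost every point is moved
    into $E$ by some word ([gap_ergodic]), and the absolute values of the vectors, pulled back along
    the first such word, are nonnegative with unit fibres over almost all of $X$ and asymptotically
    invariant under every letter ([no_transported_vectors], [decay_not_coamenable]).

    Suppose $\rho_E=1$. The moments do not decay exponentially ([moment_growth_of_rho_set]), so for
    a suitable $m$ the normalised vector $(1+\lambda)\lambda^m\zeta_E$ is almost invariant in mean
    ([almost_invariant_vector]). Coamenability asks for unit fibres. The fibre norm
    $x\mapsto\|F_x\|$ is itself an almost invariant unit vector of $L^2(X)$, and the spectral gap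
    drives it to the constant 1. Passing to a fast subsequence makes all convergences pointwise
    ([asymptotic_coset_vectors]), after which the fibres can be normalised and restricted to $E$
    ([coamenable_of_vectors]). *)

(** * Unordered sums, and almost everywhere statements over countable families *)

Section esum_extra.
Context {R : realType}.

(** Repetitions in [u] are removed by charging each value to the first index where it occurs. This
    turns an unordered sum into a series with measurable selection, to which monotone convergence
    applies. *)
Lemma esum_range {I : choiceType} (u : nat -> I) (a : I -> \bar R) :
  (forall i, 0 <= a i) ->
  \esum_(c in range u) a c =
  \sum_(n <oo) if `[< forall i, (i < n)%N -> u i <> u n >] then a (u n) else 0.
Proof.
move=> a0; pose P := [set n | forall i, (i < n)%N -> u i <> u n].
have -> : range u = u @` P.
  apply/seteqP; split => [_ [n _ <-]|_ [n _ <-]]; last by exists n.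
  elim/ltn_ind: n => n ih.
  have [Pn|] := pselect (P n); first by exists n.
  move=> /existsNP[i /not_implyP[lt_in /contrapT eq_in]].
  by rewrite -eq_in; exact: ih.
rewrite esum_image.
  rewrite esum_mkcond -nneseries_esumT; last by move=> n; case: ifP.
  apply: eq_eseriesr => n _.
  have [Pn|nPn] := pselect (P n).
    by rewrite mem_set// asboolT.
  by rewrite memNset// asboolF.
move=> m n /set_mem Pm /set_mem Pn umn.
by case: (ltngtP m n) => [/Pn|/Pm|//]; rewrite umn.
Qed.

Lemma countable_range {I : choiceType} (J : set I) :
  countable J -> J !=set0 -> exists u : nat -> I, J = range u.
Proof.
move=> /pfcard_geP[->|[u] _]; first by move=> /set0P; rewrite eqxx.
exists u; apply/seteqP; split => [i Ji|_ [n _ <-]]; last exact: funS.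
by have [n _ <-] := surj (f := u) Ji; exists n.
Qed.

Lemma esum_eq_support {I : choiceType} (A B : set I) (a : I -> \bar R) :
  A `<=` B -> (forall i, B i -> ~ A i -> a i = 0) ->
  \esum_(i in A) a i = \esum_(i in B) a i.
Proof.
move=> AB aB; rewrite esum_mkcond [RHS]esum_mkcond; apply: eq_esum => i _.
case: ifPn => [/set_mem/AB Bi|/negP Ai]; first by rewrite ifT ?inE.
by case: ifPn => // /set_mem Bi; rewrite aB// => ?; apply: Ai; rewrite inE.
Qed.

Lemma esum_interchange {I J : choiceType} (A : set I) (B : set J)
    (a : I -> J -> \bar R) : (forall i j, 0 <= a i j) ->
  \esum_(i in A) \esum_(j in B) a i j = \esum_(j in B) \esum_(i in A) a i j.
Proof.
move=> a0; rewrite !esum_esum//.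
rewrite (reindex_esum (B `*`` fun=> A) _ (fun x => (x.2, x.1)))//; split=> //=.
- by move=> [i j] [/=].
- by move=> [i1 i2] [j1 j2] /= _ _ [] -> ->.
- by move=> [i1 i2] [Pi1 Qi2] /=; exists (i2, i1).
Qed.

Lemma esum_ge1 {I : choiceType} (A : set I) (a : I -> \bar R) i :
  (forall i, A i -> 0 <= a i) -> A i -> a i <= \esum_(j in A) a j.
Proof.
move=> a0 Ai; rewrite -[leLHS]esum_set1; last exact: a0.
rewrite esum_mkcond [leRHS]esum_mkcond; apply: le_esum => j _.
case: ifPn => [/set_mem ->|_]; first by rewrite ifT ?inE.
by case: ifPn => // /set_mem/a0.
Qed.

Lemma esumZl {I : choiceType} (A : set I) (a : I -> \bar R) k :
  0 <= k -> (forall i, 0 <= a i) ->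
  \esum_(i in A) (k * a i) = k * \esum_(i in A) a i.
Proof.
move=> k0 a0; move: k k0 => [r|_|//].
  rewrite lee_fin => r0; rewrite -ereal_supZl//; last first.
    by apply/set0P; exists 0, set0; [exact: fsets_set0|rewrite fsbig_set0].
  rewrite image_comp; congr ereal_sup; apply: eq_imagel => X _ /=.
  by rewrite ge0_mule_fsumr.
have [a_eq0|] := pselect (forall i, A i -> a i = 0).
  by rewrite !esum1 ?mule0// => i /a_eq0 ->; rewrite mule0.
move=> /existsNP[i /not_implyP[Ai /eqP ai]].
have ai_gt0 : 0 < a i by rewrite lt_def ai a0.
rewrite gt0_mulye; last first.
  by rewrite (lt_le_trans ai_gt0)//; apply: esum_ge1.
apply/eqP; rewrite -leye_eq -[leLHS](gt0_mulye ai_gt0).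
by apply: (esum_ge1 (a := fun i => +oo * a i)) => // j _; rewrite mule_ge0.
Qed.

End esum_extra.

Section esum_measure.
Context {R : realType} d {T : measurableType d} (mu : {measure set T -> \bar R}).
Context {I : choiceType} (J : set I) (D : set T) (f : I -> T -> \bar R).
Hypotheses (cJ : countable J) (mD : measurable D).
Hypotheses (f0 : forall i x, 0 <= f i x)
  (mf : forall i, J i -> measurable_fun D (f i)).

Let new (u : nat -> I) n := `[< forall i, (i < n)%N -> u i <> u n >].

Lemma measurable_esum : measurable_fun D (fun x => \esum_(i in J) f i x).
Proof.
have [->|/set0P/(countable_range cJ)[u Ju]] := eqVneq J set0.
  by apply: (eq_measurable_fun (cst 0)) => // x _; rewrite esum_set0.
rewrite Ju; apply: (eq_measurable_fun
    (fun x => \sum_(n <oo | n \in new u) f (u n) x)).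
  by move=> x _; rewrite esum_range//= eseries_mkcond.
apply: ge0_emeasurable_sum => // n _; apply: mf.
by rewrite Ju; exists n.
Qed.

Lemma integral_esum : \int[mu]_(x in D) (\esum_(i in J) f i x) =
  \esum_(i in J) \int[mu]_(x in D) f i x.
Proof.
have [->|/set0P/(countable_range cJ)[u Ju]] := eqVneq J set0.
  by rewrite esum_set0; under eq_integral do rewrite esum_set0; rewrite integral0.
have i0 i : 0 <= \int[mu]_(x in D) f i x by apply: integral_ge0.
rewrite Ju esum_range//; under eq_integral do rewrite esum_range//.
rewrite integral_nneseries//.
- by apply: eq_eseriesr => n _; case: ifP => // _; rewrite integral0.
- by move=> n; case: `[<_>] => //; apply: mf; rewrite Ju; exists n.
- by move=> n x _; case: ifP.
Qed.

End esum_measure.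

Lemma nneseries_geometric (R : realType) (q : R) : (0 <= q < 1)%R ->
  \sum_(n <oo) (q ^+ n)%:E = ((1 - q)^-1)%:E.
Proof.
move=> /andP[q0 q1]; apply/cvg_lim => //.
rewrite (_ : (fun n => _) = EFin \o series (geometric 1 q)); last first.
  apply/funext => n /=; rewrite /series/= -sumEFin.
  by apply: eq_bigr => i _; rewrite /geometric /= mul1r.
apply: cvg_EFin; first by apply: nearW.
rewrite -[X in _ --> X]mul1r; apply: cvg_geometric_series.
by rewrite ger0_norm.
Qed.

(** Monotone convergence gives the series a finite integral. This is the device that turns summable
    integral bounds into pointwise bounds and pointwise convergence. *)
Lemma ae_series_lty (R : realType) d (T : measurableType d)
    (mu : {measure set T -> \bar R}) (D : set T) (f : nat -> T -> \bar R) :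
  measurable D -> (forall n, measurable_fun D (f n)) ->
  (forall n x, 0 <= f n x) ->
  \sum_(n <oo) \int[mu]_(x in D) f n x < +oo ->
  {ae mu, forall x, D x -> \sum_(n <oo) f n x < +oo}.
Proof.
move=> mD mf f0 foo.
have mF : measurable_fun D (fun x => \sum_(n <oo) f n x).
  by apply: (ge0_emeasurable_sum (P := predT)).
have F0 x : 0 <= \sum_(n <oo) f n x by exact: nneseries_ge0.
have : mu.-integrable D (fun x => \sum_(n <oo) f n x).
  apply/integrableP; split => //.
  under eq_integral do rewrite gee0_abs//.
  by rewrite integral_nneseries.
move=> /(integrable_ae mD); apply: filterS => x Px Dx.
by have := Px Dx; rewrite ge0_fin_numE.
Qed.

Lemma measurable_fun_invr_ge0 (R : realType) d (T : measurableType d)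
    (D : set T) (f : T -> R) : (forall x, (0 <= f x)%R) ->
  measurable_fun D f -> measurable_fun D (fun x => (f x)^-1)%R.
Proof.
move=> f0 mf; rewrite (_ : (fun x => _) = (@powR R ^~ (-1)%R) \o f); last first.
  by apply/funext => x /=; rewrite powR_inv1.
exact: measurableT_comp.
Qed.

Lemma near_cvge_lt (R : realType) {I} {F : set_system I} {FF : Filter F}
    (f : I -> \bar R) a b : f @ F --> a -> a < b -> \forall i \near F, f i < b.
Proof. by move=> fa ab; apply: (fa [set u | u < b]); exact: open_ereal_lt'. Qed.

Lemma ae_forall_nat (R : realType) d (T : measurableType d)
    (mu : {measure set T -> \bar R}) (P : nat -> T -> Prop) :
  (forall n, {ae mu, forall x, P n x}) -> {ae mu, forall x, forall n, P n x}.
Proof.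
move=> aP; have : mu.-negligible (\bigcup_n ~` [set x | P n x]).
  by apply: negligible_bigcup => n; exact: aP.
by apply: negligibleS => x /= /existsNP[n nP]; exists n.
Qed.

Lemma ae_forall_count (R : realType) d (T : measurableType d)
    (mu : {measure set T -> \bar R}) (I : countType) (P : I -> T -> Prop) :
  (forall n, {ae mu, forall x, P n x}) -> {ae mu, forall x, forall n, P n x}.
Proof.
move=> aP; have : {ae mu, forall x (n : nat), forall i,
    unpickle n = Some i -> P i x}.
  apply: ae_forall_nat => n; case: (unpickle n) => [i|]; last exact: nearW.
  by apply: filterS (aP i) => x Px _ [<-].
by apply: filterS => x Px i; exact: (Px (pickle i) i (pickleK i)).
Qed.

Lemma ae_forall_set (R : realType) d (T : measurableType d)
    (mu : {measure set T -> \bar R}) (I : choiceType) (J : set I)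
    (P : I -> T -> Prop) : countable J ->
  (forall i, J i -> {ae mu, forall x, P i x}) ->
  {ae mu, forall x, forall i, J i -> P i x}.
Proof.
move=> cJ aP; have [->|/set0P/(countable_range cJ)[u Ju]] := eqVneq J set0.
  exact: nearW.
have : {ae mu, forall x n, P (u n) x}.
  by apply: ae_forall_nat => n; apply: aP; rewrite Ju; exists n.
by apply: filterS => x Px i; rewrite Ju => -[n _ <-].
Qed.

(** The expansion of a squared distance, with the cross term moved to the left so that no difference
    of possibly infinite sums appears. *)
Lemma esum_sqrB (R : realType) (I : choiceType) (A : set I) (a b : I -> R) :
  (forall i, 0 <= a i)%R -> (forall i, 0 <= b i)%R ->
  (\esum_(i in A) ((a i - b i) ^+ 2)%:E) +
    2%:E * (\esum_(i in A) (a i * b i)%:E) =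
  (\esum_(i in A) (a i ^+ 2)%:E) + (\esum_(i in A) (b i ^+ 2)%:E).
Proof.
move=> a0 b0; rewrite -esumZl//; last by move=> i; rewrite lee_fin mulr_ge0.
transitivity (\esum_(i in A) (a i ^+ 2 + b i ^+ 2)%:E).
  rewrite -esumD; last 2 first.
  - by move=> i _; rewrite lee_fin sqr_ge0.
  - by move=> i _; rewrite -EFinM lee_fin !mulr_ge0.
  by apply: eq_esum => i _; rewrite -EFinM -EFinD; congr (_%:E); ring.
rewrite -esumD; last 2 first.
- by move=> i _; rewrite lee_fin sqr_ge0.
- by move=> i _; rewrite lee_fin sqr_ge0.
by apply: eq_esum => i _; rewrite EFinD.
Qed.

(** * Conull sets invariant under countably many measure-preserving maps *)

Section conull.
Context {R : realType} d {T : measurableType d} (mu : probability T R).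

Lemma ae_comp (h : T -> T) (P : T -> Prop) : measurable_fun setT h ->
  (forall A, measurable A -> mu (h @^-1` A) = mu A) ->
  {ae mu, forall x, P x} -> {ae mu, forall x, P (h x)}.
Proof.
move=> mh ph [N [mN N0 PN]]; exists (h @^-1` N); split.
- by rewrite -[_ @^-1` _]setTI; exact: mh.
- by rewrite -[RHS]N0; exact: ph.
- by move=> x /= nP; exact: PN.
Qed.

Lemma ae_conull (P : T -> Prop) : {ae mu, forall x, P x} ->
  exists A, [/\ measurable A, mu (~` A) = 0 & A `<=` P].
Proof.
move=> [N [mN N0 PN]]; exists (~` N); rewrite setCK; split => //.
  exact: measurableC.
by move=> x Nx; apply: contrapT => nP; apply: Nx; exact: PN.
Qed.

(** Discarding at each stage the points that some map sends outside the previous set costs only a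
    null set, as the maps are countably many and preserve [mu]. The intersection of all stages is
    invariant. *)
Lemma ae_invariant_set (I : choiceType) (J : set I) (h : I -> T -> T)
    (P : T -> Prop) : countable J ->
  (forall i, J i -> measurable_fun setT (h i)) ->
  (forall i A, J i -> measurable A -> mu (h i @^-1` A) = mu A) ->
  {ae mu, forall x, P x} ->
  exists A : set T, [/\ measurable A, mu (~` A) = 0, A `<=` P &
    forall i x, J i -> A x -> A (h i x)].
Proof.
move=> cJ mh ph /ae_conull[A0 [mA0 A00 A0P]].
pose An := fix An n := if n is n'.+1
  then An n' `&` [set x | forall i, J i -> An n' (h i x)] else A0.
have [u Ju] : exists u : nat -> option I, forall i, J i <-> exists n, u n = Some i.
  have [->|/set0P/(countable_range cJ)[u ->]] := eqVneq J set0.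
    by exists (fun=> None) => i; split => // -[].
  exists (fun n => Some (u n)) => i; split => [[n _ <-]|[n [<-]]]; by exists n.
have mAn n : measurable (An n).
  elim: n => //= n ih; apply: measurableI => //.
  rewrite (_ : mkset _ = \bigcap_k
    (if u k is Some i then h i @^-1` An n else setT)); last first.
    apply/seteqP; split => x /= H.
      by move=> k _; case uk : (u k) => [i|//]; apply: H; apply/Ju; exists k.
    by move=> i /Ju[k uk]; have := H k Logic.I; rewrite uk.
  apply: bigcapT_measurable => k; case uk : (u k) => [i|]; last exact: measurableT.
  rewrite -[_ @^-1` _]setTI; apply: mh => //.
  by apply/Ju; exists k.
have aeAn n : {ae mu, forall x, An n x}.
  elim: n => [|n ih] /=.
    exists (~` A0); split => //; exact: measurableC.
  have : {ae mu, forall x i, J i -> An n (h i x)}.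
    apply: ae_forall_set => // i Ji.
    by apply: ae_comp ih; [exact: mh|move=> A mA; exact: ph].
  by apply: filterS2 ih => x.
exists (\bigcap_n An n); split.
- exact: bigcapT_measurable.
- have [N [mN N0 AN]] := ae_forall_nat aeAn.
  apply/eqP; rewrite -measure_le0 -N0; apply: le_measure; rewrite ?inE//.
    by apply: measurableC; exact: bigcapT_measurable.
  by move=> x /= Ax; apply: AN => /= H; apply: Ax => n _; exact: H.
- by move=> x Ax; apply: A0P; exact: (Ax 0%N Logic.I).
- move=> i x Ji Ax n _; have [_] := Ax n.+1 Logic.I.
  by move=> /(_ i Ji).
Qed.

End conull.

Section measurable_extra.
Context d d' {T : measurableType d} {T' : measurableType d'}.

Lemma measurable_fun_if_asbool (D A : set T) (f g : T -> T') :
  measurable D -> measurable (D `&` A) ->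
  measurable_fun D f -> measurable_fun D g ->
  measurable_fun D (fun x => if `[<A x>] then f x else g x).
Proof.
move=> mD mA mf mg; apply: measurable_fun_if => //.
- apply: (@measurable_fun_bool _ _ _ _ true).
  rewrite [X in measurable X](_ : _ = D `&` A)//.
  by apply/seteqP; split => x [Dx /asboolP].
- by apply: measurable_funS mf => // x [].
- by apply: measurable_funS mg => // x [].
Qed.

End measurable_extra.

(* A random walk on the classes of an equivalence relation, driven by
   countably many measure-preserving maps with symmetric weights; [wdom] is a
   conull set on which the maps act by bijections. *)
Record reversible_walk (R : realType) d (T : measurableType d)
    (mu : probability T R) := ReversibleWalk {
  letter : choiceType ;
  letters : set letter ;
  wt : letter -> R ;
  linv : letter -> letter ;
  step : letter -> T -> T ;
  wdom : set T ;
  letters_countable : countable letters ;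
  wt_ge0 : forall i, (0 <= wt i)%R ;
  wt_gt0 : forall i, letters i -> (0 < wt i)%R ;
  wt_sum : \esum_(i in letters) (wt i)%:E = 1 ;
  letters_linv : forall i, letters i -> letters (linv i) ;
  linvK : forall i, letters i -> linv (linv i) = i ;
  wt_linv : forall i, letters i -> wt (linv i) = wt i ;
  step_meas : forall i, letters i -> measurable_fun setT (step i) ;
  step_pres : forall i A, letters i -> measurable A ->
    mu (step i @^-1` A) = mu A ;
  wdom_meas : measurable wdom ;
  wdom_full : mu (~` wdom) = 0 ;
  step_wdom : forall i x, letters i -> wdom x -> wdom (step i x) ;
  step_linv : forall i x, letters i -> wdom x -> step (linv i) (step i x) = x
}.

(** * Words in the letters, their action and their orbits *)

Section walk.
Context {R : realType} d {T : measurableType d} {mu : probability T R}.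
Variable W : reversible_walk mu.
Local Notation J := (@letters _ _ _ _ W).
Local Notation X := (@wdom _ _ _ _ W).
Local Notation linv := (@linv _ _ _ _ W).
Local Notation step := (@step _ _ _ _ W).
Local Lemma mX : measurable X. Proof. exact: wdom_meas. Qed.
Local Hint Resolve mX : core.

Definition word : set (seq (letter W)) := [set w : seq (letter W) | forall i, i \in w -> J i].

Definition act (w : seq (letter W)) (x : T) := foldl (fun y i => step i y) x w.

Definition winv (w : seq (letter W)) := rev (map linv w).

Lemma word_nil : word [::]. Proof. by []. Qed.

Lemma word_cons i w : word (i :: w) <-> J i /\ word w.
Proof.
split=> [iw|[Ji ww] j]; last by rewrite inE => /predU1P[->|/ww].
by split=> [|j jw]; apply: iw; rewrite inE ?eqxx ?jw ?orbT.
Qed.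

Lemma word_cat w1 w2 : word (w1 ++ w2) <-> word w1 /\ word w2.
Proof.
elim: w1 => [|i w1 ih] /=; first by split => [|[]].
by rewrite !word_cons ih; tauto.
Qed.

Lemma word_winv w : word w -> word (winv w).
Proof.
move=> ww i; rewrite mem_rev => /mapP[j /ww Jj ->]; exact: letters_linv.
Qed.

Lemma act_cat w1 w2 x : act (w1 ++ w2) x = act w2 (act w1 x).
Proof. by rewrite /act foldl_cat. Qed.

Lemma act_wdom w x : word w -> X x -> X (act w x).
Proof.
elim: w x => // i w ih x /word_cons[Ji ww] Xx /=.
by apply: ih => //; exact: step_wdom.
Qed.

Lemma act_winv w x : word w -> X x -> act (winv w) (act w x) = x.
Proof.
elim: w x => // i w ih x /word_cons[Ji ww] Xx.
rewrite /winv /= rev_cons -cats1 act_cat /= ih//; last exact: step_wdom.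
exact: step_linv.
Qed.

Lemma act_meas w : word w -> measurable_fun setT (act w).
Proof.
elim: w => [_|i w ih /word_cons[Ji ww]]; first exact: measurable_id.
exact: (measurableT_comp (ih ww) (step_meas Ji)).
Qed.

Lemma countable_word : countable word.
Proof.
have /countable_injP[f finj] := letters_countable W.
apply/countable_injP; exists (fun w => pickle (map f w)).
move=> w1 w2 /set_mem + /set_mem + /(pcan_inj pickleK).
elim: w1 w2 => [|i w1 ih] [|j w2]//= /word_cons[Ji ww1] /word_cons[Jj ww2].
move=> [fij /(ih _ ww1 ww2) ->]; congr (_ :: _).
by apply: finj fij; exact: mem_set.
Qed.

Lemma word_enum : exists u : nat -> seq (letter W), word = range u.
Proof. by apply: countable_range; [exact: countable_word|exists [::]]. Qed.

Definition orbit (x : T) : set T := [set act w x | w in word].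

Lemma orbit_step i x : J i -> X x -> orbit (step i x) = orbit x.
Proof.
move=> Ji Xx; apply/seteqP; split => _ [w ww <-].
  by exists (i :: w) => //; apply/word_cons.
exists (linv i :: w) => //=; last by rewrite /act /= step_linv.
by apply/word_cons; split => //; exact: letters_linv.
Qed.

Lemma orbit_act w x : word w -> X x -> orbit (act w x) = orbit x.
Proof.
elim: w x => // i w ih x /word_cons[Ji ww] Xx /=.
by rewrite [LHS]ih ?orbit_step//; exact: step_wdom.
Qed.

Lemma measure_wdom : mu X = 1.
Proof.
have mXC : measurable (~` X) by apply: measurableC.
by rewrite -[X]setCK (probability_setC mu mXC) (wdom_full W) sube0.
Qed.

Lemma ae_wdom (P : T -> Prop) :
  {ae mu, forall x, X x -> P x} <-> {ae mu, forall x, P x}.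
Proof.
split=> [XP|]; last by apply: filterS => x Px _.
have Xae : {ae mu, forall x, X x}.
  by exists (~` X); split => //; [exact/measurableC/wdom_meas|exact/wdom_full].
by apply: filterS2 XP Xae => x; apply.
Qed.

(** The preimage of the domain under a letter contains the domain, and the excess lies in the null
    complement; so invariance of [mu] passes to integrals over the domain. *)
Lemma ge0_integral_step i (f : T -> \bar R) : J i ->
  measurable_fun X f -> (forall x, 0 <= f x) ->
  \int[mu]_(x in X) f (step i x) = \int[mu]_(x in X) f x.
Proof.
move=> Ji mf f0.
have pres : \int[mu]_(x in X) f x = \int[mu]_(x in step i @^-1` X) f (step i x).
  transitivity (\int[pushforward mu (step i)]_(x in X) f x).
    apply: eq_measure_integral; first exact: step_meas.
    by move=> ? A mA _; exact/esym/(step_pres Ji mA).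
  apply: ge0_integral_pushforward => //; exact: step_meas.
have mXi : measurable (step i @^-1` X).
  by rewrite -[_ @^-1` _]setTI; exact: step_meas.
have mfi : measurable_fun (step i @^-1` X) (f \o step i).
  apply: (measurable_comp (F := X)) => //; first by move=> _ [x Xx <-].
  exact: measurable_funTS (step_meas Ji).
have XX : X `<=` step i @^-1` X by move=> x; exact: step_wdom.
rewrite pres [RHS](ge0_negligible_integral _ _ _ _ (wdom_full W))//=.
- by rewrite setDE setCK setIC setIidl.
- exact: measurableC.
Qed.

End walk.

(** * The Markov operator of the walk *)

Section averages.
Context {R : realType} d {T : measurableType d} {mu : probability T R}.
Variable W : reversible_walk mu.
Local Notation J := (@letters _ _ _ _ W).
Local Notation X := (@wdom _ _ _ _ W).
Local Notation wt := (@wt _ _ _ _ W).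
Local Notation step := (@step _ _ _ _ W).
Local Notation act := (@act _ _ _ _ W).
Local Notation word := (@word _ _ _ _ W).
Implicit Types (f g : T -> \bar R) (F G : T -> set T -> \bar R).

(** Values are extended reals and the sum is unordered, so that nonnegative functions can be
    averaged without any summability condition. *)
Definition avg f (x : T) : \bar R := \esum_(i in J) ((wt i)%:E * f (step i x)).

Definition wordn n : set (seq (letter W)) := [set w | word w /\ size w = n].

Definition wordwt (w : seq (letter W)) : R := \prod_(i <- w) wt i.

Lemma wordwt_gt0 w : word w -> (0 < wordwt w)%R.
Proof.
by move=> ww; rewrite /wordwt big_seq; apply: prodr_gt0 => i /ww; exact: wt_gt0.
Qed.

Lemma avg_ge0 f : (forall x, 0 <= f x) -> forall x, 0 <= avg f x.
Proof. by move=> f0 x; apply: esum_ge0 => i Ji; rewrite mule_ge0 ?lee_fin ?wt_ge0. Qed.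

Lemma iter_avg_ge0 n f : (forall x, 0 <= f x) -> forall x, 0 <= iter n avg f x.
Proof. by move=> f0; elim: n => //= n ih; exact: avg_ge0. Qed.

Lemma iter_avgE n f x : (forall x, 0 <= f x) ->
  iter n avg f x = \esum_(w in wordn n) ((wordwt w)%:E * f (act w x)).
Proof.
move=> f0; elim: n x => [|n ih] x /=.
  rewrite (_ : wordn 0 = [set [::]]); last first.
    by apply/seteqP; split => [w [_ /size0nil ->]//|_ ->].
  by rewrite esum_set1 /wordwt big_nil mul1e.
rewrite (reindex_esum (J `*` wordn n) _ (fun p => p.1 :: p.2)); last first.
  split => /=.
  - by move=> [i w] /= [Ji [ww <-]]; split => //; apply/word_cons.
  - by move=> [i w] [j v] _ _ /= [-> ->].
  - move=> [|i w] [ww //= [sw]]; move/word_cons : ww => [Ji ww].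
    by exists (i, w).
rewrite [RHS](_ : _ = \esum_(k in J `*` wordn n)
    ((wt k.1)%:E * ((wordwt k.2)%:E * f (act k.2 (step k.1 x))))); last first.
  by apply: eq_esum => -[i w] _ /=; rewrite /wordwt big_cons EFinM muleA.
rewrite -(esum_esum (J := fun=> wordn n)
  (a := fun i w => (wt i)%:E * ((wordwt w)%:E * f (act w (step i x))))).
  apply: eq_esum => i Ji; rewrite ih esum_mkcond -esumZl ?lee_fin ?wt_ge0//; last first.
    move=> w; case: ifPn => // /set_mem[ww _].
    by rewrite mule_ge0// lee_fin ltW// wordwt_gt0.
  rewrite [RHS]esum_mkcond; apply: eq_esum => w _.
  by case: ifP => //; rewrite mule0.
move=> i w Ji [ww _]; rewrite !mule_ge0 ?lee_fin ?wt_ge0// ltW//.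
exact: wordwt_gt0.
Qed.

Lemma le_iter_avg n f g x : (forall x, 0 <= f x) -> (forall x, 0 <= g x) ->
  (forall y, orbit W x y -> f y <= g y) -> iter n avg f x <= iter n avg g x.
Proof.
move=> f0 g0 fg; rewrite !iter_avgE//; apply: le_esum => w [ww _].
apply: lee_wpmul2l; first by rewrite lee_fin ltW// wordwt_gt0.
by apply: fg; exists w.
Qed.

Lemma eq_iter_avg n f g x : (forall x, 0 <= f x) -> (forall x, 0 <= g x) ->
  (forall y, orbit W x y -> f y = g y) -> iter n avg f x = iter n avg g x.
Proof.
by move=> f0 g0 fg; apply/eqP; rewrite eq_le !le_iter_avg// => y /fg ->.
Qed.

Lemma iter_avg_cst1 n x : iter n avg (fun=> 1) x = 1.
Proof.
elim: n x => //= n ih x; rewrite -[RHS](@wt_sum _ _ _ _ W) /avg.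
by apply: eq_esum => i _; rewrite ih mule1.
Qed.

Lemma iter_avg_le1 n f x : (forall x, 0 <= f x) -> (forall x, f x <= 1) ->
  iter n avg f x <= 1.
Proof. by move=> f0 f1; rewrite -(iter_avg_cst1 n x); exact: le_iter_avg. Qed.

Lemma iter_avgZ n k f x : 0 <= k -> (forall x, 0 <= f x) ->
  iter n avg (fun y => k * f y) x = k * iter n avg f x.
Proof.
move=> k0 f0; rewrite !iter_avgE//; last by move=> y; rewrite mule_ge0.
rewrite [X in k * X]esum_mkcond -esumZl//; last first.
  move=> w; case: ifPn => // /set_mem[ww _].
  by rewrite mule_ge0// lee_fin ltW// wordwt_gt0.
rewrite esum_mkcond; apply: eq_esum => w _.
by case: ifP; rewrite ?mule0// muleCA.
Qed.

Lemma iter_avgD n f g x : (forall x, 0 <= f x) -> (forall x, 0 <= g x) ->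
  iter n avg (fun y => f y + g y) x = iter n avg f x + iter n avg g x.
Proof.
move=> f0 g0; rewrite !iter_avgE//; last by move=> y; rewrite adde_ge0.
rewrite -esumD; first by apply: eq_esum => w _; rewrite ge0_muleDr.
  by move=> w [ww _]; rewrite mule_ge0// lee_fin ltW// wordwt_gt0.
by move=> w [ww _]; rewrite mule_ge0// lee_fin ltW// wordwt_gt0.
Qed.

Lemma iter_avg_word n f w x : (forall x, 0 <= f x) -> wordn n w ->
  (wordwt w)%:E * f (act w x) <= iter n avg f x.
Proof.
move=> f0 wn; rewrite iter_avgE//.
apply: (esum_ge1 (a := fun w => (wordwt w)%:E * f (act w x))) => // v [vv _].
by rewrite mule_ge0// lee_fin ltW// wordwt_gt0.
Qed.

Lemma iter_avg_neq0 n f x : (forall x, 0 <= f x) -> iter n avg f x != 0 ->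
  exists2 w, wordn n w & f (act w x) != 0.
Proof.
move=> f0; rewrite iter_avgE//; apply: contra_neqP => wf.
apply: esum1 => w wn; have [-> |fw] := eqVneq (f (act w x)) 0.
  by rewrite mule0.
by exfalso; apply: wf; exists w.
Qed.

End averages.

(** * Fibrewise sums over cosets and the pairing on the coset space *)

Section coset_sums.
Context {R : realType} d {T : measurableType d} {mu : probability T R}.
Variables (W : reversible_walk mu) (Sub : set (T * T)).
Hypotheses (mS : measurable Sub) (eS : is_equivalence Sub).
Local Notation J := (@letters _ _ _ _ W).
Local Notation X := (@wdom _ _ _ _ W).
Local Notation wt := (@wt _ _ _ _ W).
Local Notation linv := (@linv _ _ _ _ W).
Local Notation step := (@step _ _ _ _ W).
Local Notation act := (@act _ _ _ _ W).
Local Notation word := (@word _ _ _ _ W).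
Local Notation avg := (@avg _ _ _ _ W).
Implicit Types (f g : T -> \bar R) (F G : T -> set T -> \bar R).

Let mX : measurable X. Proof. exact: wdom_meas. Qed.
Local Hint Resolve mX : core.

Lemma cls_eqP x y : cls Sub x = cls Sub y <-> Sub (x, y).
Proof.
have [r s t] := eS; split=> [e|xy].
  by rewrite -[Sub _]/(cls Sub x y) e /cls /=; exact: r.
by apply/seteqP; split => z /=; apply: t => //; exact: s.
Qed.

Definition orbit_cosets x : set (set T) := [set cls Sub (act w x) | w in word].

Lemma orbit_cosetsE x : orbit_cosets x = [set cls Sub y | y in orbit W x].
Proof. by rewrite /orbit_cosets /orbit -image_comp. Qed.

Lemma orbit_cosets_step i x : J i -> X x ->
  orbit_cosets (step i x) = orbit_cosets x.
Proof. by move=> Ji Xx; rewrite !orbit_cosetsE orbit_step. Qed.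

Definition csum F x := \esum_(c in orbit_cosets x) F x c.

(* Borel functions on the coset space. *)
Definition coset_measurable F :=
  forall w, word w -> measurable_fun X (fun x => F x (cls Sub (act w x))).

(** Words enumerate the cosets of an orbit with repetitions. Counting each coset at its first word
    keeps the sum measurable, because equality of two cosets is membership of a pair in the
    measurable set [Sub]. *)
Lemma measurable_fun_csum F : (forall x c, 0 <= F x c) ->
  coset_measurable F -> measurable_fun X (csum F).
Proof.
move=> F0 mF; have [u wu] := word_enum W.
have wun n : word (u n) by rewrite wu; exists n.
pose A n := [set x | forall i, (i < n)%N ->
  cls Sub (act (u i) x) <> cls Sub (act (u n) x)].
apply: (eq_measurable_fun (fun x => \sum_(n <oo | n \in predT)
  if `[< A n x >] then F x (cls Sub (act (u n) x)) else 0)).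
  move=> x _; rewrite /csum /orbit_cosets wu image_comp.
  rewrite (esum_range (fun n => cls Sub (act (u n) x)) (fun c => F0 x c)).
  by apply: eq_eseriesl.
apply: ge0_emeasurable_sum => [n x _ _|n _]; first by case: ifP.
apply: measurable_fun_if_asbool => //; last exact: mF.
rewrite (_ : _ `&` _ = \bigcap_(i in `I_n) (X `&`
    (fun x => (act (u i) x, act (u n) x)) @^-1` ~` Sub) `&` X); last first.
  apply/seteqP; split => [x [Xx Ax]|x [Ax Xx]]; last first.
    by split => // i /Ax[_ /=]; rewrite cls_eqP.
  by split => // i /Ax; rewrite cls_eqP.
apply: measurableI => //; apply: fin_bigcap_measurable => // i _.
rewrite -[Y in X `&` Y]setTI; apply: measurableI => //.
apply: measurable_fun_pair => //; try exact: act_meas.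
exact: measurableC.
Qed.

Lemma coset_measurable_step i F : J i -> coset_measurable F ->
  coset_measurable (fun x c => F (step i x) c).
Proof.
move=> Ji mF w ww.
apply: (eq_measurable_fun
    ((fun y => F y (cls Sub (act (linv i :: w) y))) \o step i)).
  by move=> x /set_mem Xx /=; rewrite step_linv.
apply: (measurable_comp (F := X)) => //.
- by move=> _ [x Xx <-]; exact: step_wdom.
- by apply: mF; apply/word_cons; split => //; exact: letters_linv.
- exact: measurable_funTS (step_meas Ji).
Qed.

Lemma coset_measurableM F G : coset_measurable F -> coset_measurable G ->
  coset_measurable (fun x c => F x c * G x c).
Proof. by move=> mF mG w ww; apply: emeasurable_funM; [exact: mF|exact: mG]. Qed.

Lemma coset_measurableD F G : coset_measurable F -> coset_measurable G ->
  coset_measurable (fun x c => F x c + G x c).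
Proof. by move=> mF mG w ww; apply: emeasurable_funD; [exact: mF|exact: mG]. Qed.

Definition avgc F x c := avg (F^~ c) x.

Lemma avgc_ge0 F : (forall x c, 0 <= F x c) -> forall x c, 0 <= avgc F x c.
Proof. by move=> F0 x c; exact: avg_ge0. Qed.

Lemma iter_avgcE n F x c : iter n avgc F x c = iter n avg (F^~ c) x.
Proof.
elim: n x => [//|n ih] x; rewrite !iterS /avgc.
have -> // : (iter n avgc F)^~ c = iter n avg (F^~ c).
by apply/funext => y; exact: ih.
Qed.

Lemma iter_avgc_ge0 n F : (forall x c, 0 <= F x c) ->
  forall x c, 0 <= iter n avgc F x c.
Proof. by move=> F0 x c; rewrite iter_avgcE; exact: iter_avg_ge0. Qed.

Lemma coset_measurable_avgc F : (forall x c, 0 <= F x c) ->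
  coset_measurable F -> coset_measurable (avgc F).
Proof.
move=> F0 mF w ww; apply: (measurable_esum (f := fun i x =>
  (wt i)%:E * F (step i x) (cls Sub (act w x)))) => //.
- exact: letters_countable.
- by move=> i x; rewrite mule_ge0// lee_fin wt_ge0.
- by move=> i Ji; apply: measurable_funeM; exact: coset_measurable_step.
Qed.

Lemma coset_measurable_iter_avgc n F : (forall x c, 0 <= F x c) ->
  coset_measurable F -> coset_measurable (iter n avgc F).
Proof.
move=> F0 mF; elim: n => //= n ih; apply: coset_measurable_avgc => //.
exact: iter_avgc_ge0.
Qed.

Lemma csum_ge0 F x : (forall x c, 0 <= F x c) -> 0 <= csum F x.
Proof. by move=> F0; exact: esum_ge0. Qed.

(** On nonnegative functions this is the inner product of $L^2(\mathcal R/\mathcal S)$, as soon as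
    orbits are [Rel]-classes. *)
Definition cip F G := \int[mu]_(x in X) csum (fun x c => F x c * G x c) x.

Lemma cipC F G : cip F G = cip G F.
Proof.
by apply: eq_integral => x _; apply: eq_esum => c _; rewrite muleC.
Qed.

Lemma cip_avgcl F G : (forall x c, 0 <= F x c) -> (forall x c, 0 <= G x c) ->
  coset_measurable F -> coset_measurable G ->
  cip (avgc F) G =
  \esum_(i in J) ((wt i)%:E * cip (fun x c => F (step i x) c) G).
Proof.
move=> F0 G0 mF mG; have FG0 i x c : 0 <= F (step i x) c * G x c.
  by rewrite mule_ge0.
have mFG i : J i -> coset_measurable (fun x c => F (step i x) c * G x c).
  by move=> Ji; apply: coset_measurableM => //; exact: coset_measurable_step.
rewrite /cip (eq_integral (fun x => \esum_(i in J)
    ((wt i)%:E * csum (fun x c => F (step i x) c * G x c) x))); last first.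
  move=> x _; rewrite /csum.
  rewrite (eq_esum (b := fun c => \esum_(i in J)
      ((wt i)%:E * (F (step i x) c * G x c)))); last first.
    move=> c _; rewrite muleC /avgc /avg -esumZl//; last first.
      by move=> i; rewrite mule_ge0// lee_fin wt_ge0.
    by apply: eq_esum => i _; rewrite muleCA; congr (_ * _); rewrite muleC.
  rewrite esum_interchange; last first.
    by move=> c i; rewrite mule_ge0// lee_fin wt_ge0.
  by apply: eq_esum => i _; rewrite esumZl// lee_fin wt_ge0.
rewrite integral_esum//.
- apply: eq_esum => i Ji; rewrite ge0_integralZl// ?lee_fin ?wt_ge0//.
  + by apply: measurable_fun_csum => //; exact: mFG.
  + by move=> x _; exact: csum_ge0.
- exact: letters_countable.
- by move=> i x; rewrite mule_ge0 ?lee_fin ?wt_ge0//; exact: csum_ge0.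
- move=> i Ji; apply: measurable_funeM; apply: measurable_fun_csum => //.
  exact: mFG.
Qed.

(** The substitution of [step i x] for [x] preserves the measure and does not change the set of
    cosets of the orbit. *)
Lemma cip_step i F G : J i ->
  (forall x c, 0 <= F x c) -> (forall x c, 0 <= G x c) ->
  coset_measurable F -> coset_measurable G ->
  cip (fun x c => F (step i x) c) G = cip F (fun x c => G (step (linv i) x) c).
Proof.
move=> Ji F0 G0 mF mG; rewrite /cip.
rewrite -[RHS](@ge0_integral_step _ _ _ _ W i)//.
- apply: eq_integral => x /set_mem Xx; rewrite /csum orbit_cosets_step//.
  by apply: eq_esum => c _; rewrite step_linv.
- apply: measurable_fun_csum; first by move=> x c; rewrite mule_ge0.
  apply: coset_measurableM => //; apply: coset_measurable_step => //.
  exact: letters_linv.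
- by move=> x; apply: csum_ge0 => {}x c; rewrite mule_ge0.
Qed.

(* The weights are symmetric and the letters preserve the measure, so the
   averaging operator is self-adjoint. *)
Lemma cip_avgc F G : (forall x c, 0 <= F x c) -> (forall x c, 0 <= G x c) ->
  coset_measurable F -> coset_measurable G ->
  cip (avgc F) G = cip F (avgc G).
Proof.
move=> F0 G0 mF mG; rewrite cip_avgcl// [RHS]cipC cip_avgcl//.
rewrite (reindex_esum J J linv); last first.
  split; first exact: letters_linv.
    by move=> i j /set_mem Ji /set_mem Jj /(congr1 linv); rewrite !linvK.
  by move=> i Ji; exists (linv i); [exact: letters_linv|exact: linvK].
apply: eq_esum => i Ji; have Jli := letters_linv Ji.
by rewrite wt_linv// cip_step// linvK// cipC.
Qed.

Lemma cip_iter_avgc n F G :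
  (forall x c, 0 <= F x c) -> (forall x c, 0 <= G x c) ->
  coset_measurable F -> coset_measurable G ->
  cip (iter n avgc F) G = cip F (iter n avgc G).
Proof.
move=> F0 G0 mF mG; elim: n G G0 mG => [//|n ih] G G0 mG.
rewrite iterS cip_avgc//.
- by rewrite ih ?iterSr//; [exact: avgc_ge0|exact: coset_measurable_avgc].
- exact: iter_avgc_ge0.
- exact: coset_measurable_iter_avgc.
Qed.

(** For [Z] equal to $E$ this is $\zeta_E$ without its normalising constant. *)
Definition diag (Z : set T) (x : T) (c : set T) : \bar R :=
  (\1_Z x * \1_c x)%:E.

Lemma diag_ge0 Z x c : 0 <= diag Z x c.
Proof. by rewrite lee_fin mulr_ge0. Qed.

Lemma coset_measurable_diag Z : measurable Z -> coset_measurable (diag Z).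
Proof.
move=> mZ w ww; apply/measurable_EFinP; apply: measurable_funM.
  exact: measurable_indic.
apply: (eq_measurable_fun ((\1_Sub : _ -> R) \o (fun x => (act w x, x)))).
  by move=> x _ /=; rewrite !indicE; congr (_%:R); apply: asbool_equiv_eq.
apply: measurableT_comp; first exact: measurable_indic.
apply: measurable_funTS; apply: measurable_fun_pair => //; exact: act_meas.
Qed.

Lemma csum_diag F Z x : (forall x c, 0 <= F x c) ->
  csum (fun x c => F x c * diag Z x c) x = F x (cls Sub x) * (\1_Z x)%:E.
Proof.
move=> F0; rewrite /csum.
rewrite -(esum_eq_support (A := [set cls Sub x])).
- rewrite esum_set1 ?mule_ge0 ?diag_ge0//; congr (_ * _); rewrite /diag.
  by rewrite [X in (_ * X)%R]indicE mem_set ?mulr1//; case: eS => + _ _; apply.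
- by move=> _ ->; exists [::]; [exact: word_nil|].
- move=> _ [w ww <-] xw; rewrite /diag [X in (_ * X)%R]indicE memNset ?mulr0 ?mule0//.
  by move=> xx; apply: xw; exact/cls_eqP.
Qed.

Lemma cip_diag F Z : (forall x c, 0 <= F x c) ->
  cip F (diag Z) = \int[mu]_(x in X) (F x (cls Sub x) * (\1_Z x)%:E).
Proof. by move=> F0; apply: eq_integral => x _; exact: csum_diag. Qed.

End coset_sums.

(** * A Schur test for powers of the averaging operator *)

Section schur.
Context {R : realType} d {T : measurableType d} {mu : probability T R}.
Variables (W : reversible_walk mu) (Sub : set (T * T)).
Hypotheses (mS : measurable Sub) (eS : is_equivalence Sub).
Local Notation X := (@wdom _ _ _ _ W).
Local Notation avgc := (@avgc _ _ _ _ W).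
Local Notation cip := (@cip _ _ _ _ W Sub).
Local Notation coset_measurable := (@coset_measurable _ _ _ _ W Sub).
Local Notation orbit := (@orbit _ _ _ _ W).
Local Notation orbit_cosets := (@orbit_cosets _ _ _ _ W Sub).
Implicit Types (f g : T -> \bar R) (F G : T -> set T -> \bar R).

Let mX : measurable X. Proof. exact: wdom_meas. Qed.
Local Hint Resolve mX : core.

Lemma cip_ge0 F G : (forall x c, 0 <= F x c) -> (forall x c, 0 <= G x c) ->
  0 <= cip F G.
Proof.
move=> F0 G0; apply: integral_ge0 => x _; apply: csum_ge0 => {}x c.
exact: mule_ge0.
Qed.

Lemma cipDl F1 F2 G1 G2 : (forall x c, 0 <= F1 x c) -> (forall x c, 0 <= F2 x c) ->
  (forall x c, 0 <= G1 x c) -> (forall x c, 0 <= G2 x c) ->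
  coset_measurable F1 -> coset_measurable F2 ->
  coset_measurable G1 -> coset_measurable G2 ->
  \int[mu]_(x in X) csum W Sub (fun x c => F1 x c * G1 x c + F2 x c * G2 x c) x =
  cip F1 G1 + cip F2 G2.
Proof.
move=> F10 F20 G10 G20 mF1 mF2 mG1 mG2.
rewrite /cip -ge0_integralD//.
- by apply: eq_integral => x _; rewrite -esumD// => c _; rewrite mule_ge0.
- by move=> x _; apply: csum_ge0 => {}x c; rewrite mule_ge0.
- apply: measurable_fun_csum => //; first by move=> x c; rewrite mule_ge0.
  exact: coset_measurableM.
- by move=> x _; apply: csum_ge0 => {}x c; rewrite mule_ge0.
- apply: measurable_fun_csum => //; first by move=> x c; rewrite mule_ge0.
  exact: coset_measurableM.
Qed.

Lemma le_int_csum F G : (forall x c, 0 <= F x c) -> (forall x c, 0 <= G x c) ->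
  coset_measurable F -> coset_measurable G ->
  (forall x c, X x -> orbit_cosets x c -> F x c <= G x c) ->
  \int[mu]_(x in X) csum W Sub F x <= \int[mu]_(x in X) csum W Sub G x.
Proof.
move=> F0 G0 mF mG FG; apply: ge0_le_integral => //.
- by move=> x _; exact: csum_ge0.
- exact: measurable_fun_csum.
- exact: measurable_fun_csum.
- by move=> x Xx; apply: le_esum => c xc; exact: FG.
Qed.

(* Schur test: when [2 F(x) F(y) <= P(y) O(x) + O(y) P(x)], self-adjointness
   makes both terms contribute the same amount. *)
Lemma cip_schur n F P O :
  (forall x c, 0 <= F x c) -> (forall x c, 0 <= P x c) ->
  (forall x c, 0 <= O x c) ->
  coset_measurable F -> coset_measurable P -> coset_measurable O ->
  (forall x y c, X x -> orbit_cosets x c -> orbit x y ->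
    2%:E * (F x c * F y c) <= P y c * O x c + O y c * P x c) ->
  cip (iter n avgc F) F <= cip (iter n avgc P) O.
Proof.
move=> F0 P0 O0 mF mP mO H.
have iF0 := iter_avgc_ge0 W n F0.
have iP0 := iter_avgc_ge0 W n P0; have iO0 := iter_avgc_ge0 W n O0.
have imF := coset_measurable_iter_avgc n F0 mF.
have imP := coset_measurable_iter_avgc n P0 mP.
have imO := coset_measurable_iter_avgc n O0 mO.
have two0 : (0 < 2%:R :> R)%R by [].
rewrite -(@lee_pmul2l _ 2%:R%:E)//.
have -> : 2%:R%:E * cip (iter n avgc P) O =
    cip (iter n avgc P) O + cip (iter n avgc O) P.
  by rewrite (cip_iter_avgc mS eS n O0 P0 mO mP) cipC mule_natl mule2n.
have -> : 2%:R%:E * cip (iter n avgc F) F =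
    cip (iter n avgc F) F + cip (iter n avgc F) F by rewrite mule_natl mule2n.
rewrite -cipDl// -cipDl//; apply: le_int_csum.
- by move=> x c; rewrite adde_ge0 ?mule_ge0.
- by move=> x c; rewrite adde_ge0 ?mule_ge0.
- by apply: coset_measurableD; exact: coset_measurableM.
- by apply: coset_measurableD; exact: coset_measurableM.
move=> x c Xx xc; rewrite !iter_avgcE.
rewrite -mule2n -mule_natl ![_ * F x c]muleC ![_ * O x c]muleC ![_ * P x c]muleC.
rewrite -!iter_avgZ ?lee_fin//; last by move=> y; rewrite mule_ge0.
rewrite -iter_avgD; [|by move=> y; rewrite mule_ge0..].
apply: le_iter_avg; [by move=> y; rewrite !mule_ge0| |].
  by move=> y; rewrite adde_ge0 ?mule_ge0.
move=> y xy; apply: le_trans (H x y c Xx xc xy) _.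
by rewrite muleC [_ * P x c]muleC.
Qed.

End schur.

(** * Return probabilities to a class and a dichotomy for their decay *)

Section return_probability.
Context {R : realType} d {T : measurableType d} {mu : probability T R}.
Variables (W : reversible_walk mu) (Sub : set (T * T)).
Hypotheses (mS : measurable Sub) (eS : is_equivalence Sub).
Local Notation J := (@letters _ _ _ _ W).
Local Notation X := (@wdom _ _ _ _ W).
Local Notation wt := (@wt _ _ _ _ W).
Local Notation linv := (@linv _ _ _ _ W).
Local Notation cip := (@cip _ _ _ _ W Sub).
Local Notation step := (@step _ _ _ _ W).
Local Notation word := (@word _ _ _ _ W).
Local Notation act := (@act _ _ _ _ W).
Local Notation wordn := (@wordn _ _ _ _ W).
Local Notation wordwt := (@wordwt _ _ _ _ W).
Local Notation avg := (@avg _ _ _ _ W).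
Local Notation avgc := (@avgc _ _ _ _ W).
Local Notation diag := (@diag R d T).
Local Notation coset_measurable := (@coset_measurable _ _ _ _ W Sub).
Local Notation orbit := (@orbit _ _ _ _ W).
Local Notation orbit_cosets := (@orbit_cosets _ _ _ _ W Sub).
Implicit Types (f g : T -> \bar R) (F G : T -> set T -> \bar R).

Let mX : measurable X. Proof. exact: wdom_meas. Qed.
Local Hint Resolve mX : core.

Definition eindic (A : set T) (x : T) : \bar R := (\1_A x)%:E.

Lemma eindic_ge0 A x : 0 <= eindic A x.
Proof. by rewrite lee_fin. Qed.

Lemma eindic_le1 A x : eindic A x <= 1.
Proof. by rewrite lee_fin indicE lern1 leq_b1. Qed.
Local Hint Resolve eindic_ge0 eindic_le1 : core.

(* The probability that the walk from x lies in the Sub-class of x at time n. *)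
Definition ret n x : R := fine (iter n avg (eindic (cls Sub x)) x).

Lemma hit_ge0 n A x : 0 <= iter n avg (eindic A) x.
Proof. exact: iter_avg_ge0. Qed.

Lemma hit_le1 n A x : iter n avg (eindic A) x <= 1.
Proof. exact: iter_avg_le1. Qed.

Lemma hit_fin n A x : iter n avg (eindic A) x \is a fin_num.
Proof.
rewrite ge0_fin_numE; last exact: hit_ge0.
exact: le_lt_trans (hit_le1 _ _ _) (ltry _).
Qed.

Lemma retE n x : (ret n x)%:E = iter n avg (eindic (cls Sub x)) x.
Proof. by rewrite /ret fineK//; exact: hit_fin. Qed.

Lemma ret_ge0 n x : (0 <= ret n x)%R.
Proof. by rewrite -lee_fin retE hit_ge0. Qed.

Lemma ret_le1 n x : (ret n x <= 1)%R.
Proof. by rewrite -lee_fin retE hit_le1. Qed.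

Lemma ret0 x : ret 0 x = 1%R.
Proof.
rewrite /ret /= /eindic indicE mem_set//=; case: eS => r _ _; exact: r.
Qed.

Lemma iter_avgc_diag n Z x c : X x -> (forall y, orbit x y -> c y -> Z y) ->
  iter n avgc (diag Z) x c = iter n avg (eindic c) x.
Proof.
move=> Xx xZ; rewrite iter_avgcE; apply: eq_iter_avg => // [y|y xy].
  exact: diag_ge0.
rewrite /diag /eindic; have [cy|cy] := pselect (c y).
  by rewrite !indicE !mem_set// ?mul1r//; exact: xZ.
by rewrite (indicE _ c) memNset// mulr0.
Qed.

Lemma measurable_ret n : measurable_fun X (ret n).
Proof.
apply/measurable_EFinP.
have := coset_measurable_iter_avgc (Sub := Sub) n (@diag_ge0 R d T setT)
  (@coset_measurable_diag _ _ _ _ W _ mS _ measurableT).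
move=> /(_ [::] (@word_nil _ _ _ _ W)); apply: eq_measurable_fun => x /set_mem Xx.
by rewrite /= retE iter_avgc_diag.
Qed.

Lemma letters_neq0 : J !=set0.
Proof.
apply/set0P/negP => /eqP J0; have := wt_sum W; rewrite J0 esum_set0.
by move=> /eqP; rewrite eq_sym onee_eq0.
Qed.

Lemma wt_le1 i : J i -> (wt i <= 1)%R.
Proof.
move=> Ji; rewrite -lee_fin -(@wt_sum _ _ _ _ W).
by apply: (esum_ge1 (a := fun i => (wt i)%:E)) => // j _; rewrite lee_fin wt_ge0.
Qed.

(* Going back along the inverse letter. *)
Lemma iter_avg2_ge : exists k : R, [/\ (0 < k)%R, (k <= 1)%R &
  forall n f x, X x -> (forall x, 0 <= f x) ->
    (k ^+ n)%:E * f x <= iter (2 * n) avg f x].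
Proof.
have [i Ji] := letters_neq0; have Jli := letters_linv Ji.
exists (wt i * wt i)%R; split.
- by rewrite mulr_gt0// wt_gt0.
- by rewrite mulr_ile1 ?wt_ge0// wt_le1.
move=> n f x Xx f0.
elim: n f f0 => [|n ih] f f0; first by rewrite mul1e.
rewrite mulnS addnC iterD exprSr EFinM -muleA.
apply: le_trans (ih _ _); last exact: iter_avg_ge0.
rewrite lee_wpmul2l ?lee_fin ?exprn_ge0 ?mulr_ge0 ?wt_ge0//.
have iw : wordn 2 [:: i; linv i].
  by split => // j; rewrite !inE => /orP[|] /eqP ->.
have := iter_avg_word x f0 iw.
by rewrite /wordwt !big_cons big_nil mulr1 wt_linv//= /act/= step_linv.
Qed.

(** The Markov property at time [m]: if the walk is then at a point of the class of [x], returning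
    to the class of that point is the same as returning to the class of [x]. *)
Lemma iter_avg_ge_class n m x : X x ->
  forall f, (forall x, 0 <= f x) ->
  (forall y, orbit x y -> cls Sub x y -> f y <= (ret n y)%:E) ->
  iter m avg (fun y => eindic (cls Sub x) y * f y) x <= (ret (m + n) x)%:E.
Proof.
move=> Xx f f0 fn; rewrite retE iterD.
apply: le_iter_avg => [y|y|y xy]; [by rewrite mule_ge0|exact: hit_ge0|].
have [xSy|xSy] := pselect (cls Sub x y); last first.
  by rewrite /eindic indicE memNset// mul0e; exact: hit_ge0.
rewrite /eindic indicE mem_set// mul1e; apply: le_trans (fn y xy xSy) _.
by rewrite retE (iffRL (cls_eqP eS x y)).
Qed.

Section dichotomy.
Variables (u v : R).
Hypotheses (u0 : (0 < u)%R) (u1 : (u < 1)%R) (uv : (u < v)%R).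

Let g k x := ret (2 * k) x.

(** The points where [ret (2 * k) x / u ^+ k] has infimum 0 over [k], that is, where no lower bound
    at rate [u] holds. *)
Let Z := [set x | X x /\ forall j : nat, exists k, (g k x < j.+1%:R^-1 * u ^+ k)%R].

Let mZ : measurable Z.
Proof.
rewrite (_ : Z = \bigcap_j \bigcup_k (X `&`
    [set x | (g k x < j.+1%:R^-1 * u ^+ k)%R])); last first.
  apply/seteqP; split => [x [Xx Zx] j _|x Zx].
    by have [k gk] := Zx j; exists k.
  split; first by have [k _ []] := Zx 0%N Logic.I.
  by move=> j; have [k _ [_ gk]] := Zx j Logic.I; exists k.
apply: bigcapT_measurable => j; apply: bigcupT_measurable => k.
rewrite (_ : [set x | _] = g k @^-1` `]-oo, (j.+1%:R^-1 * u ^+ k)%R[).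
  exact: measurable_ret.
by apply/seteqP; split => x /=; rewrite in_itv.
Qed.

Lemma ret_word n m w x y : wordn m w -> act w x = y -> cls Sub x y ->
  (wordwt w * ret n y <= ret (m + n) x)%R.
Proof.
move=> wm wy xSy; rewrite -lee_fin EFinM !retE iterD.
rewrite -(iffRL (cls_eqP eS x y) xSy) -wy.
by apply: iter_avg_word => //; exact: hit_ge0.
Qed.

(** Inside a class the walk started in [Z] stays in [Z] at even times. A point of the class outside
    [Z] has a lower bound at rate [u], and this bound would pass to [x] at the cost of the weight of
    the word leading there. *)
Let Z_inv x m : Z x ->
  iter (2 * m) avg (eindic (cls Sub x `\` Z)) x = 0.
Proof.
move=> [Xx Zx]; apply/eqP; apply: contraT => /iter_avg_neq0[//|w wm].
rewrite /eindic indicE; have [[xSy nZy]|nxy] := pselect ((cls Sub x `\` Z) (act w x)); last first.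
  by rewrite memNset// eqxx.
move=> _; have ww : word w by case: wm.
have Xy : X (act w x) by exact: act_wdom.
have [j Zj] : exists j : nat, forall k, (j.+1%:R^-1 * u ^+ k <= g k (act w x))%R.
  apply: contrapT => /forallNP H; apply: nZy; split => // j.
  by have /existsNP[k /negP] := H j; rewrite -ltNge => ?; exists k.
have [k0 [k0_gt0 k0_le1 k0avg]] := iter_avg2_ge.
(* The first entry serves [k < m], where backtracking along one letter bounds the return
   probability; the second serves [m <= k], where the walk passes through the point outside [Z]. *)
pose e := (Num.min (k0 ^+ m) (wordwt w * j.+1%:R^-1))%R.
have e0 : (0 < e)%R by rewrite lt_min exprn_gt0// mulr_gt0// wordwt_gt0.
have [i ie] := ltr_add_invr e0; rewrite add0r in ie.
have [k gk] := Zx i.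
suff : (e * u ^+ k <= g k x)%R.
  rewrite leNgt => /negP; case; apply: lt_le_trans gk _.
  by rewrite ler_wpM2r ?exprn_ge0// ltW.
have uk1 n : (u ^+ n <= 1)%R by rewrite exprn_ile1// ltW.
have [km|mk] := leqP m k; last first.
  apply: (@le_trans _ _ (k0 ^+ k)%R); last first.
    rewrite -lee_fin retE; apply: le_trans (k0avg _ _ _ Xx _) => //.
    by rewrite /eindic indicE mem_set ?mule1//; exact/cls_eqP.
  apply: (@le_trans _ _ e); first by rewrite ler_piMr// ltW.
  rewrite /e ge_min; apply/orP; left.
  by apply: ler_wiXn2l => //; [exact: ltW|exact: ltnW].
have := ret_word (2 * (k - m)) wm erefl xSy; rewrite -mulnDr subnKC//.
apply: le_trans; apply: (@le_trans _ _ (wordwt w * (j.+1%:R^-1 * u ^+ (k - m)))%R).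
  rewrite mulrA; apply: ler_pM.
  - exact: ltW.
  - by rewrite exprn_ge0// ltW.
  - by rewrite /e ge_min lexx orbT.
  - by apply: ler_wiXn2l; [exact: ltW|exact: ltW|exact: leq_subr].
by rewrite ler_wpM2l// ltW// wordwt_gt0.
Qed.

(** The minimum of [ret (2 * k) x / u ^+ k] over [k <= n], a truncation of the infimum in the
    definition of [Z]. It is the weight in the Schur test and decreases to 0 on [Z]. *)
Fixpoint theta n x : R :=
  if n is n'.+1 then (Num.min (theta n' x) (ret (2 * n) x / u ^+ n))%R else 1%R.

Lemma theta_le n k x : (k <= n)%N -> (theta n x <= ret (2 * k) x / u ^+ k)%R.
Proof.
elim: n => [|n ih]; first by rewrite leqn0 => /eqP ->; rewrite ret0 divr1.
rewrite leq_eqVlt => /predU1P[->|kn] /=; first by rewrite ge_min lexx orbT.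
by rewrite ge_min ih.
Qed.

Lemma theta_attained n x :
  exists2 k, (k <= n)%N & theta n x = (ret (2 * k) x / u ^+ k)%R.
Proof.
elim: n => [|n [k kn e]]; first by exists 0%N; rewrite ?ret0 ?divr1.
rewrite /= minEle; case: ifP => _; last by exists n.+1.
by exists k => //; exact: leqW.
Qed.

Lemma theta_le1 n x : (theta n x <= 1)%R.
Proof. by have := theta_le x (leq0n n); rewrite ret0 divr1. Qed.

Lemma theta_ge0 n x : (0 <= theta n x)%R.
Proof.
by have [k _ ->] := theta_attained n x; rewrite divr_ge0 ?ret_ge0// exprn_ge0// ltW.
Qed.

Lemma theta_antitone m n x : (m <= n)%N -> (theta n x <= theta m x)%R.
Proof.
move=> mn; have [k km ->] := theta_attained m x.
by apply: theta_le; exact: leq_trans mn.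
Qed.

Lemma measurable_theta n : measurable_fun X (theta n).
Proof.
elim: n => [|n ih]; first exact: measurable_cst.
apply: measurable_minr => //; apply: measurable_funM; last exact: measurable_cst.
exact: measurable_ret.
Qed.

Section estimate.
Variables (k0 : R).
Hypotheses (k0_gt0 : (0 < k0)%R) (k0_le1 : (k0 <= 1)%R)
  (k0avg : forall n f x, X x -> (forall x, 0 <= f x) ->
    (k0 ^+ n)%:E * f x <= iter (2 * n) avg f x).

Lemma theta_ge n x : X x -> (k0 ^+ n <= theta n x)%R.
Proof.
move=> Xx; have [k kn ->] := theta_attained n x.
rewrite ler_pdivlMr ?exprn_gt0//.
apply: (@le_trans _ _ (k0 ^+ n)%R).
  by apply: ler_piMr; [exact/exprn_ge0/ltW|rewrite exprn_ile1// ltW].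
apply: (@le_trans _ _ (k0 ^+ k)%R).
  by apply: ler_wiXn2l => //; exact: ltW.
rewrite -lee_fin retE; apply: le_trans (k0avg _ Xx _) => //.
by rewrite /eindic indicE mem_set ?mule1//; exact/cls_eqP.
Qed.

Lemma theta_gt0 n x : X x -> (0 < theta n x)%R.
Proof. by move=> Xx; rewrite (lt_le_trans _ (theta_ge n Xx))// exprn_gt0. Qed.

(** The strict inequality forces the minimum at [x] to be attained at some [k > m]. By the Markov
    property [ret (2 * k) x] dominates the average over time [2 * m] of [ret (2 * (k - m))] on the
    class, hence of [u ^+ (k - m) * theta n]; dividing gives superharmonicity of [theta n] for the
    walk confined to the class. *)
Lemma avg_theta_le m n x : X x -> (theta n x < theta m x)%R ->
  iter (2 * m) avg (fun y => eindic (cls Sub x) y * (theta n y)%:E) x <=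
  (u ^+ m * theta n x)%:E.
Proof.
move=> Xx nm; have [k kn e] := theta_attained n x.
have mk : (m < k)%N.
  rewrite ltnNge; apply/negP => km; move: nm; rewrite e ltNge => /negP; apply.
  exact: theta_le.
have uk := exprn_gt0 (k - m) u0.
rewrite -(@lee_pmul2l _ (u ^+ (k - m))%:E)//.
rewrite -EFinM mulrA -exprD subnK ?(ltnW mk)// e mulrC divfK ?gt_eqF ?exprn_gt0//.
pose f y := (u ^+ (k - m) * theta n y)%:E.
have f0 y : 0 <= f y by rewrite lee_fin mulr_ge0 ?theta_ge0// ltW.
have -> : ret (2 * k) x = ret (2 * m + 2 * (k - m)) x.
  by rewrite -mulnDr subnKC// ltnW.
apply: le_trans (@iter_avg_ge_class (2 * (k - m)) (2 * m) x Xx f f0 _).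
  rewrite -iter_avgZ//; last 2 first.
  - by rewrite lee_fin ltW.
  - by move=> y; rewrite mule_ge0 ?lee_fin ?theta_ge0.
  apply: le_iter_avg => y.
  - by rewrite !mule_ge0 ?lee_fin ?theta_ge0//; exact: ltW.
  - by rewrite mule_ge0.
  - by move=> _; rewrite muleCA /f EFinM.
move=> y [w ww wy] xSy; rewrite lee_fin mulrC -ler_pdivlMr//.
by apply: theta_le; rewrite (leq_trans (leq_subr _ _)).
Qed.

Let Zn m n := Z `&` [set x | (theta n x < theta m x)%R].

Let mZn m n : measurable (Zn m n).
Proof.
rewrite (_ : Zn m n = Z `&` (X `&`
    (fun x => theta m x - theta n x)%R @^-1` `]0%R, +oo[)); last first.
  apply/seteqP; split => x.
    by move=> [[Xx Zx] /= tx]; split => //; split => //=; rewrite in_itv/= andbT subr_gt0.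
  by move=> [Zx [Xx /=]]; rewrite in_itv/= andbT subr_gt0.
apply: measurableI => //.
have : measurable_fun X (fun x => theta m x - theta n x)%R.
  by apply: measurable_funB; exact: measurable_theta.
by apply.
Qed.

(** Schur test with weights [theta n] and its inverse on the diagonal of [Z]; the condition on
    weights is $b/a+a/b\ge2$. On [Zn m n] superharmonicity bounds the integrand by [u ^+ m]. On the
    rest of [Z], [theta n x] is at least [theta m x], hence at least [k0 ^+ m], and the average is
    at most 1. *)
Lemma ret_estimate m n :
  \int[mu]_(x in X) ((ret (2 * m) x)%:E * eindic Z x) <=
  (u ^+ m)%:E + (k0 ^- m)%:E * mu (Z `\` Zn m n).
Proof.
pose P x c := diag Z x c * (theta n x)%:E.
pose O x c := ((theta n x)^-1)%:E * diag Z x c.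
have mt : coset_measurable (fun x _ => (theta n x)%:E).
  by move=> w ww; apply/measurable_EFinP; exact: measurable_theta.
have mtV : coset_measurable (fun x _ => ((theta n x)^-1)%:E).
  move=> w ww; apply/measurable_EFinP.
  apply: measurable_fun_invr_ge0; first exact: theta_ge0.
  exact: measurable_theta.
have md : coset_measurable (diag Z) by exact: coset_measurable_diag.
have P0 x c : 0 <= P x c by rewrite mule_ge0 ?diag_ge0 ?lee_fin ?theta_ge0.
have O0 x c : 0 <= O x c by rewrite mule_ge0 ?diag_ge0 ?lee_fin ?invr_ge0 ?theta_ge0.
have mP : coset_measurable P by exact: coset_measurableM.
have mO : coset_measurable O by exact: coset_measurableM.
have := cip_schur mS eS (2 * m) (@diag_ge0 R d T Z) P0 O0 md mP mO.
rewrite (cip_diag _ eS); last by apply: iter_avgc_ge0; exact: diag_ge0.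
have -> : cip (iter (2 * m) avgc P) O =
    cip (fun x c => iter (2 * m) avgc P x c * ((theta n x)^-1)%:E) (diag Z).
  by apply: eq_integral => x _; apply: eq_esum => c _; rewrite muleA.
rewrite (cip_diag _ eS); last first.
  move=> x c; rewrite mule_ge0 ?lee_fin ?invr_ge0 ?theta_ge0//.
  exact: iter_avgc_ge0.
move=> schur.
(* By [Z_inv], cutting the indicator of the class down to [Z] changes nothing along the walk started
   in [Z]. *)
have eZ x : X x -> iter (2 * m) avgc (diag Z) x (cls Sub x) * eindic Z x =
    (ret (2 * m) x)%:E * eindic Z x.
  move=> Xx; have [Zx|nZx] := pselect (Z x); last first.
    by rewrite /eindic indicE memNset// !mule0.
  congr (_ * _); rewrite retE.
  have -> : eindic (cls Sub x) = (fun y => eindic (cls Sub x `&` Z) y +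
      eindic (cls Sub x `\` Z) y).
    apply/funext => y; rewrite /eindic -EFinD !indicE in_setI in_setD.
    by case: (y \in cls Sub x); case: (y \in Z); rewrite /= ?addr0 ?add0r.
  rewrite iter_avgD// (Z_inv m Zx) !adde0 iter_avgcE; congr (iter _ _ _ x).
  by apply/funext => y; rewrite /diag /eindic indicI /= mulrC.
rewrite (eq_integral (fun x =>
    iter (2 * m) avgc (diag Z) x (cls Sub x) * eindic Z x)); last first.
  by move=> x /set_mem Xx; rewrite eZ.
apply: le_trans (schur _) _.
  move=> x y c Xx _ [w ww wy]; have Xy : X y by rewrite -wy; exact: act_wdom.
  have tx := theta_gt0 n Xx; have ty := theta_gt0 n Xy.
  rewrite /P /O /diag -!EFinM lee_fin !indicE.
  case: (x \in Z); case: (x \in c); case: (y \in Z); case: (y \in c);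
    rewrite ?(mulr0, mul0r, mulr1, mul1r, addr0)//.
  move: (theta n x) (theta n y) tx ty => a b a0 b0; rewrite -subr_ge0.
  have -> : (b / a + b^-1 * a - 2%:R = (b - a) ^+ 2 / (a * b))%R.
    by field; rewrite !gt_eqF.
  by rewrite divr_ge0 ?sqr_ge0// mulr_ge0// ltW.
apply: (@le_trans _ _ (\int[mu]_(x in X)
   ((u ^+ m)%:E * eindic (Zn m n) x + (k0 ^- m)%:E * eindic (Z `\` Zn m n) x))).
  apply: ge0_le_integral => //.
  - move=> x _; rewrite !mule_ge0 ?lee_fin ?invr_ge0 ?theta_ge0//.
    exact: iter_avgc_ge0.
  - apply: emeasurable_funM; last by apply/measurable_EFinP; exact: measurable_indic.
    apply: emeasurable_funM; last exact: (mtV [::] (@word_nil _ _ _ _ W)).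
    exact: (coset_measurable_iter_avgc _ P0 mP (@word_nil _ _ _ _ W)).
  - apply: emeasurable_funD; apply: measurable_funeM; apply/measurable_EFinP;
      apply: measurable_indic => //; exact: measurableD.
  move=> x Xx; have [Zx|nZx] := pselect (Z x); last first.
    have nZn : ~ Zn m n x by case.
    have nZD : ~ (Z `\` Zn m n) x by case.
    by rewrite /eindic !indicE !memNset// !mule0 adde0.
  have Z1 : \1_Z x = 1%R :> R by rewrite indicE mem_set.
  rewrite Z1 mule1 iter_avgcE.
  have tx := theta_gt0 n Xx.
  have PE : iter (2 * m) avg (P^~ (cls Sub x)) x <=
      iter (2 * m) avg (fun y => eindic (cls Sub x) y * (theta n y)%:E) x.
    apply: le_iter_avg => // y; first by rewrite mule_ge0 ?lee_fin ?theta_ge0.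
    move=> _; rewrite /P /diag lee_wpmul2r ?lee_fin ?theta_ge0//.
    by rewrite ler_piMl// indicE lern1 leq_b1.
  rewrite lee_pdivrMr//.
  have [tt|tt] := pselect (theta n x < theta m x)%R.
    rewrite /eindic (indicE _ (Zn m n)) mem_set// (indicE _ (_ `\` _)) memNset; last first.
      by move=> [_]; apply.
    rewrite mule0 adde0 mule1 -EFinM; apply: le_trans PE _.
    exact: avg_theta_le.
  rewrite /eindic (indicE _ (Zn m n)) memNset; last by move=> [].
  rewrite (indicE _ (_ `\` _)) mem_set; last by split => // -[].
  rewrite mule0 add0e mule1 -EFinM; apply: le_trans PE _.
  apply: (@le_trans _ _ 1).
    apply: iter_avg_le1 => y; first by rewrite mule_ge0 ?lee_fin ?theta_ge0.
    rewrite -EFinM lee_fin; apply: mulr_ile1 => //.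
    - exact: theta_ge0.
    - exact: theta_le1.
  rewrite lee_fin mulrC ler_pdivlMr ?exprn_gt0// mul1r.
  by apply: le_trans (theta_ge m Xx) _; rewrite leNgt; exact/negP.
have mi A : measurable A -> measurable_fun X (eindic A).
  by move=> mA; apply/measurable_EFinP; exact: measurable_indic.
have mD : measurable (Z `\` Zn m n) by exact: measurableD.
rewrite ge0_integralD//; last 4 first.
- by move=> x _; rewrite mule_ge0// lee_fin exprn_ge0// ltW.
- by apply: measurable_funeM; exact: mi.
- by move=> x _; rewrite mule_ge0// lee_fin invr_ge0 exprn_ge0// ltW.
- by apply: measurable_funeM; exact: mi.
rewrite !ge0_integralZl ?lee_fin ?invr_ge0 ?exprn_ge0 ?(ltW u0) ?(ltW k0_gt0)//;
  try exact: mi.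
rewrite !integral_indic//; apply: leeD.
- rewrite -[leRHS]mule1; apply: lee_wpmul2l.
    by rewrite lee_fin exprn_ge0// ltW.
  by apply: probability_le1; exact: measurableI.
- rewrite lee_wpmul2l ?lee_fin ?invr_ge0 ?exprn_ge0 ?(ltW k0_gt0)//.
  by apply: le_measure; rewrite ?inE//; exact: measurableI.
Qed.

(** As [n] grows the sets [Z \ Zn m n] decrease to the empty set, since [theta n] tends to 0 on [Z]
    while [theta m] is positive. The error term of [ret_estimate] therefore vanishes. *)
Lemma ret_integral_le m :
  \int[mu]_(x in X) ((ret (2 * m) x)%:E * eindic Z x) <= (u ^+ m)%:E.
Proof.
apply/lee_addgt0Pr => e e0.
have cvg0 : mu \o (fun n => Z `\` Zn m n) @ \oo --> 0.
  have cap0 : \bigcap_n (Z `\` Zn m n) = set0.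
    apply/seteqP; split => // x xZ.
    have [Xx Zx] : Z x by case: (xZ 0%N Logic.I).
    have [j jm] := ltr_add_invr (theta_gt0 m Xx); rewrite add0r in jm.
    have [k gk] := Zx j; have [_] := xZ k Logic.I; apply; split => //=.
    apply: le_lt_trans (theta_le x (leqnn k)) _; apply: le_lt_trans jm.
    by rewrite ler_pdivrMr ?exprn_gt0// ltW.
  rewrite -(measure0 mu) -cap0; apply: nonincreasing_cvg_mu.
  - apply: (@le_lt_trans _ _ 1); last exact: ltry.
    by apply: probability_le1; exact: measurableD.
  - by move=> n; exact: measurableD.
  - by rewrite cap0.
  - move=> n p np; apply/subsetPset => x [Zx nx]; split => // -[_ /= px].
    by apply: nx; split => //=; apply: le_lt_trans px; exact: theta_antitone.
have ke0 : (0 < e * k0 ^+ m)%R by rewrite mulr_gt0// exprn_gt0.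
have [n _ /(_ n (leqnn n)) /= Hn] : \forall n \near \oo,
    mu (Z `\` Zn m n) < (e * k0 ^+ m)%:E.
  by apply: (near_cvge_lt cvg0); rewrite lte_fin.
apply: le_trans (ret_estimate m n) _; rewrite leeD2l//.
rewrite muleC lee_pdivrMr ?exprn_gt0// -EFinM; exact: ltW.
Qed.

End estimate.

(** The integrals over [Z] of [ret (2 * m) x / v ^+ m] are bounded by the geometric sequence of
    ratio [u / v]. Their series is thus finite almost everywhere on [Z], and its sum serves as
    [C]. *)
Lemma ret_dichotomy : {ae mu, forall x, X x ->
  (forall e, (0 < e)%R -> exists k, (ret (2 * k) x < e * u ^+ k)%R) ->
  exists C, forall m, (ret (2 * m) x <= C * v ^+ m)%R}.
Proof.
have [k0 [k0_gt0 k0_le1 k0avg]] := iter_avg2_ge.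
have v0 : (0 < v)%R by exact: lt_trans uv.
pose f m x := (v ^- m)%:E * ((ret (2 * m) x)%:E * eindic Z x).
have f0 m x : 0 <= f m x.
  by rewrite !mule_ge0 ?lee_fin ?invr_ge0 ?exprn_ge0 ?ret_ge0// ltW.
have mf0 m : measurable_fun X (fun x => (ret (2 * m) x)%:E * eindic Z x).
  apply: emeasurable_funM; apply/measurable_EFinP; first exact: measurable_ret.
  exact: measurable_indic.
have mf m : measurable_fun X (f m) by apply: measurable_funeM.
have : {ae mu, forall x, X x -> \sum_(m <oo) f m x < +oo}.
  apply: ae_series_lty => //.
  apply: (@le_lt_trans _ _ (\sum_(m <oo) ((u / v) ^+ m)%:E)).
    apply: lee_nneseries => [m _ _|m _]; first by apply: integral_ge0.
    rewrite ge0_integralZl//; last 2 first.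
    - by move=> x _; rewrite mule_ge0 ?lee_fin ?ret_ge0.
    - by rewrite lee_fin invr_ge0 exprn_ge0// ltW.
    apply: (@le_trans _ _ ((v ^- m)%:E * (u ^+ m)%:E)).
      rewrite lee_wpmul2l ?lee_fin ?invr_ge0 ?exprn_ge0 ?(ltW v0)//.
      exact: (ret_integral_le k0_gt0 k0_le1 k0avg).
    by rewrite -EFinM expr_div_n mulrC.
  rewrite nneseries_geometric ?ltry//.
  by rewrite divr_ge0 ?(ltW u0) ?(ltW v0)//= ltr_pdivrMr// mul1r.
apply: filterS => x fx Xx xZ.
have Zx : Z x.
  by split => // j; apply: xZ; rewrite invr_gt0.
exists (fine (\sum_(m <oo) f m x)) => m.
have s0 : 0 <= \sum_(m <oo) f m x by exact: nneseries_ge0.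
rewrite -ler_pdivrMr ?exprn_gt0// -lee_fin fineK; last first.
  by rewrite ge0_fin_numE// fx.
apply: le_trans (nneseries_lim_ge m.+1 _) => //.
rewrite big_mkord big_ord_recr/= -[leLHS]add0e leeD ?sume_ge0//.
by rewrite /f /eindic indicE mem_set// mule1 -EFinM mulrC.
Qed.

End dichotomy.

End return_probability.

(** * Convergence of the roots of the return probabilities *)

Section roots.
Local Open Scope ring_scope.
Context {R : realType}.

Lemma powR_rootK (g : R) n : (0 <= g)%R -> (0 < n)%N ->
  ((g `^ n%:R^-1) ^+ n = g)%R.
Proof.
move=> g0 n0; rewrite -powR_mulrn ?powR_ge0// -powRrM mulVf ?powRr1//.
by rewrite pnatr_eq0 -lt0n.
Qed.

Lemma powR_root_lt (g b : R) k : (0 <= g)%R -> (0 <= b)%R -> (0 < k)%N ->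
  ((g `^ (2 * k)%:R^-1 < b) = (g < (b ^+ 2) ^+ k))%R.
Proof.
move=> g0 b0 k0; have n0 : (0 < 2 * k)%N by rewrite muln_gt0.
rewrite -(@ltr_pXn2r _ (2 * k))// ?nnegrE ?powR_ge0//.
by rewrite powR_rootK// exprM.
Qed.

Lemma powR_root_gt (g b : R) k : (0 <= g)%R -> (0 <= b)%R -> (0 < k)%N ->
  ((b < g `^ (2 * k)%:R^-1) = ((b ^+ 2) ^+ k < g))%R.
Proof.
move=> g0 b0 k0; have n0 : (0 < 2 * k)%N by rewrite muln_gt0.
rewrite -(@ltr_pXn2r _ (2 * k))// ?nnegrE ?powR_ge0//.
by rewrite powR_rootK// exprM.
Qed.

Lemma near_exp_ltM (a b e : R) : (0 <= b)%R -> (b < a)%R -> (0 < e)%R ->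
  \forall k \near \oo, (b ^+ k < e * a ^+ k)%R.
Proof.
move=> b0 ba e0; have a0 : (0 < a)%R by exact: le_lt_trans ba.
have ab1 : (`|b / a| < 1)%R.
  by rewrite ger0_norm ?ltr_pdivrMr ?mul1r// divr_ge0// ltW.
have := @cvg_geometric R 1%R _ ab1 => /(cvgr_lt _) /(_ _ e0).
by apply: filterS => k; rewrite /= mul1r expr_div_n ltr_pdivrMr ?exprn_gt0.
Qed.

(** The square of the limit is the supremum of the rates [a] for which [g k] is at least a positive
    multiple of [a ^+ k] for all [k]. Rates below it bound the roots from below by definition, and
    the dichotomy at rates above it bounds them from above. *)
Lemma cvg_root (g : nat -> R) : (forall k, 0 <= g k <= 1)%R ->
  (forall p q : rat, (0 < ratr p :> R)%R -> (ratr p < 1 :> R)%R -> (p < q)%R ->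
    (forall e, (0 < e)%R -> exists k, (g k < e * (ratr p) ^+ k)%R) ->
    exists C, forall m, (g m <= C * (ratr q) ^+ m)%R) ->
  exists2 l : R, (0 <= l <= 1)%R & (g k `^ (2 * k)%:R^-1)%R @[k --> \oo] --> l.
Proof.
move=> g01 gpq.
have g0 k : (0 <= g k)%R by have /andP[] := g01 k.
pose A : set R := [set a | a = 0 \/ exists2 e, (0 < e)%R &
  forall k, (e * a ^+ k <= g k)%R].
have A1 a : A a -> (a <= 1)%R.
  move=> [->//|[e e0 ea]]; rewrite leNgt; apply/negP => a1.
  have [n _ /(_ n (leqnn n)) /=] := near_exp_ltM (@ler01 R) a1 e0.
  rewrite expr1n ltNge => /negP; apply; apply: le_trans (ea n) _.
  by have /andP[] := g01 n.
have hA : has_sup A by split; [exists 0%R; left|exists 1%R => a /A1].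
have s0 : (0 <= sup A)%R by apply: ub_le_sup; [case: hA|left].
have s1 : (sup A <= 1)%R by apply: ge_sup; [exists 0%R; left|exact: A1].
exists (Num.sqrt (sup A)).
  by rewrite sqrtr_ge0/= -sqrtr1 ler_wsqrtr.
apply/cvgrPdist_lt => eps eps0.
set l := Num.sqrt (sup A).
have l2 : (l ^+ 2 = sup A)%R by rewrite sqr_sqrtr.
have l0 : (0 <= l)%R by rewrite sqrtr_ge0.
have lo : \forall k \near \oo, (l - eps < g k `^ (2 * k)%:R^-1)%R.
  have [b0|b0] := ltP (l - eps)%R 0%R.
    by apply: nearW => k; rewrite (lt_le_trans b0)// powR_ge0.
  have bs : ((l - eps) ^+ 2 < sup A)%R.
    by rewrite -l2 ltr_pXn2r ?nnegrE// gtrBl.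
  have [a Aa ba] := sup_gt (proj1 hA) bs.
  case: Aa => [a0|[e e0 ea]].
    by move: ba; rewrite a0 ltNge sqr_ge0.
  near=> k; rewrite powR_root_gt//; last by near: k; exact: nbhs_infty_gt.
  apply: lt_le_trans (ea k); near: k.
  by apply: near_exp_ltM => //; exact: sqr_ge0.
have up : \forall k \near \oo, (g k `^ (2 * k)%:R^-1 < l + eps)%R.
  have [b1|b1] := ltP 1%R (l + eps)%R.
    apply: nearW => k; rewrite (le_lt_trans _ b1)//.
    apply: (@le_trans _ _ (1 `^ (2 * k)%:R^-1)); last by rewrite powR1.
    by apply: ge0_ler_powR; rewrite ?nnegrE ?invr_ge0//; have /andP[] := g01 k.
  have b0 : (0 < l + eps)%R by rewrite ltr_wpDl.
  have bs : (sup A < (l + eps) ^+ 2)%R.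
    by rewrite -l2 ltr_pXn2r ?nnegrE ?ltrDl// ltW.
  (* Two rational rates are placed between the supremum and the target: at the smaller one the lower
     bound fails, so the upper bound holds at the larger one, with room left to absorb its
     constant. *)
  have [q /[!in_itv]/= /andP[sq qb]] := rat_in_itvoo bs.
  have [p /[!in_itv]/= /andP[sp pq]] := rat_in_itvoo sq.
  have b21 : ((l + eps) ^+ 2 <= 1)%R by rewrite exprn_ile1// ltW.
  have p0 : (0 < ratr p :> R)%R by exact: le_lt_trans sp.
  have [| |e e0|C Cg] := gpq p q p0.
  - by rewrite (lt_trans pq)// (lt_le_trans qb).
  - by rewrite -(ltr_rat R).
  - apply: contrapT => /forallNP H; suff : A (ratr p).
      by move=> /(ub_le_sup (proj2 hA)); rewrite leNgt sp.
    by right; exists e => // k; rewrite leNgt; exact/negP.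
  have C0 : (0 < C + 1)%R.
    by rewrite ltr_wpDl//; have := Cg 0%N; rewrite expr0 mulr1; exact: le_trans.
  near=> k; rewrite powR_root_lt ?(ltW b0)//; last by near: k; exact: nbhs_infty_gt.
  apply: (@le_lt_trans _ _ ((C + 1) * ratr q ^+ k)%R).
    apply: le_trans (Cg k) _; rewrite ler_wpM2r ?lerDl//.
    by rewrite exprn_ge0// ltW// (lt_trans p0).
  rewrite -ltr_pdivlMl//; near: k; apply: near_exp_ltM => //.
  - by rewrite ltW// (lt_trans p0).
  - by rewrite invr_gt0.
by apply: filterS2 lo up => k lo up; rewrite ltr_distlC lo up.
Unshelve. all: by end_near. Qed.

End roots.

Section shrink.
Context {R : realType} d {T : measurableType d} {mu : probability T R}.
Variable W : reversible_walk mu.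
Local Notation J := (@letters _ _ _ _ W).
Local Notation X := (@wdom _ _ _ _ W).
Local Notation step := (@step _ _ _ _ W).

Lemma ae_invariant (P : T -> Prop) : {ae mu, forall x, P x} ->
  exists A : set T, [/\ measurable A, mu (~` A) = 0, A `<=` X, A `<=` P &
    forall i x, J i -> A x -> A (step i x)].
Proof.
move=> aeP; have : {ae mu, forall x, X x /\ P x}.
  by apply/(ae_wdom W); apply: filterS aeP.
move=> /(ae_invariant_set (letters_countable W) (@step_meas _ _ _ _ W)
  (@step_pres _ _ _ _ W))[A [mA A0 AXP Ai]].
by exists A; split => // x /AXP[].
Qed.

(** The same walk on a smaller invariant conull domain, so that almost everywhere hypotheses can be
    taken to hold at every point. *)
Definition shrink (A : set T) (mA : measurable A) (A0 : mu (~` A) = 0)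
    (AX : A `<=` X) (Ai : forall i x, J i -> A x -> A (step i x)) :
    reversible_walk mu :=
  ReversibleWalk (letters_countable W) (@wt_ge0 _ _ _ _ W) (@wt_gt0 _ _ _ _ W)
    (wt_sum W) (@letters_linv _ _ _ _ W) (@linvK _ _ _ _ W)
    (@wt_linv _ _ _ _ W) (@step_meas _ _ _ _ W) (@step_pres _ _ _ _ W)
    mA A0 Ai (fun i x Ji Ax => @step_linv _ _ _ _ W i x Ji (AX x Ax)).

End shrink.

Section return_asymptotics.
Context {R : realType} d {T : measurableType d} {mu : probability T R}.
Variables (W : reversible_walk mu) (Sub : set (T * T)).
Hypotheses (mS : measurable Sub) (eS : is_equivalence Sub).
Local Notation X := (@wdom _ _ _ _ W).
Local Notation ret := (@ret _ _ _ _ W Sub).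

Lemma ret_cvg : {ae mu, forall x, X x -> exists2 l : R, (0 <= l <= 1)%R &
  (ret (2 * k) x `^ (2 * k)%:R^-1)%R @[k --> \oo] --> l}.
Proof.
(* Rational rates allow a single null set for all instances of the dichotomy. *)
have : {ae mu, forall x (pq : rat * rat), (0 < ratr pq.1 :> R)%R ->
    (ratr pq.1 < 1 :> R)%R -> (pq.1 < pq.2)%R -> X x ->
    (forall e, (0 < e)%R -> exists k, (ret (2 * k) x < e * (ratr pq.1) ^+ k)%R) ->
    exists C, forall m, (ret (2 * m) x <= C * (ratr pq.2) ^+ m)%R}.
  apply: ae_forall_count => -[p q] /=.
  have [p0|p0] := boolP (0 < ratr p :> R)%R; last exact: nearW.
  have [p1|p1] := boolP (ratr p < 1 :> R)%R; last exact: nearW.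
  have [pq|pq] := boolP (p < q)%R; last exact: nearW.
  have pqR : (ratr p < ratr q :> R)%R by rewrite ltr_rat.
  by apply: filterS (ret_dichotomy W mS eS p0 p1 pqR) => x H _ _ _ Xx; exact: H.
apply: filterS => x H Xx; apply: cvg_root => [k|p q p0 p1 pq].
  by rewrite ret_ge0 ret_le1.
exact: (H (p, q)).
Qed.

End return_asymptotics.

(** * The Green function and the bound it gives on the averaging operator *)

Section green.
Context {R : realType} d {T : measurableType d} {mu : probability T R}.
Variables (W : reversible_walk mu) (Sub : set (T * T)).
Hypotheses (mS : measurable Sub) (eS : is_equivalence Sub).
Local Notation X := (@wdom _ _ _ _ W).
Local Notation wt := (@wt _ _ _ _ W).
Local Notation step := (@step _ _ _ _ W).
Local Notation act := (@act _ _ _ _ W).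
Local Notation word := (@word _ _ _ _ W).
Local Notation wordn := (@wordn _ _ _ _ W).
Local Notation wordwt := (@wordwt _ _ _ _ W).
Local Notation avg := (@avg _ _ _ _ W).
Local Notation avgc := (@avgc _ _ _ _ W).
Local Notation cip := (@cip _ _ _ _ W Sub).
Local Notation coset_measurable := (@coset_measurable _ _ _ _ W Sub).
Local Notation orbit_cosets := (@orbit_cosets _ _ _ _ W Sub).
Local Notation ret := (@ret _ _ _ _ W Sub).
Local Notation eindic := (@eindic R d T).

Let mX : measurable X. Proof. exact: wdom_meas. Qed.
Local Hint Resolve mX : core.
Local Hint Resolve eindic_ge0 : core.

Lemma coset_measurable_hit m :
  coset_measurable (fun x c => iter m avg (eindic c) x).
Proof.
move=> w ww; have := coset_measurable_iter_avgc (Sub := Sub) m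
  (@diag_ge0 R d T setT) (@coset_measurable_diag _ _ _ _ W _ mS _ measurableT) ww.
by apply: eq_measurable_fun => x /set_mem Xx; rewrite iter_avgc_diag.
Qed.

Variables (E : set T) (s t : R).
Hypotheses (s0 : (0 < s)%R) (st : (s < t)%R).
Hypothesis ret_decay : forall y, X y -> E y ->
  exists C, forall m, (ret (2 * m) y <= C * (s ^+ 2) ^+ m)%R.

Let t0 : (0 < t)%R. Proof. exact: lt_trans st. Qed.

(* The Green function at the spectral parameter [t], seen as a function of the
   starting point: it is a positive [t]-superharmonic function. *)
Definition green x c := \sum_(m <oo) ((t ^- m)%:E * iter m avg (eindic c) x).

Lemma green_term_ge0 m x c : 0 <= (t ^- m)%:E * iter m avg (eindic c) x.
Proof. by rewrite mule_ge0 ?hit_ge0// lee_fin invr_ge0 exprn_ge0// ltW. Qed.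
Local Hint Resolve green_term_ge0 : core.

Lemma green_ge0 x c : 0 <= green x c.
Proof. exact: nneseries_ge0. Qed.

Lemma coset_measurable_green : coset_measurable green.
Proof.
move=> w ww; apply: (ge0_emeasurable_sum (P := predT)) => [m x _ _|m _] //.
by apply: measurable_funeM; exact: coset_measurable_hit.
Qed.

(** If a word leads from [x] to a point of [c], then going back along its inverse and hitting [c]
    after [m] more steps is a return to the class of that point. The assumed decay concerns even
    times only, so [m] must share the parity of the length of the word; each parity gets its own
    word, or the probabilities of that parity all vanish. *)
Lemma hit_decay x c : X x -> orbit_cosets x c -> c `<=` E ->
  exists C, forall m, iter m avg (eindic c) x <= (C * s ^+ m)%:E.
Proof.
move=> Xx xc cE.
have parity b : exists2 C, (0 <= C)%R & forall m, odd m = b ->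
    iter m avg (eindic c) x <= (C * s ^+ m)%:E.
  have [[m0 m0b m0P]|no] := pselect (exists2 m0, odd m0 = b &
      iter m0 avg (eindic c) x != 0); last first.
    exists 0%R => // m mb; rewrite mul0r; apply/eqP.
    have [->|h] := eqVneq (iter m avg (eindic c) x) 0; first by rewrite lexx.
    by exfalso; apply: no; exists m.
  have [//|w wm0 cw] := iter_avg_neq0 _ m0P.
  have ww : word w by case: wm0.
  have cy : c (act w x).
    apply: contrapT => ncy; move: cw.
    by rewrite /eindic indicE memNset// eqxx.
  have cE' : c = cls Sub (act w x).
    case: xc cy => v vv <- cvy; apply/(cls_eqP eS).
    exact: cvy.
  have Xy : X (act w x) by exact: act_wdom.
  have [C HC] := ret_decay Xy (cE _ cy).
  have wwi := word_winv ww; have dl := wordwt_gt0 wwi.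
  have C0 : (0 <= C)%R.
    by have := HC 0%N; rewrite expr0 mulr1; apply: le_trans; exact: ret_ge0.
  exists (C * s ^+ m0 / wordwt (winv w))%R.
    by rewrite divr_ge0 ?mulr_ge0 ?exprn_ge0 ?(ltW s0) ?(ltW dl).
  move=> m mb; rewrite -(@lee_pmul2l _ (wordwt (winv w))%:E)// -EFinM.
  have wn : wordn m0 (winv w).
    by split => //; rewrite size_rev size_map; case: wm0.
  have := iter_avg_word (act w x) (@hit_ge0 _ _ _ _ W m c) wn.
  rewrite act_winv// => /le_trans; apply; rewrite -iterD cE' -retE lee_fin.
  have e2 : (m0 + m = 2 * (m0 + m)./2)%N.
    by rewrite mul2n -[LHS]odd_double_half oddD m0b mb addbb.
  rewrite e2; apply: le_trans (HC _) _.
  rewrite -exprM -e2 exprD.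
  suff -> : (C * (s ^+ m0 * s ^+ m) =
    wordwt (winv w) * (C * s ^+ m0 / wordwt (winv w) * s ^+ m))%R by [].
  by field; rewrite gt_eqF.
have [C1 C10 H1] := parity true; have [C2 C20 H2] := parity false.
exists (C1 + C2)%R => m.
have sm0 : (0 <= s ^+ m)%R by rewrite exprn_ge0// ltW.
case: (boolP (odd m)) => [om|/negbTE om].
  by apply: le_trans (H1 m om) _; rewrite lee_fin ler_wpM2r// lerDl.
by apply: le_trans (H2 m om) _; rewrite lee_fin ler_wpM2r// lerDr.
Qed.

Lemma green_fin x c : X x -> orbit_cosets x c -> c `<=` E ->
  green x c \is a fin_num.
Proof.
move=> Xx xc cE; rewrite ge0_fin_numE ?green_ge0//.
have [C HC] := hit_decay Xx xc cE.
have C0 : (0 <= C)%R.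
  have := HC 0%N; rewrite expr0 mulr1 -lee_fin; apply: le_trans.
  exact: hit_ge0.
apply: (@le_lt_trans _ _ (\sum_(m <oo) C%:E * ((s / t) ^+ m)%:E)).
  apply: lee_nneseries => // m _.
  apply: le_trans (lee_wpmul2l _ (HC m)) _.
    by rewrite lee_fin invr_ge0 exprn_ge0// ltW.
  by rewrite -!EFinM lee_fin expr_div_n mulrCA [(s ^+ _ / _)%R]mulrC.
have st0 : (0 <= s / t)%R by rewrite divr_ge0// ltW.
rewrite nneseriesZl; last by move=> m _; rewrite lee_fin exprn_ge0.
rewrite nneseries_geometric -?EFinM ?ltry// st0/=.
by rewrite ltr_pdivrMr// mul1r.
Qed.

Lemma green_gt0 x c : X x -> orbit_cosets x c -> 0 < green x c.
Proof.
move=> Xx [w ww <-].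
apply: (@lt_le_trans _ _ ((t ^- size w)%:E *
    iter (size w) avg (eindic (cls Sub (act w x))) x)).
  rewrite mule_gt0// ?lte_fin ?invr_gt0 ?exprn_gt0//.
  have wn : wordn (size w) w by [].
  have cw : cls Sub (act w x) (act w x) by case: eS => r _ _; exact: r.
  apply: lt_le_trans (iter_avg_word x _ wn) => //.
  by rewrite /eindic indicE mem_set// mule1 lte_fin wordwt_gt0.
apply: le_trans (nneseries_lim_ge (size w).+1 _) => //.
by rewrite big_mkord big_ord_recr/= -[leLHS]add0e leeD ?sume_ge0.
Qed.

(** Averaging shifts the hitting times by one, so the result is [t] times the Green series without
    its term at time 0. *)
Lemma avgc_green x c : avgc green x c <= t%:E * green x c.
Proof.
have -> : avgc green x c =
    \sum_(m <oo) ((t ^- m)%:E * iter m.+1 avg (eindic c) x).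
  rewrite /avgc /avg /green.
  rewrite nneseries_esumT; last first.
    by move=> m; rewrite mule_ge0 ?hit_ge0// lee_fin invr_ge0 exprn_ge0// ltW.
  rewrite (eq_esum (b := fun i => \esum_(m in [set: nat])
      ((wt i)%:E * ((t ^- m)%:E * iter m avg (eindic c) (step i x))))); last first.
    move=> i Ji; rewrite nneseries_esumT// esumZl// lee_fin.
    exact: wt_ge0.
  rewrite esum_interchange; last first.
    by move=> i m; rewrite mule_ge0// lee_fin wt_ge0.
  apply: eq_esum => m _; rewrite iterS /avg -esumZl.
  - by apply: eq_esum => i _; rewrite muleCA.
  - by rewrite lee_fin invr_ge0 exprn_ge0// ltW.
  - by move=> i; rewrite mule_ge0 ?hit_ge0// lee_fin wt_ge0.
pose f m := t%:E * ((t ^- m)%:E * iter m avg (eindic c) x).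
have f0 m : 0 <= f m by rewrite mule_ge0// lee_fin ltW.
have -> : t%:E * green x c = \sum_(m <oo) f m by rewrite -nneseriesZl.
rewrite [leRHS]nneseries_recl// -(nneseries_addn 1 f0).
rewrite -[leLHS]add0e leeD//; apply: lee_nneseries => m _.
  by move=> _; rewrite mule_ge0 ?hit_ge0// lee_fin invr_ge0 exprn_ge0// ltW.
rewrite /f addn1 muleA -EFinM; set h := iter _ _ _ _.
suff -> : (t ^- m = t * t ^- m.+1)%R by [].
by rewrite exprS invfM mulrA mulfV ?mul1r// gt_eqF.
Qed.

(** Schur test in one step with weights [green] and [F ^ 2 / green]: the condition is the inequality
    between arithmetic and geometric means, and superharmonicity turns the averaged weight into
    [t * green], which cancels the denominator. *)
Lemma green_bound (F : T -> set T -> R) : (forall x c, 0 <= F x c)%R ->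
  coset_measurable (fun x c => (F x c)%:E) ->
  (forall x c, X x -> orbit_cosets x c -> F x c != 0%R -> c `<=` E) ->
  cip (avgc (fun x c => (F x c)%:E)) (fun x c => (F x c)%:E) <=
  t%:E * cip (fun x c => (F x c)%:E) (fun x c => (F x c)%:E).
Proof.
move=> F0 mF FE; set F' := fun x c => (F x c)%:E.
have F'0 x c : 0 <= F' x c by rewrite lee_fin.
pose O x c := (F x c ^+ 2 / fine (green x c))%:E.
have O0 x c : 0 <= O x c.
  by rewrite lee_fin divr_ge0 ?sqr_ge0// fine_ge0// green_ge0.
have mO : coset_measurable O.
  move=> w ww; apply/measurable_EFinP; apply: measurable_funM.
    by apply: measurable_funX; apply/measurable_EFinP; exact: mF.
  apply: measurable_fun_invr_ge0; first by move=> x; rewrite fine_ge0// green_ge0.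
  apply: measurableT_comp; last exact: coset_measurable_green.
  exact: fine_measurable.
have schur := cip_schur mS eS 1 F'0 green_ge0 O0 mF coset_measurable_green mO.
apply: le_trans (schur _) _.
  move=> x y c Xx xc [w ww wy]; have Xy : X y by rewrite -wy; exact: act_wdom.
  have yc : orbit_cosets y c.
    by move: xc; rewrite !orbit_cosetsE -wy orbit_act.
  have [Fx|Fx] := eqVneq (F x c) 0%R.
    by rewrite /F' Fx mul0e mule0 adde_ge0// mule_ge0// green_ge0.
  have cE := FE x c Xx xc Fx.
  have hx := green_gt0 Xx xc; have hy := green_gt0 Xy yc.
  rewrite /O -(fineK (green_fin Xx xc cE)) -(fineK (green_fin Xy yc cE)).
  have {}hx : (0 < fine (green x c))%R.
    by rewrite fine_gt0// hx ltey_eq green_fin.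
  have {}hy : (0 < fine (green y c))%R.
    by rewrite fine_gt0// hy ltey_eq green_fin.
  move: (fine (green x c)) (fine (green y c)) hx hy => a b a0 b0.
  rewrite /F' /= -!EFinM -EFinD lee_fin -subr_ge0.
  have -> : (b * (F x c ^+ 2 / a) + F y c ^+ 2 / b * a - 2%:R * (F x c * F y c) =
     (b * F x c - a * F y c) ^+ 2 / (a * b))%R.
    by field; rewrite !gt_eqF.
  by rewrite divr_ge0 ?sqr_ge0// mulr_ge0// ltW.
have mFF : coset_measurable (fun x c => F' x c * F' x c).
  exact: coset_measurableM.
rewrite /cip -ge0_integralZl//; last 3 first.
- by apply: measurable_fun_csum => // x c; rewrite mule_ge0.
- by move=> x _; apply: csum_ge0 => {}x c; rewrite mule_ge0.
- by rewrite lee_fin ltW.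
rewrite [leRHS](eq_integral (csum W Sub (fun x c => t%:E * (F' x c * F' x c)))); last first.
  by move=> x _; rewrite /csum esumZl ?lee_fin ?(ltW t0)// => c; rewrite mule_ge0.
apply: le_int_csum => //.
- by move=> x c; rewrite mule_ge0//; apply: avgc_ge0; exact: green_ge0.
- by move=> x c; rewrite !mule_ge0 ?lee_fin ?(ltW t0).
- apply: coset_measurableM => //.
  by apply: coset_measurable_avgc; [exact: green_ge0|exact: coset_measurable_green].
- by move=> w ww; apply: measurable_funeM; exact: mFF.
move=> x c Xx xc; apply: (@le_trans _ _ (t%:E * green x c * O x c)).
  by rewrite lee_wpmul2r//; exact: avgc_green.
have [Fx|Fx] := eqVneq (F x c) 0%R.
  by rewrite /O /F' Fx expr0n/= mul0r !mule0.
have cE := FE x c Xx xc Fx.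
rewrite /O -muleA -(fineK (green_fin Xx xc cE)) /F' -!EFinM lee_fin /=.
have hx : (0 < fine (green x c))%R.
  by rewrite fine_gt0// green_gt0//= ltey_eq green_fin.
suff -> : (t * (fine (green x c) * (F x c ^+ 2 / fine (green x c))) =
  t * (F x c * F x c))%R by [].
by field; rewrite gt_eqF.
Qed.

End green.

(** * No asymptotically invariant nonnegative vectors under exponential decay *)

Section asymptotic_invariance.
Context {R : realType} d {T : measurableType d} {mu : probability T R}.
Variables (W : reversible_walk mu) (Sub : set (T * T)).
Hypotheses (mS : measurable Sub) (eS : is_equivalence Sub).
Local Notation J := (@letters _ _ _ _ W).
Local Notation X := (@wdom _ _ _ _ W).
Local Notation wt := (@wt _ _ _ _ W).
Local Notation step := (@step _ _ _ _ W).
Local Notation cip := (@cip _ _ _ _ W Sub).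
Local Notation csum := (@csum _ _ _ _ W Sub).
Local Notation coset_measurable := (@coset_measurable _ _ _ _ W Sub).
Local Notation orbit_cosets := (@orbit_cosets _ _ _ _ W Sub).
Local Notation ret := (@ret _ _ _ _ W Sub).

Let mX : measurable X. Proof. exact: wdom_meas. Qed.
Local Hint Resolve mX : core.

Lemma finite_letters (t : R) : (t < 1)%R ->
  exists2 s : seq (letter W), uniq s /\ (forall i, i \in s -> J i) &
    (t < \sum_(i <- s) wt i)%R.
Proof.
move=> t1; apply: contrapT => no.
have : \esum_(i in J) (wt i)%:E <= t%:E.
  apply: ge_ereal_sup => _ [A [finA AJ] <-].
  rewrite fsbig_finite// sumEFin lee_fin leNgt; apply/negP => tA.
  apply: no; exists (finmap.enum_fset (fset_set A)) => //; split; first exact: finmap.fset_uniq.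
  by move=> i; rewrite in_fset_set// => /set_mem/AJ.
by rewrite wt_sum lee_fin leNgt t1.
Qed.

Lemma coset_measurable_sqrB (F G : T -> set T -> R) :
  coset_measurable (fun x c => (F x c)%:E) ->
  coset_measurable (fun x c => (G x c)%:E) ->
  coset_measurable (fun x c => ((F x c - G x c) ^+ 2)%:E).
Proof.
move=> mF mG w ww; apply/measurable_EFinP; apply: measurable_funX.
by apply: measurable_funB; apply/measurable_EFinP; [exact: mF|exact: mG].
Qed.

Lemma csum_step (F : T -> set T -> \bar R) i x : J i -> X x ->
  csum (fun x c => F (step i x) c) x = csum F (step i x).
Proof. by move=> Ji Xx; rewrite /csum orbit_cosets_step. Qed.

Variables (E : set T) (s t : R).
Hypotheses (s0 : (0 < s)%R) (st : (s < t)%R) (t1 : (t < 1)%R).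
Hypothesis ret_decay : forall y, X y -> E y ->
  exists C, forall m, (ret (2 * m) y <= C * (s ^+ 2) ^+ m)%R.

(** With unit fibres, the displacement under a letter plus twice the correlation [K] is 2. Dominated
    convergence, with the constant 2 as bound, makes each correlation tend to 1. Finitely many
    letters already carry weight more than [t], against the bound [t] from [green_bound]. *)
Lemma no_asymptotically_invariant (F : nat -> T -> set T -> R) :
  (forall n x c, 0 <= F n x c)%R ->
  (forall n, coset_measurable (fun x c => (F n x c)%:E)) ->
  (forall n x c, X x -> orbit_cosets x c -> F n x c != 0%R -> c `<=` E) ->
  (forall n x, X x -> csum (fun x c => (F n x c ^+ 2)%:E) x = 1) ->
  (forall i x, J i -> X x ->
    csum (fun x c => ((F n (step i x) c - F n x c) ^+ 2)%:E) x @[n --> \oo] --> 0) ->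
  False.
Proof.
move=> F0 mF FE F1 Finv.
pose D i n x := csum (fun x c => ((F n (step i x) c - F n x c) ^+ 2)%:E) x.
pose K i n := cip (fun x c => (F n (step i x) c)%:E) (fun x c => (F n x c)%:E).
have D0 i n x : 0 <= D i n x.
  by apply: csum_ge0 => {}x c; rewrite lee_fin sqr_ge0.
have mstep i n : J i -> coset_measurable (fun x c => (F n (step i x) c)%:E).
  by move=> Ji; apply: (coset_measurable_step (F := fun x c => (F n x c)%:E)).
have mD i n : J i -> measurable_fun X (D i n).
  move=> Ji; apply: measurable_fun_csum => //.
    by move=> x c; rewrite lee_fin sqr_ge0.
  by apply: coset_measurable_sqrB => //; exact: mstep.
have mK i n : J i -> measurable_fun X
    (csum (fun x c => (F n (step i x) c)%:E * (F n x c)%:E)).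
  move=> Ji; apply: measurable_fun_csum => //.
    by move=> x c; rewrite mule_ge0// lee_fin.
  by apply: coset_measurableM => //; exact: mstep.
have K0 i n x : 0 <= csum (fun x c => (F n (step i x) c)%:E * (F n x c)%:E) x.
  by apply: csum_ge0 => {}x c; rewrite mule_ge0// lee_fin.
have DK i n x : J i -> X x ->
    D i n x + 2%:E * csum (fun x c => (F n (step i x) c)%:E * (F n x c)%:E) x = 2%:E.
  move=> Ji Xx.
  rewrite [LHS](esum_sqrB _ (a := F n (step i x)) (b := F n x))//.
  rewrite [X in X + _](csum_step (fun x c => (F n x c ^+ 2)%:E))//.
  by rewrite [X in _ + X]F1// F1//; exact: step_wdom.
have intDK i n : J i -> \int[mu]_(x in X) D i n x + 2%:E * K i n = 2%:E.
  move=> Ji; rewrite /K -ge0_integralZl//; last exact: mK.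
  rewrite -ge0_integralD//; last 3 first.
  - exact: mD.
  - by move=> x _; rewrite mule_ge0.
  - by apply: measurable_funeM; exact: mK.
  rewrite (eq_integral (cst 2%:E)); last by move=> x /set_mem Xx; exact: DK.
  by rewrite integral_cst// [X in _ * X](measure_wdom W) mule1.
have Dcvg i : J i -> \int[mu]_(x in X) D i n x @[n --> \oo] --> 0.
  move=> Ji; rewrite -(@integral0 _ _ _ mu X).
  have [| | | |_ _] := @dominated_convergence _ _ _ mu X mX (D i) (cst 0)
    (cst 2%:E) (fun n => mD i n Ji).
  - exact: measurable_cst.
  - by apply: nearW => x Xx; exact: Finv.
  - exact: (finite_measure_integrable_cst mu 2%R mX).
  - apply: nearW => x n Xx; rewrite gee0_abs// -[leRHS](DK i n x Ji Xx) leeDl//.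
    by rewrite mule_ge0.
  - exact.
have [r [ru rJ] tr] := finite_letters t1.
have Kfin i n : J i -> (K i n <= 1).
  move=> Ji; rewrite -(@lee_pmul2l _ 2%:E)// mule1 -[leRHS](intDK i n Ji) leeDr//.
  exact: integral_ge0.
have K00 i n : 0 <= K i n by apply: integral_ge0 => x _.
have sumK n : \sum_(i <- r) (wt i)%:E * K i n <= t%:E.
  have := green_bound mS eS s0 st ret_decay (F0 n) (mF n) (FE n).
  rewrite [X in _ <= _ * X](_ : _ = 1); last first.
    rewrite /cip (eq_integral (cst 1)).
      by rewrite integral_cst// mul1e; exact: measure_wdom.
    move=> x /set_mem Xx; rewrite -[RHS](F1 n x Xx); apply: eq_esum => c _.
    by rewrite -EFinM expr2.
  rewrite mule1; apply: le_trans; rewrite cip_avgcl//; last 2 first.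
  - by move=> x c; rewrite lee_fin.
  - by move=> x c; rewrite lee_fin.
  apply: esum_ge; exists [set` r].
    by split; [exact: finite_seq|move=> i /= /rJ].
  by rewrite fsbig_seq.
pose k i n := fine (K i n).
have kE i n : J i -> (k i n)%:E = K i n.
  move=> Ji; rewrite fineK// ge0_fin_numE//.
  exact: le_lt_trans (Kfin i n Ji) (ltry _).
have kcvg i : i \in r -> k i n @[n --> \oo] --> (1 : R)%R.
  move=> /rJ Ji.
  have : (1 - 2^-1 * fine (\int[mu]_(x in X) D i n x))%R @[n --> \oo] --> (1 : R)%R.
    rewrite -[X in _ --> X]subr0 -[X in (1 - X)%R](mulr0 (2^-1 : R)%R).
    apply: cvgB; first exact: cvg_cst.
    apply: cvgM; first exact: cvg_cst.
    by apply: fine_cvg; exact: Dcvg.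
  apply: cvg_trans; apply: near_eq_cvg; apply: nearW => n.
  have := intDK i n Ji; rewrite -kE//.
  have : \int[mu]_(x in X) D i n x \is a fin_num.
    rewrite ge0_fin_numE; last exact: integral_ge0.
    apply: (@le_lt_trans _ _ 2%:E); last exact: ltry.
    by rewrite -[leRHS](intDK i n Ji) leeDl// mule_ge0.
  move=> /fineK <- /=; rewrite -EFinM -EFinD => -[e].
  by lra.
have sumcvg (q : seq (letter W)) : {subset q <= r} ->
    (\sum_(i <- q) wt i * k i n)%R @[n --> \oo] --> (\sum_(i <- q) wt i)%R.
  elim: q => [|i q ih] qr.
    under eq_cvg do rewrite big_nil; rewrite big_nil; exact: cvg_cst.
  under eq_cvg do rewrite big_cons; rewrite big_cons; apply: cvgD.
    rewrite -[X in _ --> X]mulr1; apply: cvgM; first exact: cvg_cst.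
    apply: kcvg.
    by apply: qr; rewrite inE eqxx.
  by apply: ih => j jq; apply: qr; rewrite inE jq orbT.
suff : (\sum_(i <- r) wt i <= t)%R by rewrite leNgt tr.
apply: (cvgr_to_le (sumcvg r (fun _ => id))); apply: nearW => n.
rewrite -lee_fin -sumEFin; apply: le_trans (sumK n).
rewrite big_seq [leRHS]big_seq lee_sum// => i ir.
by rewrite EFinM kE//; exact: rJ.
Qed.

End asymptotic_invariance.

(** * Almost invariant vectors from slowly decaying moments *)

Section almost_invariant_vectors.
Context {R : realType} d {T : measurableType d} {mu : probability T R}.
Variables (W : reversible_walk mu) (Sub : set (T * T)).
Hypotheses (mS : measurable Sub) (eS : is_equivalence Sub).
Local Notation J := (@letters _ _ _ _ W).
Local Notation X := (@wdom _ _ _ _ W).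
Local Notation wt := (@wt _ _ _ _ W).
Local Notation step := (@step _ _ _ _ W).
Local Notation avgc := (@avgc _ _ _ _ W).
Local Notation cip := (@cip _ _ _ _ W Sub).
Local Notation csum := (@csum _ _ _ _ W Sub).
Local Notation coset_measurable := (@coset_measurable _ _ _ _ W Sub).
Local Notation orbit_cosets := (@orbit_cosets _ _ _ _ W Sub).
Implicit Types F G : T -> set T -> \bar R.

Let mX : measurable X. Proof. exact: wdom_meas. Qed.
Local Hint Resolve mX : core.

Lemma cipZl (k : \bar R) F G : 0 <= k ->
  (forall x c, 0 <= F x c) -> (forall x c, 0 <= G x c) ->
  coset_measurable F -> coset_measurable G ->
  cip (fun x c => k * F x c) G = k * cip F G.
Proof.
move=> k0 F0 G0 mF mG; rewrite /cip -ge0_integralZl//.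
- apply: eq_integral => x _; rewrite /csum -esumZl//.
    by apply: eq_esum => c _; rewrite muleA.
  by move=> c; rewrite mule_ge0.
- apply: measurable_fun_csum => //; first by move=> x c; rewrite mule_ge0.
  exact: coset_measurableM.
- by move=> x _; apply: csum_ge0 => {}x c; rewrite mule_ge0.
Qed.

Lemma cipD F1 F2 G :
  (forall x c, 0 <= F1 x c) -> (forall x c, 0 <= F2 x c) ->
  (forall x c, 0 <= G x c) ->
  coset_measurable F1 -> coset_measurable F2 -> coset_measurable G ->
  cip (fun x c => F1 x c + F2 x c) G = cip F1 G + cip F2 G.
Proof.
move=> F10 F20 G0 mF1 mF2 mG; rewrite -(cipDl mS eS)//.
by apply: eq_integral => x _; apply: eq_esum => c _; rewrite ge0_muleDl.
Qed.

(** Each letter preserves the norm of [F], so its displacement plus twice its correlation is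
    $2\langle F,F\rangle$; averaging over the letters produces $\langle\lambda F,F\rangle$. The
    identity is additive because the terms may be infinite. *)
Lemma avg_dist_cip (F : T -> set T -> R) : (forall x c, 0 <= F x c)%R ->
  coset_measurable (fun x c => (F x c)%:E) ->
  (\esum_(i in J) ((wt i)%:E *
    \int[mu]_(x in X) csum (fun x c => ((F (step i x) c - F x c) ^+ 2)%:E) x)) +
  2%:E * cip (avgc (fun x c => (F x c)%:E)) (fun x c => (F x c)%:E) =
  2%:E * cip (fun x c => (F x c)%:E) (fun x c => (F x c)%:E).
Proof.
move=> F0 mF; set F' := fun x c => (F x c)%:E.
have F'0 x c : 0 <= F' x c by rewrite lee_fin.
have mstep i : J i -> coset_measurable (fun x c => F' (step i x) c).
  by move=> Ji; apply: coset_measurable_step.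
pose D i x := csum (fun x c => ((F (step i x) c - F x c) ^+ 2)%:E) x.
have D0 i x : 0 <= D i x.
  by apply: csum_ge0 => {}x c; rewrite lee_fin sqr_ge0.
have mD i : J i -> measurable_fun X (D i).
  move=> Ji; apply: measurable_fun_csum => //.
    by move=> x c; rewrite lee_fin sqr_ge0.
  by apply: coset_measurable_sqrB => //; exact: mstep.
have m1 F1 : (forall x c, 0 <= F1 x c) -> coset_measurable F1 ->
    measurable_fun X (csum F1).
  by move=> F10 mF1; exact: measurable_fun_csum.
have intD i : J i -> \int[mu]_(x in X) D i x +
    2%:E * cip (fun x c => F' (step i x) c) F' = 2%:E * cip F' F'.
  move=> Ji.
  have -> : 2%:E * cip F' F' =
      cip (fun x c => F' (step i x) c) (fun x c => F' (step i x) c) + cip F' F'.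
    rewrite mule_natl mule2n; congr (_ + _).
    rewrite (cip_step mS eS Ji F'0) //; last exact: mstep.
    apply: eq_integral => x /set_mem Xx; apply: eq_esum => c _.
    congr (_ * F' _ _).
    have Jli := letters_linv Ji.
    by have := @step_linv _ _ _ _ W _ _ Jli Xx; rewrite linvK.
  have m2 G1 G2 : (forall x c, 0 <= G1 x c) -> (forall x c, 0 <= G2 x c) ->
      coset_measurable G1 -> coset_measurable G2 ->
      measurable_fun X (csum (fun x c => G1 x c * G2 x c)).
    move=> G10 G20 mG1 mG2; apply: m1; first by move=> x c; rewrite mule_ge0.
    exact: coset_measurableM.
  have mss := m2 _ _ (fun x => F'0 (step i x)) (fun x => F'0 (step i x))
    (mstep i Ji) (mstep i Ji).
  have msf := m2 _ _ (fun x => F'0 (step i x)) F'0 (mstep i Ji) mF.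
  have mff := m2 _ _ F'0 F'0 mF mF.
  have p0 (G1 G2 : T -> set T -> \bar R) x : (forall x c, 0 <= G1 x c) ->
      (forall x c, 0 <= G2 x c) -> 0 <= csum (fun x c => G1 x c * G2 x c) x.
    by move=> G10 G20; apply: csum_ge0 => {}x c; rewrite mule_ge0.
  rewrite /cip -ge0_integralZl//; last by move=> x _; exact: p0.
  rewrite -!ge0_integralD//; try (by move=> x _; exact: p0);
    try exact: mss; try exact: mff; try exact: mD; last 2 first.
  - by move=> x _; rewrite mule_ge0//; exact: p0.
  - exact: measurable_funeM.
  apply: eq_integral => x _.
  have := esum_sqrB (orbit_cosets x) (F0 (step i x)) (F0 x).
  under eq_esum do rewrite EFinM; move=> ->.
  by congr (_ + _); apply: eq_esum.
have c0 : 0 <= 2%:E * cip F' F' by rewrite mule_ge0// cip_ge0.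
rewrite -[RHS]mule1 -(@wt_sum _ _ _ _ W) -esumZl//; last first.
  by move=> i; rewrite lee_fin wt_ge0.
rewrite cip_avgcl// -esumZl//; last first.
  by move=> i; rewrite mule_ge0 ?lee_fin ?wt_ge0 ?cip_ge0.
rewrite -esumD; last 2 first.
- move=> i _; rewrite mule_ge0 ?lee_fin ?wt_ge0//.
  by apply: integral_ge0 => x _; exact: D0.
- by move=> i _; rewrite !mule_ge0 ?lee_fin ?wt_ge0 ?cip_ge0.
apply: eq_esum => i Ji; rewrite muleCA -ge0_muleDr; last 2 first.
- by apply: integral_ge0 => x _; exact: D0.
- by rewrite mule_ge0// cip_ge0.
by rewrite intD// muleC.
Qed.

End almost_invariant_vectors.

Section slow_decay.
Context {R : realType}.

(** Otherwise [D] would eventually contract by the factor [1 - e] at every step, which is faster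
    than the growth hypothesis allows. *)
Lemma slow_decay (M : nat -> R) (e : R) : (forall j, 0 <= M j)%R ->
  (forall r, (0 < r)%R -> (r < 1)%R -> exists2 dl : R, (0 < dl)%R &
    \forall k \near \oo, (dl * r ^+ k <= M (2 * k)%N)%R) ->
   (0 < e)%R -> (e < 1)%R -> exists m,
  let D k := (M (2 * k)%N + M (2 * k).+1)%R in
  (0 < D m)%R /\ (D m - D m.+1 <= e * D m)%R.
Proof.
move=> M0 Mgrowth e0 e1; apply: contrapT => /forallNP no.
pose D k := (M (2 * k)%N + M (2 * k).+1)%R.
have D0 k : (0 <= D k)%R by rewrite addr_ge0 ?M0.
(* Any rate strictly between [1 - e] and 1 would do. *)
pose r := (1 - e / 2)%R.
have r0 : (0 < r)%R by rewrite /r; lra.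
have r1 : (r < 1)%R by rewrite /r; lra.
have er : (1 - e < r)%R by rewrite /r; lra.
have e10 : (0 <= 1 - e)%R by lra.
have [dl dl0 [N _ HN]] := Mgrowth r r0 r1.
have DN k : (N <= k)%N -> (dl * r ^+ k <= D k)%R.
  by move=> Nk; apply: le_trans (HN k Nk) _; rewrite lerDl M0.
have Dstep k : (N <= k)%N -> (D k.+1 <= (1 - e) * D k)%R.
  move=> Nk; rewrite leNgt; apply/negP => Dk; apply: (no k) => /=.
  split; first by apply: lt_le_trans (DN k Nk); rewrite mulr_gt0// exprn_gt0.
  by rewrite -/(D k) -/(D k.+1); lra.
have Dgeo k : (D (N + k)%N <= (1 - e) ^+ k * D N)%R.
  elim: k => [|k ih]; first by rewrite addn0 expr0 mul1r.
  rewrite addnS; apply: le_trans (Dstep _ (leq_addr _ _)) _.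
  by rewrite exprS -mulrA ler_wpM2l.
have c0 : (0 < dl * r ^+ N / (D N + 1))%R.
  by rewrite divr_gt0 ?mulr_gt0 ?exprn_gt0// ltr_wpDl.
have [L _ /(_ L (leqnn L)) /=] := near_exp_ltM e10 er c0.
have DN1 : (0 < D N + 1)%R by rewrite ltr_wpDl.
rewrite mulrAC ltr_pdivlMr// ltNge => /negP; apply.
rewrite -mulrA -exprD; apply: le_trans (DN (N + L)%N (leq_addr _ _)) _.
apply: le_trans (Dgeo L) _; rewrite ler_wpM2l ?exprn_ge0//.
by rewrite lerDl.
Qed.

End slow_decay.

Section spectral_radius_one.
Context {R : realType} d {T : measurableType d} {mu : probability T R}.
Variables (W : reversible_walk mu) (Sub : set (T * T)).
Hypotheses (mS : measurable Sub) (eS : is_equivalence Sub).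
Local Notation J := (@letters _ _ _ _ W).
Local Notation X := (@wdom _ _ _ _ W).
Local Notation wt := (@wt _ _ _ _ W).
Local Notation step := (@step _ _ _ _ W).
Local Notation act := (@act _ _ _ _ W).
Local Notation avgc := (@avgc _ _ _ _ W).
Local Notation cip := (@cip _ _ _ _ W Sub).
Local Notation csum := (@csum _ _ _ _ W Sub).
Local Notation coset_measurable := (@coset_measurable _ _ _ _ W Sub).
Local Notation orbit_cosets := (@orbit_cosets _ _ _ _ W Sub).
Local Notation ret := (@ret _ _ _ _ W Sub).
Local Notation diag := (@diag R d T).
Implicit Types F G : T -> set T -> \bar R.

Let mX : measurable X. Proof. exact: wdom_meas. Qed.
Local Hint Resolve mX : core.

Variable E : set T.
Hypotheses (mE : measurable E) (Einv : rel_invariant Sub E).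

Let phi j := iter j avgc (diag E).

Let phi0 j x c : 0 <= phi j x c.
Proof. by apply: iter_avgc_ge0 => {}x {}c; exact: diag_ge0. Qed.

Let mphi j : coset_measurable (phi j).
Proof.
apply: coset_measurable_iter_avgc; first exact: diag_ge0.
exact: coset_measurable_diag.
Qed.

Lemma diag_le1 Z x c : diag Z x c <= 1.
Proof. by rewrite /diag lee_fin mulr_ile1// indicE lern1 leq_b1. Qed.

Let phi_le1 j x c : phi j x c <= 1.
Proof.
rewrite /phi iter_avgcE; apply: iter_avg_le1 => y; first exact: diag_ge0.
exact: diag_le1.
Qed.

Let phi_fin j x c : phi j x c \is a fin_num.
Proof.
by rewrite ge0_fin_numE// (le_lt_trans (phi_le1 j x c))// ltry.
Qed.

Let A j := cip (phi j) (diag E).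

Let AE i j : cip (phi i) (phi j) = A (j + i).
Proof.
rewrite /A /phi iterD -(cip_iter_avgc mS eS j _ _ (mphi i))//.
- exact: diag_ge0.
- exact: coset_measurable_diag.
Qed.

Let A0 j : 0 <= A j.
Proof. by apply: cip_ge0 => //; exact: diag_ge0. Qed.

Let A_le1 j : A j <= 1.
Proof.
rewrite /A cip_diag//; apply: (@le_trans _ _ (\int[mu]_(x in X) cst 1 x)).
  apply: ge0_le_integral => //.
  - by move=> x _; rewrite mule_ge0// lee_fin.
  - apply: emeasurable_funM; first exact: (mphi _ (@word_nil _ _ _ _ W)).
    by apply/measurable_EFinP; exact: measurable_indic.
  - move=> x _; rewrite -[leRHS]mule1; apply: lee_pmul => //.
    by rewrite lee_fin indicE lern1 leq_b1.
by rewrite integral_cst// mul1e; apply: probability_le1.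
Qed.

Definition moment j : R := fine (cip (iter j avgc (diag E)) (diag E)).

Let momentE j : (moment j)%:E = A j.
Proof.
rewrite /moment fineK// ge0_fin_numE; last exact: A0.
exact: le_lt_trans (A_le1 j) (ltry _).
Qed.

Let phi_moment i j : cip (phi i) (phi j) = (moment (j + i))%:E.
Proof. by rewrite AE momentE. Qed.

Lemma moment_ge0 j : (0 <= moment j)%R.
Proof. by rewrite -lee_fin momentE. Qed.

Lemma moment_ret k : (moment k)%:E =
  \int[mu]_(x in X) ((ret k x)%:E * (\1_E x)%:E).
Proof.
rewrite momentE /A cip_diag//; apply: eq_integral => x /set_mem Xx.
have [Ex|nEx] := pselect (E x); last by rewrite indicE memNset// !mule0.
congr (_ * _); rewrite retE /phi iter_avgc_diag// => y _.
by move=> xSy; exact: Einv xSy Ex.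
Qed.

Hypothesis moment_growth : forall r, (0 < r)%R -> (r < 1)%R ->
  exists2 dl : R, (0 < dl)%R &
    \forall k \near \oo, (dl * r ^+ k <= moment (2 * k))%R.

(** The vector is a multiple of $b=(1+\lambda)\lambda^m\zeta$ with $\zeta$ the diagonal of [E]. The
    factor $1+\lambda$ damps spectrum near $-1$, where $\lambda^m\zeta$ alone may be far from
    invariant. In terms of moments $\langle b,b\rangle-\langle\lambda b,b\rangle$ equals
    [D m - D m.+1], and $\langle b,b\rangle\ge$ [D m]; [slow_decay] supplies [m]. *)
Lemma almost_invariant_vector (e : R) : (0 < e)%R -> (e < 1)%R ->
  exists F : T -> set T -> R, [/\ forall x c, (0 <= F x c)%R,
    coset_measurable (fun x c => (F x c)%:E),
    forall x c, X x -> orbit_cosets x c -> F x c != 0%R -> c `<=` E,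
    cip (fun x c => (F x c)%:E) (fun x c => (F x c)%:E) = 1 &
    \esum_(i in J) ((wt i)%:E * \int[mu]_(x in X)
      csum (fun x c => ((F (step i x) c - F x c) ^+ 2)%:E) x) <= (2 * e)%:E].
Proof.
move=> e0 e1.
have [M [M0 phiM [m [Dm0 Dm]]]] : exists M : nat -> R,
    [/\ forall j, (0 <= M j)%R,
      forall i j, cip (phi i) (phi j) = (M (j + i)%N)%:E &
      exists m, let D k := (M (2 * k)%N + M (2 * k).+1)%R in
        (0 < D m)%R /\ (D m - D m.+1 <= e * D m)%R].
  exists moment; split; [exact: moment_ge0|exact: phi_moment|].
  exact: slow_decay moment_ge0 moment_growth e0 e1.
pose b x c := phi m x c + phi m.+1 x c.
have b0 x c : 0 <= b x c by rewrite adde_ge0.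
have mb : coset_measurable b by exact: coset_measurableD.
have bfin x c : b x c \is a fin_num by rewrite fin_numD !phi_fin.
pose n2 := (M (2 * m)%N + 2 * M (2 * m).+1 + M (2 * m).+2)%R.
have i0 : (m + m = 2 * m)%N by rewrite mul2n addnn.
have i1 : (m + m.+1 = (2 * m).+1)%N by rewrite addnS i0.
have i2 : (m.+1 + m = (2 * m).+1)%N by rewrite addSn i0.
have i3 : (m.+1 + m.+1 = (2 * m).+2)%N by rewrite addnS i2.
have i4 : (m.+2 + m = (2 * m).+2)%N by rewrite addSn i2.
have i5 : (m.+2 + m.+1 = (2 * m).+3)%N by rewrite addSn i3.
have i6 : (m + m.+2 = (2 * m).+2)%N by rewrite addnS i1.
have i7 : (m.+1 + m.+2 = (2 * m).+3)%N by rewrite addnS i3.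
have bb : cip b b = n2%:E.
  rewrite cipD// ![cip _ b]cipC !cipD// !phiM /n2.
  rewrite ?(i0, i1, i2, i3, i4, i5, i6, i7).
  rewrite -?EFinD.
  move: (M (2 * m)%N) (M (2 * m).+1) (M (2 * m).+2) (M (2 * m).+3) => p q r u.
  by congr (_%:E); ring.
have Lb : cip (avgc b) b = (M (2 * m).+1 + 2 * M (2 * m).+2 +
    M (2 * m).+3)%:E.
  have -> : avgc b = (fun x c => phi m.+1 x c + phi m.+2 x c).
    apply/funext => x; apply/funext => c.
    exact: (@iter_avgD _ _ _ _ W 1 _ _ x (phi0 m ^~ c) (phi0 m.+1 ^~ c)).
  rewrite cipD// ![cip _ b]cipC !cipD// !phiM.
  rewrite ?(i0, i1, i2, i3, i4, i5, i6, i7).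
  rewrite -?EFinD.
  move: (M (2 * m)%N) (M (2 * m).+1) (M (2 * m).+2) (M (2 * m).+3) => p q r u.
  by congr (_%:E); ring.
have n20 : (0 < n2)%R.
  by have := M0 (2 * m).+1; have := M0 (2 * m).+2; rewrite /n2; lra.
pose k := (Num.sqrt n2)^-1%R.
have k0 : (0 <= k)%R by rewrite invr_ge0 sqrtr_ge0.
have kk : (k * k = n2^-1)%R by rewrite -expr2 exprVn sqr_sqrtr// ltW.
pose F x c := (k * fine (b x c))%R.
have FE x c : (F x c)%:E = k%:E * b x c by rewrite EFinM fineK.
have FE' : (fun x c => (F x c)%:E) = (fun x c => k%:E * b x c).
  by apply/funext => x; apply/funext => c.
have F0 x c : (0 <= F x c)%R by rewrite mulr_ge0// fine_ge0.
have mF : coset_measurable (fun x c => (F x c)%:E).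
  by rewrite FE' => w ww; apply: measurable_funeM; exact: mb.
have kb0 x c : 0 <= k%:E * b x c by rewrite mule_ge0.
have mkb : coset_measurable (fun x c => k%:E * b x c) by rewrite -FE'.
have FF : cip (fun x c => (F x c)%:E) (fun x c => (F x c)%:E) = 1.
  by rewrite FE' cipZl// cipC cipZl// bb -!EFinM mulrA kk mulVf// gt_eqF.
have LF : cip (avgc (fun x c => (F x c)%:E)) (fun x c => (F x c)%:E) =
    (k * k)%:E * cip (avgc b) b.
  rewrite FE' (_ : avgc _ = fun x c => k%:E * avgc b x c); last first.
    apply/funext => x; apply/funext => c.
    exact: (@iter_avgZ _ _ _ _ W 1 _ _ x _ (b0 ^~ c)).
  have mLb := coset_measurable_avgc b0 mb.
  have Lb0 := avgc_ge0 W b0.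
  by rewrite cipZl// cipC cipZl// cipC muleA EFinM.
exists F; split => //.
(* A nonzero value means that the walk reaches a point of [c] in [E], and [E] is a union of
   [Sub]-classes. *)
- move=> x c Xx xc Fxc y cy; apply: contrapT => nEy; move/eqP : Fxc; apply.
  suff phi_eq0 j : phi j x c = 0 by rewrite /F /b !phi_eq0 adde0 mulr0.
  rewrite /phi iter_avgcE; apply/eqP; apply: contraT => /iter_avg_neq0[z|w wj].
    exact: diag_ge0.
  rewrite /diag; set z := act w x => /eqP; case.
  have [cz|ncz] := pselect (c z); last by rewrite (indicE _ c) memNset// mulr0.
  rewrite (indicE _ E) memNset ?mul0r// => Ez; apply: nEy.
  case: xc cy cz => v vv <- cy cz; apply: Einv Ez.
  case: eS => _ sy tr; exact: tr (sy _ _ cz) cy.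
- have := avg_dist_cip mS eS F0 mF; rewrite FF LF Lb kk mule1 => H.
  have L0 : 0 <= (n2^-1)%:E * (M (2 * m).+1 + 2 * M (2 * m).+2 +
      M (2 * m).+3)%:E.
    by rewrite -EFinM lee_fin mulr_ge0 ?invr_ge0 ?(ltW n20)// !addr_ge0 ?mulr_ge0 ?M0.
  move: H; set S := \esum_(i in J) _ => H.
  have S0 : 0 <= S.
    apply: esum_ge0 => i _; rewrite mule_ge0 ?lee_fin ?wt_ge0//.
    by apply: integral_ge0 => x _; apply: csum_ge0 => {}x c; rewrite lee_fin sqr_ge0.
  have Sfin : S \is a fin_num.
    rewrite ge0_fin_numE//; apply: (@le_lt_trans _ _ 2%:E); last exact: ltry.
    by rewrite -H leeDl// mule_ge0.
  rewrite -(fineK Sfin) lee_fin; move: H; rewrite -(fineK Sfin) -!EFinM -EFinD => -[H].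
  have Dm' : (n2 - (M (2 * m).+1 + 2 * M (2 * m).+2 +
      M (2 * m).+3) <= e * n2)%R.
    move: Dm; rewrite /n2 mulnS !addSn add0n => Dm.
    have h1 := M0 (2 * m).+1; have h2 := M0 (2 * m).+2.
    have : (0 <= e * (M (2 * m).+1 + M (2 * m).+2))%R.
      by rewrite mulr_ge0 ?addr_ge0// ltW.
    by lra.
  have -> : fine S = (2 * (n2^-1 * (n2 - (M (2 * m).+1 +
      2 * M (2 * m).+2 + M (2 * m).+3))))%R.
    by rewrite mulrBr mulVf ?gt_eqF//; lra.
  rewrite ler_wpM2l// mulrC ler_pdivrMr//.
Qed.

End spectral_radius_one.

(** * Inequalities for $\ell^2$ norms and distances *)

Section l2_distance.
Context {R : realType} {I : choiceType} (A : set I).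

(** Cauchy-Schwarz, by summing $2ab\le la^2+l^{-1}b^2$ with the optimal $l=\sqrt q/\sqrt p$; this
    needs both norms nonzero, so vanishing ones are treated apart. *)
Lemma esum_mul_le_sqrt (a b : I -> R) (p q : R) :
  (forall i, 0 <= a i)%R -> (forall i, 0 <= b i)%R ->
  \esum_(i in A) (a i ^+ 2)%:E = p%:E -> \esum_(i in A) (b i ^+ 2)%:E = q%:E ->
  \esum_(i in A) (a i * b i)%:E <= (Num.sqrt p * Num.sqrt q)%:E.
Proof.
move=> a0 b0 ap bq.
have p0 : (0 <= p)%R.
  by rewrite -lee_fin -ap; apply: esum_ge0 => i _; rewrite lee_fin sqr_ge0.
have q0 : (0 <= q)%R.
  by rewrite -lee_fin -bq; apply: esum_ge0 => i _; rewrite lee_fin sqr_ge0.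
have zero (c : I -> R) : \esum_(i in A) (c i ^+ 2)%:E = 0 ->
    forall i, A i -> c i = 0%R.
  move=> c0 i Ai; apply/eqP; rewrite -sqrf_eq0 eq_le sqr_ge0 andbT -lee_fin.
  apply: (@le_trans _ _ (\esum_(i in A) (c i ^+ 2)%:E)); last by rewrite c0.
  apply: (esum_ge1 (a := fun i => (c i ^+ 2)%:E)) => // j _.
  by rewrite lee_fin sqr_ge0.
have [pz|pn] := eqVneq p 0%R.
  rewrite pz in ap; rewrite esum1; first by rewrite lee_fin mulr_ge0 ?sqrtr_ge0.
  by move=> i Ai; rewrite (zero a ap i Ai) mul0r.
have [qz|qn] := eqVneq q 0%R.
  rewrite qz in bq; rewrite esum1; first by rewrite lee_fin mulr_ge0 ?sqrtr_ge0.
  by move=> i Ai; rewrite (zero b bq i Ai) mulr0.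
have sp : (0 < Num.sqrt p)%R by rewrite sqrtr_gt0 lt_def pn.
have sq : (0 < Num.sqrt q)%R by rewrite sqrtr_gt0 lt_def qn.
pose l := (Num.sqrt q / Num.sqrt p)%R.
have l0 : (0 < l)%R by rewrite divr_gt0.
rewrite -(@lee_pmul2l _ 2%:E)// -esumZl//; last first.
  by move=> i; rewrite lee_fin mulr_ge0.
apply: (@le_trans _ _ (\esum_(i in A)
    (l%:E * (a i ^+ 2)%:E + (l^-1)%:E * (b i ^+ 2)%:E))).
  apply: le_esum => i _; rewrite -!EFinM -EFinD lee_fin -subr_ge0.
  have -> : (l * a i ^+ 2 + l^-1 * b i ^+ 2 - 2%:R * (a i * b i) =
     (l * a i - b i) ^+ 2 / l)%R by field; rewrite gt_eqF.
  by rewrite divr_ge0 ?sqr_ge0// ltW.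
rewrite esumD; last 2 first.
- by move=> i _; rewrite -EFinM lee_fin mulr_ge0 ?sqr_ge0// ltW.
- by move=> i _; rewrite -EFinM lee_fin mulr_ge0 ?sqr_ge0// invr_ge0 ltW.
rewrite !esumZl ?lee_fin ?invr_ge0 ?(ltW l0)//; last 2 first.
- by move=> i; rewrite lee_fin sqr_ge0.
- by move=> i; rewrite lee_fin sqr_ge0.
rewrite ap bq -!EFinM -EFinD lee_fin /l.
rewrite -[X in (_ * X + _ <= _)%R](sqr_sqrtr p0) -[X in (_ + _ * X <= _)%R](sqr_sqrtr q0).
move: (Num.sqrt p) (Num.sqrt q) sp sq {l l0} => r s r0 s0.
suff -> : (s / r * r ^+ 2 + (s / r)^-1 * s ^+ 2 = 2%:R * (r * s))%R by [].
by field; rewrite !gt_eqF.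
Qed.

(** The reverse triangle inequality for $\ell^2$ norms, squared; it controls how fibre norms vary
    along a letter. *)
Lemma sqrt_dist_le (a b : I -> R) (p q : R) :
  (forall i, 0 <= a i)%R -> (forall i, 0 <= b i)%R ->
  \esum_(i in A) (a i ^+ 2)%:E = p%:E -> \esum_(i in A) (b i ^+ 2)%:E = q%:E ->
  ((Num.sqrt p - Num.sqrt q) ^+ 2)%:E <= \esum_(i in A) ((a i - b i) ^+ 2)%:E.
Proof.
move=> a0 b0 ap bq.
have p0 : (0 <= p)%R.
  by rewrite -lee_fin -ap; apply: esum_ge0 => i _; rewrite lee_fin sqr_ge0.
have q0 : (0 <= q)%R.
  by rewrite -lee_fin -bq; apply: esum_ge0 => i _; rewrite lee_fin sqr_ge0.
have := esum_sqrB A a0 b0; rewrite ap bq.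
have := esum_mul_le_sqrt a0 b0 ap bq.
have P0 : 0 <= \esum_(i in A) (a i * b i)%:E.
  by apply: esum_ge0 => i _; rewrite lee_fin mulr_ge0.
have S0 : 0 <= \esum_(i in A) ((a i - b i) ^+ 2)%:E.
  by apply: esum_ge0 => i _; rewrite lee_fin sqr_ge0.
move: P0 S0; case: (\esum_(i in A) (a i * b i)%:E) => [P| |]//.
case: (\esum_(i in A) ((a i - b i) ^+ 2)%:E) => [S| |]; [|by move=> *; exact: leey|by []].
move=> _ _; rewrite !lee_fin -EFinM -!EFinD => Ppq [SP].
have := sqr_sqrtr p0; have := sqr_sqrtr q0.
move: (Num.sqrt p) (Num.sqrt q) Ppq => r s Ppq s2 r2.
by rewrite sqrrB r2 s2; lra.
Qed.

Lemma esum_sqrD_le (a b c : I -> R) :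
  \esum_(i in A) ((a i - c i) ^+ 2)%:E <=
  2%:E * (\esum_(i in A) ((a i - b i) ^+ 2)%:E +
    \esum_(i in A) ((b i - c i) ^+ 2)%:E).
Proof.
rewrite -esumD; last 2 first.
- by move=> i _; rewrite lee_fin sqr_ge0.
- by move=> i _; rewrite lee_fin sqr_ge0.
rewrite -esumZl//; last by move=> i; rewrite -EFinD lee_fin addr_ge0 ?sqr_ge0.
apply: le_esum => i _; rewrite -EFinD -EFinM lee_fin -subr_ge0.
have -> : (2%:R * ((a i - b i) ^+ 2 + (b i - c i) ^+ 2) - (a i - c i) ^+ 2 =
  (a i - b i - (b i - c i)) ^+ 2)%R by ring.
exact: sqr_ge0.
Qed.

End l2_distance.

(** * The spectral gap makes fibre norms nearly constant *)

Section gap.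
Context {R : realType} d {T : measurableType d} {mu : probability T R}.
Variables (W : reversible_walk mu) (Sub : set (T * T)).
Hypotheses (mS : measurable Sub) (eS : is_equivalence Sub).
Local Notation J := (@letters _ _ _ _ W).
Local Notation X := (@wdom _ _ _ _ W).
Local Notation wt := (@wt _ _ _ _ W).
Local Notation step := (@step _ _ _ _ W).
Local Notation act := (@act _ _ _ _ W).
Local Notation word := (@word _ _ _ _ W).
Local Notation csum := (@csum _ _ _ _ W Sub).
Local Notation coset_measurable := (@coset_measurable _ _ _ _ W Sub).
Local Notation orbit := (@orbit _ _ _ _ W).
Local Notation orbit_cosets := (@orbit_cosets _ _ _ _ W Sub).
Local Notation moment := (@moment _ _ _ _ W Sub).

Let mX : measurable X. Proof. exact: wdom_meas. Qed.
Local Hint Resolve mX : core.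

Lemma cvg_nneseries_term (u : nat -> \bar R) : (forall n, 0 <= u n) ->
  \sum_(n <oo) u n < +oo -> u n @[n --> \oo] --> 0.
Proof.
move=> u0 /(nneseries_tail_cvg) /(_ (fun n _ => u0 n)) tail.
apply: squeeze_cvge (cvg_cst 0) tail; apply: nearW => n; rewrite u0 /=.
rewrite (nneseries_split n 1) => [|k _//].
by rewrite addn1 big_nat1 leeDl//; apply: nneseries_ge0.
Qed.

(** The form in which the spectral gap is used: nonnegative unit functions asymptotically invariant
    under the letters come arbitrarily close to the constant 1, arbitrarily far along the
    sequence. *)
Definition walk_gap := forall f : nat -> T -> R,
  (forall n, measurable_fun setT (f n)) -> (forall n x, (0 <= f n x)%R) ->
  (forall n, \int[mu]_x ((f n x) ^+ 2)%:E = 1) ->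
  (forall i, J i ->
    \int[mu]_x ((f n (step i x) - f n x) ^+ 2)%:E @[n --> \oo] --> 0) ->
  forall (e : R) N, (0 < e)%R ->
    exists2 n, (N <= n)%N & \int[mu]_x ((f n x - 1) ^+ 2)%:E <= e%:E.

Variable E : set T.
Hypotheses (mE : measurable E) (Einv : rel_invariant Sub E).
Hypothesis gap : walk_gap.
Hypothesis growth : forall r, (0 < r)%R -> (r < 1)%R ->
  exists2 dl : R, (0 < dl)%R &
    \forall k \near \oo, (dl * r ^+ k <= moment E (2 * k))%R.

Let sqsum (F : T -> set T -> R) x := csum (fun x c => (F x c ^+ 2)%:E) x.

Let dist i (F : T -> set T -> R) x :=
  csum (fun x c => ((F (step i x) c - F x c) ^+ 2)%:E) x.

Let good (F : T -> set T -> R) (e : R) := [/\ forall x c, (0 <= F x c)%R,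
    coset_measurable (fun x c => (F x c)%:E),
    forall x c, X x -> orbit_cosets x c -> F x c != 0%R -> c `<=` E,
    \int[mu]_(x in X) sqsum F x = 1 &
    forall i, J i -> (wt i)%:E * \int[mu]_(x in X) dist i F x <= e%:E].

Let exists_good (e : R) : (0 < e)%R -> exists F, good F e.
Proof.
(* Half of [e] because [almost_invariant_vector] bounds the displacement by twice its parameter, and
   at most one half because that parameter must be below 1. *)
move=> e0; pose e' := (Num.min (e / 2) 2^-1)%R.
have e'0 : (0 < e')%R by rewrite lt_min invr_gt0 ltr0n andbT divr_gt0.
have e'1 : (e' < 1)%R.
  by rewrite gt_min; apply/orP; right; rewrite invf_lt1// ltr1n.
have [F [F0 mF FE F1 Fd]] := almost_invariant_vector mS eS mE Einv growth e'0 e'1.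
exists F; split => // i Ji; apply: (@le_trans _ _ (2 * e')%:E).
  apply: le_trans Fd.
  apply: (esum_ge1 (a := fun i => (wt i)%:E * \int[mu]_(x in X) dist i F x)) => //.
  move=> j Jj; rewrite mule_ge0 ?lee_fin ?wt_ge0//.
  apply: integral_ge0 => x _; apply: csum_ge0 => {}x c.
  by rewrite lee_fin sqr_ge0.
by rewrite lee_fin mulrC -ler_pdivlMr// ge_min lexx.
Qed.

Let sq0 F x : 0 <= sqsum F x.
Proof. by apply: csum_ge0 => {}x c; rewrite lee_fin sqr_ge0. Qed.

Let dist0 i F x : 0 <= dist i F x.
Proof. by apply: csum_ge0 => {}x c; rewrite lee_fin sqr_ge0. Qed.

Let msq F : coset_measurable (fun x c => (F x c)%:E) ->
  measurable_fun X (sqsum F).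
Proof.
move=> mF; apply: measurable_fun_csum => //.
  by move=> x c; rewrite lee_fin sqr_ge0.
move=> w ww; apply/measurable_EFinP; apply: measurable_funX.
by apply/measurable_EFinP; exact: mF.
Qed.

Let mdist i F : J i -> coset_measurable (fun x c => (F x c)%:E) ->
  measurable_fun X (dist i F).
Proof.
move=> Ji mF; apply: measurable_fun_csum => //.
  by move=> x c; rewrite lee_fin sqr_ge0.
by apply: coset_measurable_sqrB => //; exact: (coset_measurable_step (F := fun x c => (F x c)%:E)).
Qed.

(** The fibre norm $\|F_x\|$, set to 0 off the domain so that it is measurable on the whole space;
    infinite norms become 0 through [fine]. *)
Let nrm F := (fun x => Num.sqrt (fine (sqsum F x))) \_ X.

Let mnrm F : coset_measurable (fun x c => (F x c)%:E) ->
  measurable_fun setT (nrm F).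
Proof.
move=> mF; apply/(measurable_restrictT _ mX).
rewrite (_ : (fun x => _) = (@powR R ^~ 2^-1%R) \o (fine \o sqsum F)).
  have mf : measurable_fun X (fine \o sqsum F).
    by apply: measurableT_comp; [exact: fine_measurable|exact: msq].
  exact: measurableT_comp.
by apply/funext => x /=; rewrite powR12_sqrt// fine_ge0.
Qed.

Let nrm0 F x : (0 <= nrm F x)%R.
Proof. by rewrite /nrm patchE; case: ifP => // _; exact: sqrtr_ge0. Qed.

Let integral_wdom (f : T -> \bar R) : (forall x, 0 <= f x) ->
  measurable_fun setT f -> \int[mu]_x f x = \int[mu]_(x in X) f x.
Proof.
move=> f0 mf; rewrite (@ge0_negligible_integral _ _ _ mu setT (~` X))//.
- by rewrite setTD setCK.
- exact: measurableC.
- exact: wdom_full.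
Qed.

Let sq_fin F e : good F e -> {ae mu, forall x, X x -> sqsum F x \is a fin_num}.
Proof.
move=> [_ mF _ F1 _]; have : mu.-integrable X (sqsum F).
  apply/integrableP; split; first exact: msq.
  under eq_integral do rewrite gee0_abs//.
  by rewrite F1 ltry.
exact: integrable_ae.
Qed.

Let nrm1 F e : good F e -> \int[mu]_x ((nrm F x) ^+ 2)%:E = 1.
Proof.
move=> gF; have [_ mF _ F1 _] := gF.
rewrite integral_wdom; last 2 first.
- by move=> x; rewrite lee_fin sqr_ge0.
- by apply/measurable_EFinP; apply: measurable_funX; exact: mnrm.
apply: etrans F1; apply: ge0_ae_eq_integral => //.
- apply/measurable_EFinP; apply: measurable_funX.
  exact: measurable_funTS (mnrm mF).
- exact: msq.
- by move=> x _; rewrite lee_fin sqr_ge0.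
- apply: filterS (sq_fin gF) => x H Xx.
  by rewrite /nrm patchE mem_set// sqr_sqrtr ?fineK ?fine_ge0//; exact: H.
Qed.

Let nrm_step F e i : J i -> good F e ->
  \int[mu]_x ((nrm F (step i x) - nrm F x) ^+ 2)%:E <=
  \int[mu]_(x in X) dist i F x.
Proof.
move=> Ji gF; have [F0 mF _ F1 _] := gF.
have mdiff : measurable_fun setT (fun x => ((nrm F (step i x) - nrm F x) ^+ 2)%:E).
  apply/measurable_EFinP; apply: measurable_funX; apply: measurable_funB.
    by apply: (measurableT_comp (mnrm mF)); exact: step_meas.
  exact: mnrm.
rewrite integral_wdom//; last by move=> x; rewrite lee_fin sqr_ge0.
apply: ae_ge0_le_integral => //.
- by move=> x _; rewrite lee_fin sqr_ge0.
- exact: measurable_funTS.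
- exact: mdist.
(* The fibre norms must be finite both at [x] and at [step i x], hence an invariant conull set. *)
have [A [mA A0 AX AP Ai]] := ae_invariant W (sq_fin gF).
exists (~` A); split; [exact: measurableC|exact: A0|].
move=> x /=; apply: contra_not => Ax Xx.
have Asx := Ai i x Ji Ax.
rewrite /nrm !patchE !mem_set//; last exact: AX.
apply: sqrt_dist_le => //.
- rewrite fineK; last by apply: AP => //; exact: AX.
  exact: (@csum_step _ _ _ _ W Sub (fun x c => (F x c ^+ 2)%:E) i x Ji Xx).
- by rewrite fineK//; exact: AP.
Qed.

(** Vectors with displacements of order $2^{-n}$ have asymptotically invariant fibre norms, so the
    gap selects indices at which the norms are within $2^{-n}$ of 1 in squared $L^2$ distance.
    Summability makes both convergences pointwise, and on an invariant conull set convergence along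
    letters extends to words by induction. *)
Lemma asymptotic_coset_vectors : exists (A : set T) (F : nat -> T -> set T -> R),
  [/\ [/\ measurable A, mu (~` A) = 0, A `<=` X &
        forall i x, J i -> A x -> A (step i x)],
    forall n, [/\ forall x c, (0 <= F n x c)%R,
      coset_measurable (fun x c => (F n x c)%:E) &
      forall x c, X x -> orbit_cosets x c -> F n x c != 0%R -> c `<=` E],
    forall n x, A x -> csum (fun x c => (F n x c ^+ 2)%:E) x \is a fin_num,
    forall x, A x -> fine (csum (fun x c => (F n x c ^+ 2)%:E) x) @[n --> \oo]
      --> (1 : R)%R &
    forall x y, A x -> orbit x y ->
      \esum_(c in orbit_cosets x) ((F n y c - F n x c) ^+ 2)%:E
        @[n --> \oo] --> 0].
Proof.
pose h n : R := (2^-1 ^+ n)%R.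
have h0 n : (0 < h n)%R by rewrite exprn_gt0.
have sumh : \sum_(n <oo) (h n)%:E < +oo.
  by rewrite nneseries_geometric ?ltry// invr_ge0 ler0n/= invf_lt1// ltr1n.
have /choice[F0 gF0] : forall n, exists F, good F (h n).
  by move=> n; exact: exists_good.
have nstep i : J i ->
    \int[mu]_x ((nrm (F0 n) (step i x) - nrm (F0 n) x) ^+ 2)%:E @[n --> \oo] --> 0.
  move=> Ji; have wi := wt_gt0 Ji.
  have hc : ((wt i)^-1)%:E * (h n)%:E @[n --> \oo] --> 0.
    rewrite -(mule0 ((wt i)^-1)%:E); apply: cvgeZl => //.
    by apply: cvg_nneseries_term => // n; rewrite lee_fin ltW.
  apply: squeeze_cvge (cvg_cst 0) hc; apply: nearW => n; apply/andP; split.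
    by apply: integral_ge0 => x _; rewrite lee_fin sqr_ge0.
  apply: le_trans (nrm_step Ji (gF0 n)) _.
  have [_ _ _ _ /(_ i Ji)] := gF0 n.
  by move=> H; rewrite [leRHS]muleC lee_pdivlMr// muleC.
(* The requirement [n <= m] keeps the displacement bound [h n] for the selected vectors. *)
have /choice[s Hs] : forall n, exists m, (n <= m)%N /\
    \int[mu]_x ((nrm (F0 m) x - 1) ^+ 2)%:E <= (h n)%:E.
  move=> n; have mn m : measurable_fun setT (nrm (F0 m)).
    by have [_ mF _ _ _] := gF0 m; exact: mnrm.
  have [m nm Hm] := gap mn (fun m => nrm0 (F0 m)) (fun m => nrm1 (gF0 m)) nstep n (h0 n).
  by exists m.
pose F n := F0 (s n).
have hs n : (h (s n) <= h n)%R.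
  have [nsn _] := Hs n; apply: ler_wiXn2l => //.
  by rewrite invf_le1// ler1n.
have aeD : {ae mu, forall x i, J i -> X x -> dist i (F n) x @[n --> \oo] --> 0}.
  apply: ae_forall_set; first exact: letters_countable.
  move=> i Ji; have wi := wt_gt0 Ji.
  have mFn n : measurable_fun X (dist i (F n)).
    by have [_ mF _ _ _] := gF0 (s n); exact: mdist.
  have : \sum_(n <oo) \int[mu]_(x in X) dist i (F n) x < +oo.
    apply: (@le_lt_trans _ _ (\sum_(n <oo) ((wt i)^-1)%:E * (h n)%:E)).
      apply: lee_nneseries => [n _ _|n _]; first by apply: integral_ge0.
      have [_ _ _ _ /(_ i Ji) H] := gF0 (s n).
      rewrite [leRHS]muleC lee_pdivlMr// muleC; apply: le_trans H _.
      by rewrite lee_fin.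
    rewrite nneseriesZl; last by move=> n _; rewrite lee_fin ltW.
    by rewrite lte_mul_pinfty// lee_fin invr_ge0 ltW.
  move=> /(ae_series_lty mX mFn (fun n => dist0 i (F n))).
  by apply: filterS => x H Xx; apply: cvg_nneseries_term => //; exact: H.
have ae1 : {ae mu, forall x, (nrm (F n) x) @[n --> \oo] --> (1 : R)%R}.
  have mdn n : measurable_fun setT (fun x => ((nrm (F n) x - 1) ^+ 2)%:E).
    have [_ mF _ _ _] := gF0 (s n).
    apply/measurable_EFinP; apply: measurable_funX; apply: measurable_funB.
      exact: mnrm.
    exact: measurable_cst.
  have d0 n x : 0 <= ((nrm (F n) x - 1) ^+ 2)%:E by rewrite lee_fin sqr_ge0.
  have : \sum_(n <oo) \int[mu]_(x in setT) ((nrm (F n) x - 1) ^+ 2)%:E < +oo.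
    apply: le_lt_trans sumh; apply: lee_nneseries => [n _ _|n _].
      by apply: integral_ge0.
    by have [] := Hs n.
  move=> /(ae_series_lty measurableT mdn d0); apply: filterS => x /(_ Logic.I).
  move=> /(cvg_nneseries_term (d0^~ x))/fine_cvg/= sq1.
  rewrite -[X in _ --> X]add0r.
  rewrite (_ : (fun n => nrm (F n) x) = (fun n => (nrm (F n) x - 1) + 1)%R); last first.
    by apply/funext => n; rewrite subrK.
  apply: cvgD; last exact: cvg_cst.
  apply/norm_cvg0P.
  rewrite -(@sqrtr0 R).
  rewrite (_ : (fun n => _) = (fun n => Num.sqrt ((nrm (F n) x - 1) ^+ 2))); last first.
    by apply/funext => n; rewrite sqrtr_sqr.
  apply: continuous_cvg => //; exact: sqrt_continuous.
have aefin : {ae mu, forall x n, X x -> sqsum (F n) x \is a fin_num}.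
  by apply: ae_forall_nat => n; exact: sq_fin (gF0 (s n)).
have aeall : {ae mu, forall x, [/\ forall i, J i -> X x -> dist i (F n) x @[n --> \oo] --> 0,
    (nrm (F n) x) @[n --> \oo] --> (1 : R)%R &
    forall n, X x -> sqsum (F n) x \is a fin_num]}.
  by apply: filterS3 aeD ae1 aefin => x.
have [A [mA A0 AX AP Ai]] := ae_invariant W aeall.
exists A, F; split => //.
- by move=> n; have [? ? ? _ _] := gF0 (s n).
- by move=> n x Ax; have [_ _ H] := AP x Ax; apply: H; exact: AX.
- move=> x Ax; have [_ H1 H2] := AP x Ax; have Xx := AX x Ax.
  rewrite (_ : (fun n => _) = (fun n => nrm (F n) x * nrm (F n) x)%R); last first.
    apply/funext => n; rewrite /nrm patchE mem_set// -expr2 sqr_sqrtr//.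
    by rewrite fine_ge0.
  by rewrite -[X in _ --> X]mulr1; apply: cvgM.
- move=> x y Ax [w ww <-]; elim: w x ww Ax {y} => [|i w ih] x ww Ax.
    rewrite (_ : (fun n => _) = cst 0); last first.
      by apply/funext => n; rewrite esum1// => c _; rewrite /= subrr expr0n.
    exact: cvg_cst.
  have [Ji ww'] : J i /\ word w by apply/word_cons.
  have Xx := AX x Ax.
  have [Hd _ _] := AP x Ax; have {}Hd := Hd i Ji Xx.
  have {}ih := ih _ ww' (Ai i x Ji Ax).
  rewrite orbit_cosets_step// in ih.
  have bound : 2%:E * ((\esum_(c in orbit_cosets x)
      ((F n (act w (step i x)) c - F n (step i x) c) ^+ 2)%:E) +
      dist i (F n) x) @[n --> \oo] --> 0.
    rewrite -(mule0 2%:E); apply: cvgeZl => //.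
    rewrite -[X in _ --> X]adde0; apply: cvgeD => //.
  apply: squeeze_cvge (cvg_cst 0) bound; apply: nearW => n; apply/andP; split.
    by apply: esum_ge0 => c _; rewrite lee_fin sqr_ge0.
  exact: esum_sqrD_le.
Qed.

End gap.

(** * Countable separating families in a standard Borel space *)

Section separation.
Context {R : realType} d {T : measurableType d}.
Hypothesis sT : standard_borel R T.

Lemma standard_borel_separated : exists U : nat -> set T,
  (forall n, measurable (U n)) /\
  forall x y, x <> y -> exists n, U n x /\ ~ U n y.
Proof.
have [U [f [hU [B cB [Bopen Bbasis]] [g fK gK] mf]]] := sT.
have finj : injective f := can_inj fK.
pose V (b : set U) := f @^-1` b.
have mV b : B b -> measurable (V b).
  move=> Bb; apply/mf; apply: sub_sigma_algebra; rewrite /V image_preimage.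
    exact: Bopen.
  by apply/seteqP; split => // u _; exists (g u).
have [B0|/set0P B0] := eqVneq B set0.
  exists (fun _ => set0); split; first by move=> _.
  move=> x y; have := Bbasis (f x) setT (filterT) => -[b [Bb _] _].
  by move: Bb; rewrite B0.
have [u Bu] := countable_range cB B0.
exists (fun n => V (u n)); split; first by move=> n; apply: mV; rewrite Bu; exists n.
move=> x y xy; have fxy : f x <> f y by move=> /finj.
have /eqP fxyb := fxy.
have [A [oA xA yA]] := hausdorff_accessible hU fxyb.
have nA : nbhs (f x) A by apply: open_nbhs_nbhs; split => //; rewrite inE in xA.
have [b [Bb bx] bA] := Bbasis (f x) A nA.
have [n _ unb] : range u b by rewrite -Bu.
exists n; rewrite /V unb; split => // /bA fyA.
by move: yA; rewrite inE; apply.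
Qed.

Lemma measurable_diagonal : measurable [set p : T * T | p.1 = p.2].
Proof.
have [U [mU sepU]] := standard_borel_separated.
rewrite (_ : mkset _ = ~` \bigcup_n (U n `*` ~` U n)).
  apply: measurableC; apply: bigcupT_measurable => n.
  by apply: measurableX => //; exact: measurableC.
apply/seteqP; split => [[x y] /= -> [n _ [/= ? ?]]//|[x y] /= H].
apply: contrapT => xy; have [n Uxy] := sepU x y xy.
by apply: H; exists n.
Qed.

End separation.

(** * Full group elements: preservation of the measure and inverses *)

Section full_group_elements.
Context {R : realType} d {T : measurableType d} (mu : probability T R).
Variable Rel : set (T * T).
Hypotheses (sT : standard_borel R T) (pmpR : pmp_eqrel mu Rel).
Local Notation FA := (full_auto mu [set: T] Rel).
Local Notation FG := (full_group mu [set: T] Rel).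

Lemma fa_funTK (g : FA) : cancel g (fa_inv g).
Proof. by move=> x; apply: (fa_funK g); rewrite inE. Qed.

Lemma fa_invTK (g : FA) : cancel (fa_inv g) g.
Proof. by move=> x; apply: (fa_invK g); rewrite inE. Qed.

Lemma esum_indic1 (I : choiceType) (A : set I) (i : I) (P : I -> Prop) :
  (forall j, A j -> P j -> j = i) -> A i -> P i ->
  \esum_(j in A) (if `[< P j >] then 1 else 0 : \bar R) = 1.
Proof.
move=> Pi Ai Pii; rewrite -(esum_eq_support (A := [set i])).
- by rewrite esum_set1 asboolT.
- by move=> _ ->.
- move=> j Aj ji; rewrite asboolF// => Pj; apply: ji; exact: Pi.
Qed.

(* Mass transport applied to the graph of the inverse map. *)
Lemma fa_inv_pres_rel (g : FA) A : measurable A ->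
  (forall x, A x -> Rel (x, g x)) -> mu (fa_inv g @^-1` A) = mu A.
Proof.
move=> mA Ag; have [mR [rf sy tr] _ transport] := pmpR.
have mgi : measurable (fa_inv g @^-1` A).
  by rewrite -[_ @^-1` _]setTI; apply: fa_inv_meas.
pose B := [set p : T * T | g p.1 = p.2 /\ A p.1].
have mB : measurable B.
  have -> : B = (fun p => (g p.1, p.2)) @^-1` [set p : T * T | p.1 = p.2] `&`
      fst @^-1` A by [].
  apply: measurableI; last by rewrite -[_ @^-1` _]setTI; exact: measurable_fst.
  have mh : measurable_fun setT (fun p : T * T => (g p.1, p.2)).
    apply: measurable_fun_pair; last exact: measurable_snd.
    exact: (measurableT_comp (fa_fun_meas g) measurable_fst).
  by rewrite -[_ @^-1` _]setTI; apply: mh => //; exact: (measurable_diagonal sT).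
pose f (p : T * T) : \bar R := if `[< B p >] then 1 else 0.
have mf : measurable_fun Rel f.
  apply: measurable_fun_if_asbool => //; exact: measurableI.
have f0 p : Rel p -> 0 <= f p by rewrite /f; case: ifP.
have := transport f mf f0.
rewrite (eq_integral (fun x => (\1_A x)%:E)); last first.
  move=> x _; rewrite indicE; have [Ax|nAx] := pselect (A x).
    rewrite mem_set//; apply: (esum_indic1 (i := g x)).
    - by move=> y _ [].
    - exact: Ag.
    - by split.
  rewrite memNset// esum1// => y _; rewrite /f asboolF// => -[_] //.
rewrite [RHS](eq_integral (fun x => (\1_(fa_inv g @^-1` A) x)%:E)); last first.
  move=> x _; rewrite indicE.
  have [Ax|nAx] := pselect ((fa_inv g @^-1` A) x).
    rewrite mem_set//; apply: (esum_indic1 (i := fa_inv g x)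
        (P := fun y => B (y, x))).
    - by move=> y _ [/= <- _]; rewrite fa_funTK.
    - by have /sy := Ag _ Ax; rewrite fa_invTK.
    - by split => //=; rewrite fa_invTK.
  rewrite memNset// esum1// => y _; rewrite /f asboolF// => -[/= gy Ay].
  by apply: nAx; rewrite /preimage /= -gy fa_funTK.
by rewrite !integral_indic// !setIT.
Qed.

(** An element moves points inside their class only almost everywhere. Mass transport applies on a
    conull set [G] where it does; the preimage of [G] then has measure 1, so what lies outside it
    can be ignored. *)
Lemma fa_inv_pres (g : FA) A : measurable A -> mu (fa_inv g @^-1` A) = mu A.
Proof.
move=> mA.
have [G [mG G0 GR]] : exists G, [/\ measurable G, mu (~` G) = 0 &
    G `<=` [set x | Rel (x, g x)]].
  by apply: ae_conull; apply: filterS (fa_rel g) => x; apply.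
have mp B : measurable B -> measurable (fa_inv g @^-1` B).
  by move=> mB; rewrite -[_ @^-1` _]setTI; apply: fa_inv_meas.
have presG B : measurable B -> mu (fa_inv g @^-1` (B `&` G)) = mu (B `&` G).
  move=> mB; apply: fa_inv_pres_rel; first exact: measurableI.
  by move=> x [_ /GR].
have muI B H : measurable B -> measurable H -> mu (~` H) = 0 ->
    mu (B `&` H) = mu B.
  move=> mB mH H0; rewrite -[in RHS](setIT B) -(setUv H) setIUr measureU//.
  - rewrite [X in _ + X](_ : _ = 0) ?adde0//.
    apply/eqP; rewrite -measure_le0 -H0; apply: le_measure; rewrite ?inE//.
      by apply: measurableI => //; exact: measurableC.
    exact: measurableC.
  - exact: measurableI.
  - by apply: measurableI => //; exact: measurableC.
  - by rewrite setIACA setICr setI0.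
have h1 : mu (fa_inv g @^-1` G) = 1.
  have := presG setT measurableT; rewrite setTI => ->.
  by have := muI setT G measurableT mG G0; rewrite setTI probability_setT.
have inG0 : mu (~` (fa_inv g @^-1` G)) = 0.
  by rewrite probability_setC ?h1 ?subee//; exact: mp.
by rewrite -(muI _ _ (mp A mA) (mp G mG) inG0) -preimage_setI presG// muI.
Qed.

Lemma fa_fun_pres (g : FA) A : measurable A -> mu (fa_fun g @^-1` A) = mu A.
Proof.
move=> mA; have mg : measurable (fa_fun g @^-1` A).
  by rewrite -[_ @^-1` _]setTI; apply: fa_fun_meas.
rewrite -(fa_inv_pres g mg); congr (mu _); apply/funext => x.
by rewrite /preimage /= fa_invTK.
Qed.

Lemma ae_fa_fun (g : FA) (P : T -> Prop) :
  {ae mu, forall x, P x} -> {ae mu, forall x, P (g x)}.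
Proof. by apply: ae_comp; [exact: fa_fun_meas|exact: fa_fun_pres]. Qed.

Lemma ae_fa_inv (g : FA) (P : T -> Prop) :
  {ae mu, forall x, P x} -> {ae mu, forall x, P (fa_inv g x)}.
Proof. by apply: ae_comp; [exact: fa_inv_meas|exact: fa_inv_pres]. Qed.

Lemma ae_rel_fun (g : FA) : {ae mu, forall x, Rel (x, g x)}.
Proof. by apply: filterS (fa_rel g) => x; apply. Qed.

Lemma ae_rel_inv (g : FA) : {ae mu, forall x, Rel (x, fa_inv g x)}.
Proof.
have [_ [_ sy _] _ _] := pmpR.
apply: filterS (ae_fa_inv g (ae_rel_fun g)) => x /sy.
by rewrite fa_invTK.
Qed.

Definition inverse_auto (g : FA) : FA.
Proof.
refine (@FullAuto _ _ _ mu [set: T] Rel (fa_inv g) g (fun _ _ => Logic.I)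
  (fun _ _ => Logic.I) (fun x _ => fa_invTK g x) (fun x _ => fa_funTK g x)
  (fa_inv_meas g) (fa_fun_meas g) _).
by apply: filterS (ae_rel_inv g) => x.
Defined.

Lemma full_group_eq (g h : FG) : {ae mu, forall x, g x = h x} -> g = h.
Proof.
move=> gh; rewrite -[g]reprK -[h]reprK; apply/eqmodP/asboolP.
by apply: filterS gh => x.
Qed.

Definition fg_inverse (g : FG) : FG := (\pi_FG (inverse_auto g))%qT.

Lemma fg_inverseE g : {ae mu, forall x, fg_inverse g x = fa_inv g x}.
Proof.
have : fa_equiv (repr (fg_inverse g)) (inverse_auto g).
  by apply/eqmodP; rewrite reprK.
by move=> /asboolP; apply: filterS => x; apply.
Qed.

Lemma fg_inverseK : involutive fg_inverse.
Proof.
move=> g; apply: full_group_eq.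
have H := fg_inverseE (fg_inverse g).
have := ae_fa_inv (fg_inverse g) (fg_inverseE g).
apply: filterS2 H => x -> e.
rewrite fa_invTK in e.
by rewrite [in RHS]e fa_invTK.
Qed.

Lemma is_inv_inverse g : is_inv g (fg_inverse g).
Proof. by apply: filterS (fg_inverseE g) => x. Qed.

End full_group_elements.

(** * The reversible walk driven by the given probability on the full group *)

Section full_group_walk.
Context {R : realType} d {T : measurableType d} (mu : probability T R).
Variable Rel : set (T * T).
Hypotheses (sT : standard_borel R T) (pmpR : pmp_eqrel mu Rel).
Local Notation FG := (full_group mu [set: T] Rel).
Variable nu : FG -> R.
Hypotheses (nuP : countable_prob nu) (nuS : symmetric_prob nu)
  (nuG : generates_rel nu).
Local Notation fg_inverse := (@fg_inverse _ _ _ mu Rel sT pmpR).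

Lemma nu_inverse g : nu (fg_inverse g) = nu g.
Proof. by apply/esym/nuS; exact: is_inv_inverse. Qed.

Lemma nu_ge0 g : (0 <= nu g)%R. Proof. by case: nuP. Qed.

Lemma nu_gt0 g : supp nu g -> (0 < nu g)%R.
Proof. by rewrite /supp /= => ng; rewrite lt_def ng nu_ge0. Qed.

Lemma nu_sum : \esum_(g in supp nu) (nu g)%:E = 1.
Proof.
have [_ _ <-] := nuP; apply: esum_eq_support => // g _.
by move=> /negP; rewrite negbK => /eqP ->.
Qed.

Lemma supp_inverse g : supp nu g -> supp nu (fg_inverse g).
Proof. by rewrite /supp /= nu_inverse. Qed.

(** A conull set on which the almost everywhere properties of the chosen representatives of the
    support hold everywhere. *)
Record walk_domain (A : set T) : Prop := WalkDomain {
  wd_meas : measurable A ;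
  wd_full : mu (~` A) = 0 ;
  wd_inv : forall g x, supp nu g -> A x -> A (fa_fun g x) ;
  wd_linv : forall g x, supp nu g -> A x -> fg_inverse g (g x) = x ;
  wd_rel : forall g x, supp nu g -> A x -> Rel (x, g x)
}.

Definition full_walk A (wA : walk_domain A) : reversible_walk mu :=
  @ReversibleWalk R d T mu FG (supp nu) nu fg_inverse (fun g => fa_fun (fg_rep g)) A
    (let: And3 _ c _ := nuP in c) nu_ge0 nu_gt0 nu_sum supp_inverse
    (fun g _ => fg_inverseK sT pmpR g) (fun g _ => nu_inverse g)
    (fun g _ => fa_fun_meas (fg_rep g)) (fun g A _ mA => fa_fun_pres sT pmpR (fg_rep g) mA)
    (wd_meas wA) (wd_full wA) (wd_inv wA) (wd_linv wA).

Lemma supp_countable : countable (supp nu). Proof. by case: nuP. Qed.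

Lemma walk_domain_exists (P : T -> Prop) : {ae mu, forall x, P x} ->
  exists2 A, walk_domain A & A `<=` P.
Proof.
move=> aeP.
have step_ae : {ae mu, forall x g, supp nu g ->
    fg_inverse g (g x) = x /\ Rel (x, g x)}.
  apply: ae_forall_set; first exact: supp_countable.
  move=> g _; have := ae_fa_fun sT pmpR (fg_rep g) (fg_inverseE sT pmpR g).
  apply: filterS2 (ae_rel_fun (fg_rep g)) => x Rx -> .
  by rewrite fa_funTK.
have both : {ae mu, forall x, P x /\ forall g, supp nu g ->
    fg_inverse g (g x) = x /\ Rel (x, g x)}.
  by apply: filterS2 aeP step_ae => x.
have [A [mA A0 AP Ai]] := ae_invariant_set (h := fun g : FG => fa_fun (fg_rep g)) supp_countable
  (fun g _ => fa_fun_meas (fg_rep g)) (fun g A _ mA => fa_fun_pres sT pmpR (fg_rep g) mA) both.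
exists A; last by move=> x /AP[].
split => //.
- by move=> g x sg Ax; have [_ /(_ g sg)[]] := AP x Ax.
- by move=> g x sg Ax; have [_ /(_ g sg)[]] := AP x Ax.
Qed.

Lemma act_rel A (wA : walk_domain A) w x : word (W := full_walk wA) w -> A x ->
  Rel (x, act w x).
Proof.
have [_ [rf sy tr] _ _] := pmpR.
elim: w x => [|g w ih] x; first by move=> _ _; exact: rf.
move=> /word_cons[sg ww] Ax; apply: tr (wd_rel wA sg Ax) _.
by apply: ih => //; exact: wd_inv.
Qed.

(** Symmetry of [nu] makes the support closed under inverses, so the inverse of a word is again a
    word. The almost everywhere equalities compose because the elements preserve null sets. *)
Lemma generated_word A (wA : walk_domain A) g : generated (supp nu) g ->
  exists2 w, word (W := full_walk wA) w & {ae mu, forall x, g x = act w x}.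
Proof.
have aeA : {ae mu, forall x, A x}.
  exists (~` A); split => //; [exact/measurableC/wd_meas|exact: wd_full wA].
elim=> {g}[g sg|g g1|g h gh _ [w ww wg]|g h k ghk _ [wg wwg gw] _ [wh wwh hw]].
- exists [:: g]; last exact: nearW.
  by apply/word_cons; split => //; exact: word_nil.
- exists [::]; first exact: word_nil.
  by apply: filterS g1 => x /(_ Logic.I).
- exists (winv w); first exact: word_winv.
  have H : {ae mu, forall y, g y = act (W := full_walk wA) w y /\ A y} by exact: filterI.
  have {}gh : {ae mu, forall x, h x = fa_inv g x} by apply: filterS gh => x; apply.
  move: gh (ae_fa_inv sT pmpR (fg_rep g) H); apply: filterS2 => x -> [e Ay].
  by rewrite fa_invTK in e; rewrite {2}e act_winv.
- exists (wh ++ wg); first by apply/word_cat.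
  have {}ghk : {ae mu, forall x, k x = g (h x)} by apply: filterS ghk => x; apply.
  move: ghk hw (ae_fa_fun sT pmpR (fg_rep h) gw).
  apply: filterS3 => x -> hx ->.
  by rewrite act_cat -hx.
Qed.

(** Choosing a word for each element of the generated group is injective, since equal words give
    almost everywhere equal elements. The group is therefore countable and one null set serves all
    its elements. *)
Lemma orbit_class A (wA : walk_domain A) :
  {ae mu, forall x, A x -> cls Rel x = orbit (full_walk wA) x}.
Proof.
have [f Hf] : exists f : FG -> seq FG, forall g, generated (supp nu) g ->
    word (W := full_walk wA) (f g) /\ {ae mu, forall x, g x = act (W := full_walk wA) (f g) x}.
  have /choice[f Hf] : forall g, exists w : seq FG, generated (supp nu) g ->
    word (W := full_walk wA) w /\ {ae mu, forall x, g x = act (W := full_walk wA) w x}.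
    move=> g; have [Gg|nGg] := pselect (generated (supp nu) g); last by exists [::].
    by have [w ww wg] := generated_word wA Gg; exists w.
  by exists f.
have cG : countable (generated (supp nu) : set FG).
  have /countable_injP[h hinj] := countable_word (full_walk wA).
  apply/countable_injP; exists (fun g => h (f g)) => g1 g2.
  rewrite !inE => /Hf[w1 e1] /Hf[w2 e2] /hinj e.
  have {}e : f g1 = f g2 by apply: e; exact: mem_set.
  apply: full_group_eq; apply: filterS2 e1 e2 => x -> ->.
  by rewrite e.
have : {ae mu, forall x (g : FG), generated (supp nu) g ->
    g x = act (W := full_walk wA) (f g) x}.
  by apply: ae_forall_set cG _ => g /Hf[].
apply: filterS2 nuG => x nuGx H Ax; apply/seteqP; split; last first.
  by move=> _ [w ww <-]; exact: act_rel.
rewrite -nuGx => _ [g gG <-]; rewrite H//; exists (f g) => //.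
by have [] := Hf g gG.
Qed.

(** The null set of [orbit_class] is known only once a domain is fixed, so the domain is chosen
    twice; orbits depend on the letters alone and are unaffected. *)
Lemma full_walk_exists (P : T -> Prop) : {ae mu, forall x, P x} ->
  exists A, exists2 wA : walk_domain A, A `<=` P &
    forall x, A x -> cls Rel x = orbit (full_walk wA) x.
Proof.
move=> aeP; have [A0 wA0 A0P] := walk_domain_exists aeP.
have aeA : {ae mu, forall x, A0 x /\ (A0 x -> cls Rel x = orbit (full_walk wA0) x)}.
  apply: filterI; last exact: orbit_class.
  exists (~` A0); split => //; [exact/measurableC/wd_meas|exact: wd_full wA0].
have [A wA AP] := walk_domain_exists aeA.
exists A, wA; first by move=> x /AP[/A0P].
by move=> x /AP[A0x /(_ A0x)].
Qed.

End full_group_walk.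

(** * Transition and return probabilities of the definitions as averages *)

Section bridge.
Context {R : realType} d {T : measurableType d} (mu : probability T R).
Variables Rel Sub : set (T * T).
Hypotheses (sT : standard_borel R T) (pmpR : pmp_eqrel mu Rel).
Hypotheses (mS : measurable Sub) (eS : is_equivalence Sub).
Local Notation FG := (full_group mu [set: T] Rel).
Variable nu : FG -> R.
Hypotheses (nuP : countable_prob nu) (nuS : symmetric_prob nu).
Variables (A : set T) (wA : walk_domain sT pmpR nu A).
Local Notation W := (full_walk nuP nuS wA).
Hypothesis clsA : forall x, A x -> cls Rel x = orbit W x.

Lemma esum_point (I : choiceType) (B : set I) (a : I) (f : I -> \bar R) :
  (forall i, 0 <= f i) ->
  \esum_(w in B) ((\1_[set w] a)%:E * f w) = (\1_B a)%:E * f a.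
Proof.
move=> f0; rewrite [\1_B a]indicE; have [Ba|nBa] := pselect (B a).
  rewrite mem_set// mul1e -(esum_eq_support (A := [set a])).
  - by rewrite esum_set1 indicE mem_set// mul1e.
  - by move=> _ ->.
  - by move=> i _ ia; rewrite indicE memNset ?mul0e// => ai; apply: ia.
rewrite memNset// mul0e esum1// => i Bi; rewrite indicE memNset ?mul0e//.
by move=> ai; apply: nBa; rewrite ai.
Qed.

Lemma transitionE y w :
  transition nu y w = \esum_(g in supp nu) ((nu g)%:E * (\1_[set w] (fg_rep g y))%:E).
Proof.
rewrite /transition esum_mkcond [RHS]esum_mkcond; apply: eq_esum => g _.
have -> : (\1_[set w] (fg_rep g y) : R) = (`[< fg_rep g y = w >])%:R.
  by rewrite indicE; case: asboolP => gy; [rewrite mem_set|rewrite memNset].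
have -> : (g \in [set g : FG | fg_rep g y = w]) = `[< fg_rep g y = w >].
  by case: asboolP => gy; [rewrite mem_set|rewrite memNset].
case: asboolP => _; last by rewrite mule0; case: ifP.
rewrite mule1; case: ifPn => // /negP.
by rewrite inE /supp /= => /negP; rewrite negbK => /eqP ->.
Qed.

(** On the domain every letter stays inside the class, so restricting the intermediate point to the
    class loses no mass. *)
Lemma walk_probE k y z : A y ->
  walk_prob nu k y z = iter k (avg W) (eindic [set z]) y.
Proof.
elim: k y => [|k ih] y Ay /=.
  rewrite /eindic !indicE; have [->|yz] := pselect (y = z); first by rewrite !mem_set.
  by rewrite !memNset// => /esym.
have orbA w : cls Rel y w -> A w.
  rewrite clsA// => -[v vv <-]; exact: (@act_wdom _ _ _ _ W).
pose f w := iter k (avg W) (eindic [set z]) w.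
have f0 w : 0 <= f w by apply: iter_avg_ge0 => x; exact: eindic_ge0.
transitivity (\esum_(w in cls Rel y) \esum_(g in supp nu)
    ((nu g)%:E * ((\1_[set w] (fg_rep g y))%:E * f w))).
  apply: eq_esum => w yw; rewrite ih; last exact: orbA.
  rewrite transitionE muleC -[LHS]/(f w * _).
  rewrite esum_mkcond -esumZl//; last first.
    by move=> g; case: ifP => // _; rewrite mule_ge0 ?lee_fin ?nu_ge0.
  rewrite [RHS]esum_mkcond; apply: eq_esum => g _; case: ifP; rewrite ?mule0//.
  by rewrite muleCA [f w * _]muleC.
rewrite esum_interchange; last first.
  by move=> w g; rewrite !mule_ge0 ?lee_fin ?nu_ge0.
apply: eq_esum => g sg.
rewrite esum_mkcond.
transitivity ((nu g)%:E * \esum_(w in cls Rel y) ((\1_[set w] (fg_rep g y))%:E * f w)).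
  rewrite [X in _ = _ * X]esum_mkcond -esumZl ?lee_fin ?nu_ge0//; last first.
    by move=> w; case: ifP => // _; rewrite mule_ge0.
  by apply: eq_esum => w _; case: ifP; rewrite ?mule0.
rewrite esum_point// indicE mem_set ?mul1e//.
exact: (wd_rel wA).
Qed.

Lemma return_probE k x : A x -> return_prob Sub nu k x = (ret W Sub k x)%:E.
Proof.
move=> Ax; rewrite /return_prob retE.
transitivity (\esum_(z in cls Sub x) \esum_(w in wordn (W := W) k)
   ((wordwt (W := W) w)%:E * (\1_[set z] (act (W := W) w x))%:E)).
  apply: eq_esum => z _; rewrite walk_probE// iter_avgE//.
  by move=> y; exact: eindic_ge0.
rewrite iter_avgE; last by move=> y; exact: eindic_ge0.
have w0 w : wordn (W := W) k w -> 0 <= (wordwt (W := W) w)%:E.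
  by move=> [ww _]; rewrite lee_fin ltW// wordwt_gt0.
transitivity (\esum_(z in cls Sub x) \esum_(w in wordn (W := W) k)
   ((if w \in wordn (W := W) k then (wordwt (W := W) w)%:E else 0) *
    (\1_[set z] (act (W := W) w x))%:E)).
  by apply: eq_esum => z _; apply: eq_esum => w /mem_set ->.
rewrite esum_interchange; last first.
  by move=> z w; rewrite mule_ge0//; case: ifP => // /set_mem; exact: w0.
apply: eq_esum => w kw; rewrite mem_set//.
transitivity ((wordwt (W := W) w)%:E *
    \esum_(z in cls Sub x) ((\1_[set z] (act (W := W) w x))%:E * 1)).
  rewrite [X in _ = _ * X]esum_mkcond -esumZl//; last 2 first.
  - exact: w0.
  - by move=> z; case: ifP => // _; rewrite mule1.
  rewrite esum_mkcond; apply: eq_esum => z _; case: ifP; rewrite ?mule0//.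
  by rewrite mule1.
by rewrite esum_point// mule1.
Qed.

Lemma rhoE x (l : R) : A x ->
  (ret W Sub (2 * k) x `^ (2 * k)%:R^-1)%R @[k --> \oo] --> l ->
  rho Sub nu x = l%:E.
Proof.
move=> Ax Hl; rewrite /rho.
rewrite (_ : (fun k => _) = (fun k => (ret W Sub (2 * k) x `^ (2 * k)%:R^-1)%:E)).
  by apply/cvg_lim => //; apply/cvg_EFin => //; exact: nearW.
by apply/funext => k; rewrite return_probE// poweR_EFin.
Qed.

End bridge.

(** * Square roots and $L^2$ norms with extended real values *)

Section square_roots.
Context {R : realType}.
Implicit Types x : \bar R.

Lemma poweR_half_sqr x : 0 <= x -> (x `^ 2^-1) * (x `^ 2^-1) = x.
Proof.
case: x => [r|_|//]; last by rewrite /= invr_eq0 pnatr_eq0 /= mulyy.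
rewrite lee_fin => r0; rewrite poweR_EFin -EFinM powR12_sqrt//.
by rewrite -expr2 sqr_sqrtr.
Qed.

Lemma poweR_half1 x : 0 <= x -> x `^ 2^-1 = 1 <-> x = 1.
Proof.
move=> x0; split => [h|->]; last by rewrite poweR1r.
by rewrite -(poweR_half_sqr x0) h mule1.
Qed.

Lemma cvg_poweR_half (x : nat -> \bar R) : (forall n, 0 <= x n) ->
  x n `^ 2^-1 @[n --> \oo] --> 0 <-> x n @[n --> \oo] --> 0.
Proof.
move=> x0; split => h.
  rewrite (_ : x = fun n => (x n `^ 2^-1) * (x n `^ 2^-1)); last first.
    by apply/funext => n; rewrite poweR_half_sqr.
  by rewrite -(mule0 0); apply: cvgeM => //; rewrite mule_def_fin.
have /fine_cvgP[hf hc] := h.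
apply/(fine_cvgP (fun n => x n `^ 2^-1) 0%R); split.
  apply: filterS hf => n hn; rewrite ge0_fin_numE ?poweR_ge0//.
  by rewrite poweR_lty// -ge0_fin_numE.
rewrite -(sqrtr0 R).
apply: cvg_trans (continuous_cvg _ (@sqrt_continuous R 0%R) hc).
apply: near_eq_cvg; move: hf; apply: filterS => n hn /=.
by rewrite -[in RHS](fineK hn) poweR_EFin /= powR12_sqrt// fine_ge0.
Qed.

End square_roots.

Section Lnorm_two.
Context {R : realType} d {T : measurableType d} (mu : {measure set T -> \bar R}).

Lemma Lnorm2E (f : T -> R) :
  Lnorm mu 2%:E (EFin \o f) = (\int[mu]_x ((f x) ^+ 2)%:E) `^ 2^-1.
Proof.
rewrite unlock; congr (_ `^ _); apply: eq_integral => x _ /=.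
by rewrite powR_mulrn// real_normK ?num_real.
Qed.

End Lnorm_two.

Section complex_norm.
Context {R : realType}.

Lemma normc_real (r : R) : ComplexField.Normc.normc (r%:C)%C = `|r|%R.
Proof. by rewrite /= expr0n/= addr0 sqrtr_sqr. Qed.

End complex_norm.

(** * From the spectral gap of the action to the gap of the walk *)

Section second_moments.
Context {R : realType} d {T : measurableType d} (mu : probability T R).
Variable f : T -> R.
Hypotheses (mf : measurable_fun setT f) (f0 : forall x, (0 <= f x)%R)
  (f1 : \int[mu]_x ((f x) ^+ 2)%:E = 1).

Let msq (g : T -> R) : measurable_fun setT g ->
  measurable_fun setT (fun x => ((g x) ^+ 2)%:E).
Proof. by move=> mg; apply/measurable_EFinP; exact: measurable_funX. Qed.

Let mE : measurable_fun setT (EFin \o f). Proof. exact/measurable_EFinP. Qed.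

Lemma mean_fin : \int[mu]_x (f x)%:E \is a fin_num.
Proof.
rewrite ge0_fin_numE; last by apply: integral_ge0 => x _; rewrite lee_fin.
apply: (@le_lt_trans _ _ (\int[mu]_x (1 + ((f x) ^+ 2)%:E))).
  apply: ge0_le_integral => //.
  - by move=> x _; rewrite lee_fin.
  - by apply: emeasurable_funD => //; exact: msq.
  - move=> x _; rewrite -EFinD lee_fin; have := sqr_ge0 (f x - 1)%R.
    by have := f0 x; nra.
rewrite ge0_integralD//; last 2 first.
- by move=> x _; rewrite lee_fin sqr_ge0.
- exact: msq.
by rewrite f1 integral_cst// mul1e [X in X + _](probability_setT mu) -EFinD ltry.
Qed.

Let m := fine (\int[mu]_x (f x)%:E).

Lemma mean_ge0 : (0 <= m)%R.
Proof. by rewrite fine_ge0//; apply: integral_ge0 => x _; rewrite lee_fin. Qed.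

Lemma sqr_deviation (r : R) : (0 <= r)%R ->
  \int[mu]_x ((f x - r) ^+ 2)%:E = (1 + r ^+ 2 - 2 * r * m)%:E.
Proof.
move=> r0.
have h : \int[mu]_x (((f x - r) ^+ 2)%:E + (2 * r)%:E * (f x)%:E) =
    \int[mu]_x (((f x) ^+ 2)%:E + (r ^+ 2)%:E).
  by apply: eq_integral => x _; rewrite -EFinM -!EFinD; congr (_%:E); ring.
have m2 : measurable_fun setT (fun x => ((f x - r) ^+ 2)%:E).
  by apply: msq; apply: measurable_funB.
have e1 : \int[mu]_x (((f x - r) ^+ 2)%:E + (2 * r)%:E * (f x)%:E) =
    \int[mu]_x ((f x - r) ^+ 2)%:E + (2 * r)%:E * \int[mu]_x (f x)%:E.
  rewrite ge0_integralD//=.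
  - by rewrite ge0_integralZl// ?lee_fin ?mulr_ge0// => x _; rewrite lee_fin.
  - by move=> x _; rewrite lee_fin sqr_ge0.
  - by move=> x _; rewrite -EFinM lee_fin !mulr_ge0.
  - exact: measurable_funeM.
have e2 : \int[mu]_x (((f x) ^+ 2)%:E + (r ^+ 2)%:E) = (1 + r ^+ 2)%:E.
  rewrite ge0_integralD//=.
  - by rewrite f1 integral_cst//= [X in _ * X](probability_setT mu) mule1.
  - by move=> x _; rewrite lee_fin sqr_ge0.
  - exact: msq.
  - by move=> x _; rewrite lee_fin sqr_ge0.
move: h; rewrite e1 e2 => h.
rewrite -(fineK mean_fin) -/m in h.
move: h; case: (\int[mu]_x ((f x - r) ^+ 2)%:E) => [a| |]//.
by rewrite -EFinM -EFinD => -[h]; congr (_%:E); rewrite -h addrK.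
Qed.

End second_moments.

Section invariance_of_gap.
Context {R : realType} d {T : measurableType d} (mu : probability T R).
Variable Rel : set (T * T).
Hypotheses (sT : standard_borel R T) (pmpR : pmp_eqrel mu Rel).
Local Notation FA := (full_auto mu [set: T] Rel).
Local Notation FG := (full_group mu [set: T] Rel).

Lemma ge0_integral_fa_fun (g : FA) (f : T -> \bar R) :
  measurable_fun setT f -> (forall x, 0 <= f x) ->
  \int[mu]_x f (g x) = \int[mu]_x f x.
Proof.
move=> mf f0; transitivity (\int[pushforward mu (fa_fun g)]_x f x); last first.
  apply: eq_measure_integral; first exact: fa_fun_meas.
  by move=> ? A mA _; exact: fa_fun_pres.
rewrite ge0_integral_pushforward ?preimage_setT//.
exact: fa_fun_meas.
Qed.

Variable f : nat -> T -> R.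
Hypothesis mf : forall n, measurable_fun setT (f n).

Let dist n (g : T -> T) := \int[mu]_x ((f n (g x) - f n x) ^+ 2)%:E.

Let dist0 n g : 0 <= dist n g.
Proof. by apply: integral_ge0 => x _; rewrite lee_fin sqr_ge0. Qed.

Let mdist n (g : T -> T) : measurable_fun setT g ->
  measurable_fun setT (fun x => ((f n (g x) - f n x) ^+ 2)%:E).
Proof.
move=> mg; apply/measurable_EFinP/measurable_funX/measurable_funB => //.
exact: measurableT_comp.
Qed.

Let dist_ae n (g h : T -> T) : measurable_fun setT g -> measurable_fun setT h ->
  {ae mu, forall x, g x = h x} -> dist n g = dist n h.
Proof.
move=> mg mh gh; apply: ge0_ae_eq_integral => //; try exact: mdist.
- by move=> x _; rewrite lee_fin sqr_ge0.
- by move=> x _; rewrite lee_fin sqr_ge0.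
- by apply: filterS gh => x -> .
Qed.

Let dist_inv n (g : FA) : dist n (fa_inv g) = dist n g.
Proof.
rewrite /dist -[LHS](ge0_integral_fa_fun g); last 2 first.
- by apply: mdist; exact: fa_inv_meas.
- by move=> x; rewrite lee_fin sqr_ge0.
by apply: eq_integral => x _; rewrite fa_funTK -sqrrN opprB.
Qed.

(** The squared displacement is unchanged by inversion and satisfies $d(gh)\le 2(d(g)+d(h))$, both
    by invariance of [mu]. Convergence on a set of elements thus passes to everything it
    generates. *)
Lemma almost_invariant_generated (A : set FG) :
  (forall g : FG, A g -> dist n g @[n --> \oo] --> 0) ->
  forall g : FG, generated A g -> dist n (fa_inv g) @[n --> \oo] --> 0.
Proof.
move=> conv g Gg; under eq_fun do rewrite dist_inv.
elim: Gg => {g}[g sg|g g1|g h gh _ ih|g h k ghk _ ihg _ ihh].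
- exact: conv.
- rewrite (_ : (fun n => _) = cst 0); first exact: cvg_cst.
  apply/funext => n; rewrite (@dist_ae _ _ id)//; last 2 first.
  + exact: fa_fun_meas.
  + by apply: filterS g1 => x; apply.
  by rewrite /dist integral0_eq// => x _; rewrite subrr expr0n.
- rewrite (_ : (fun n => _) = (fun n => dist n g))//.
  apply/funext => n; rewrite -[RHS]dist_inv; apply: dist_ae.
  + exact: fa_fun_meas.
  + exact: fa_inv_meas.
  + by apply: filterS gh => x; apply.
- have bound : 2%:E * (dist n g + dist n h) @[n --> \oo] --> 0.
    rewrite -(mule0 2%:E); apply: cvgeZl => //.
    by rewrite -[X in _ --> X]adde0; apply: cvgeD.
  apply: squeeze_cvge (cvg_cst 0) bound; apply: nearW => n; rewrite dist0 /=.
  have mgh : measurable_fun setT (fun x => g (h x)).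
    exact: (measurableT_comp (fa_fun_meas (fg_rep g)) (fa_fun_meas (fg_rep h))).
  rewrite (@dist_ae _ _ (fun x => g (h x)))//; last 2 first.
  + exact: fa_fun_meas.
  + by apply: filterS ghk => x; apply.
  have sq0 (u : T -> R) x : 0 <= ((u x) ^+ 2)%:E by rewrite lee_fin sqr_ge0.
  rewrite [X in X + _]/dist -(ge0_integral_fa_fun (fg_rep h)); last 2 first.
  + by apply: mdist; exact: fa_fun_meas.
  + by move=> x; exact: (sq0 (fun x => f n (g x) - f n x)%R).
  have m1 : measurable_fun setT (fun x => ((f n (g (h x)) - f n (h x)) ^+ 2)%:E).
    apply/measurable_EFinP/measurable_funX/measurable_funB.
      exact: measurableT_comp (mf n) mgh.
    by apply: measurableT_comp (mf n) _; exact: fa_fun_meas.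
  have m2 := mdist n (fa_fun_meas (fg_rep h)).
  rewrite -ge0_integralD//; last 2 first.
  + by move=> x _; rewrite lee_fin sqr_ge0.
  + by move=> x _; rewrite lee_fin sqr_ge0.
  rewrite -ge0_integralZl//; last 2 first.
  + exact: emeasurable_funD.
  + by move=> x _; rewrite adde_ge0// lee_fin sqr_ge0.
  apply: ge0_le_integral => //.
  + by move=> x _; rewrite lee_fin sqr_ge0.
  + exact: mdist.
  + by apply: measurable_funeM; exact: emeasurable_funD.
  + move=> x _; rewrite -EFinD -EFinM lee_fin /=.
    move: (f n (g (h x))) (f n (h x)) (f n x) => a b c.
    by have := sqr_ge0 (a - b - (b - c))%R; nra.
Qed.

End invariance_of_gap.

Section gap_transfer.
Context {R : realType} d {T : measurableType d} (mu : probability T R).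
Variable Rel : set (T * T).
Hypotheses (sT : standard_borel R T) (pmpR : pmp_eqrel mu Rel).
Local Notation FG := (full_group mu [set: T] Rel).
Variable nu : FG -> R.
Hypotheses (nuP : countable_prob nu) (nuS : symmetric_prob nu).
Variables (A : set T) (wA : walk_domain sT pmpR nu A).
Local Notation W := (full_walk nuP nuS wA).

(* The deviations of a sequence violating [walk_gap] from their means, once
   normalized, are almost invariant unit vectors of mean zero. *)
Lemma spectral_gap_walk : spectral_gap (generated (supp nu)) -> walk_gap W.
Proof.
move=> sg f mf f0 f1 fs e N e0; apply: contrapT => H; apply: sg.
have far n : e%:E < \int[mu]_x ((f (n + N)%N x - 1) ^+ 2)%:E.
  rewrite ltNge; apply/negP => Hn; apply: H; exists (n + N)%N => //.
  exact: leq_addl.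
pose u n := f (n + N)%N.
have mu_ n : measurable_fun setT (u n) by exact: mf.
have u0 n x : (0 <= u n x)%R by exact: f0.
pose m n := fine (\int[mu]_x (u n x)%:E).
pose v n := (1 - m n ^+ 2)%R.
have m0 n : (0 <= m n)%R by apply: mean_ge0; exact: f0.
have vE n : \int[mu]_x ((u n x - m n) ^+ 2)%:E = (v n)%:E.
  rewrite (sqr_deviation (mf _) (f0 _) (f1 _) (m0 n)) -/(u n) -/(m n).
  by congr (_%:E); rewrite /v; ring.
(* The squared distance from [u n] to 1 is [2 - 2 * m n] and exceeds [e], so [m n < 1 - e / 2]; and
   [1 - m n ^+ 2] is at least [1 - m n] since [m n] lies between 0 and 1. This keeps the
   normalisation of the deviations bounded. *)
have ev n : (e / 2 < v n)%R.
  have := far n; rewrite (sqr_deviation (mf _) (f0 _) (f1 _) ler01) -/(u n) -/(m n).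
  rewrite lte_fin /v; have := m0 n; move: (m n) => y y0 hy.
  have y1 : (y <= 1)%R by move: hy e0; rewrite expr1n; lra.
  have : (y ^+ 2 <= y)%R by rewrite expr2 ler_piMr.
  by move: hy; rewrite expr1n; lra.
have v0 n : (0 < v n)%R by apply: lt_trans (ev n); rewrite divr_gt0.
have sv0 n : (0 < Num.sqrt (v n))%R by rewrite sqrtr_gt0.
pose h n x : R := ((u n x - m n) / Num.sqrt (v n))%R.
have mh n : measurable_fun setT (h n).
  by apply: measurable_funM => //; apply: measurable_funB.
have hsq n x y : ((h n x - h n y) ^+ 2 = (v n)^-1 * (u n x - u n y) ^+ 2)%R.
  rewrite /h -mulrBl exprMn exprVn sqr_sqrtr ?(ltW (v0 n))// mulrC.
  by congr (_ * _ ^+ 2)%R; ring.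
exists (fun n x => (h n x)%:C%C); split.
- by move=> n; split => //=.
- move=> n; split => /=; last by rewrite integral0.
  have iu : mu.-integrable setT (EFin \o u n).
    apply/integrableP; split; first exact/measurable_EFinP.
    under eq_integral => x _ do rewrite /= ger0_norm//.
    have : \int[mu]_x (u n x)%:E \is a fin_num.
      exact: (mean_fin (mu_ n) (f0 _) (f1 _)).
    by rewrite ge0_fin_numE// integral_ge0// => x _; rewrite lee_fin f0.
  have ic : mu.-integrable setT (EFin \o cst (m n) : T -> \bar R).
    by apply: finite_measure_integrable_cst.
  have fm : \int[mu]_x (u n x)%:E = (m n)%:E.
    by rewrite fineK//; exact: (mean_fin (mu_ n) (f0 _) (f1 _)).
  under eq_integral => x _ do rewrite /h mulrC EFinM EFinB.
  rewrite integralZl//; last exact: integrableB.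
  rewrite integralB_EFin// fm integral_cst//= [X in _ * (_ - _ * X)](probability_setT mu).
  by rewrite mule1 subee// mule0.
- move=> n; rewrite (_ : (fun x => _) = EFin \o (fun x => `|h n x|%R)); last first.
    by apply/funext => x; rewrite /= -normc_real.
  rewrite Lnorm2E; apply/poweR_half1.
    by apply: integral_ge0 => x _; rewrite lee_fin sqr_ge0.
  transitivity (\int[mu]_x (((v n)^-1)%:E * ((u n x - m n) ^+ 2)%:E)).
    apply: eq_integral => x _; rewrite -EFinM real_normK ?num_real// /h.
    by rewrite exprMn exprVn sqr_sqrtr ?(ltW (v0 n))// mulrC.
  rewrite ge0_integralZl//; last 3 first.
  + by apply/measurable_EFinP/measurable_funX/measurable_funB.
  + by move=> x _; rewrite lee_fin sqr_ge0.
  + by rewrite lee_fin invr_ge0 ltW.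
  by rewrite vE -EFinM mulVf// gt_eqF.
- move=> g Gg.
  have conv : \int[mu]_x ((u n (fa_inv g x) - u n x) ^+ 2)%:E @[n --> \oo] --> 0.
    apply: (@almost_invariant_generated _ _ _ _ _ sT pmpR _ mu_ (supp nu)) => //.
    move=> i si; have := fs i si; rewrite -(cvg_shiftn N); exact.
  rewrite (_ : (fun n => _) = (fun n => (\int[mu]_x
      (((v n)^-1)%:E * ((u n (fa_inv g x) - u n x) ^+ 2)%:E)) `^ 2^-1)); last first.
    apply/funext => n.
    rewrite (_ : (fun x => _) = EFin \o (fun x => `|h n (fa_inv g x) - h n x|%R)); last first.
      by apply/funext => x; congr (_%:E); rewrite -normc_real rmorphB.
    rewrite Lnorm2E; congr (_ `^ _); apply: eq_integral => x _.
    by rewrite real_normK ?num_real// hsq EFinM.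
  apply/cvg_poweR_half.
    move=> n; apply: integral_ge0 => x _.
    by rewrite -EFinM lee_fin mulr_ge0 ?sqr_ge0// invr_ge0 ltW.
  have bound : (2 / e)%:E * \int[mu]_x ((u n (fa_inv g x) - u n x) ^+ 2)%:E @[n --> \oo] --> 0.
    by rewrite -(mule0 (2 / e)%:E); apply: cvgeZl.
  apply: squeeze_cvge (cvg_cst 0) bound; apply: nearW => n; apply/andP; split.
    apply: integral_ge0 => x _.
    by rewrite -EFinM lee_fin mulr_ge0 ?sqr_ge0// invr_ge0 ltW.
  rewrite ge0_integralZl//; last 3 first.
  + apply/measurable_EFinP/measurable_funX/measurable_funB => //.
    by apply: measurableT_comp => //; exact: fa_inv_meas.
  + by move=> x _; rewrite lee_fin sqr_ge0.
  + by rewrite lee_fin invr_ge0 ltW.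
  apply: lee_wpmul2r.
    by apply: integral_ge0 => x _; rewrite lee_fin sqr_ge0.
  rewrite lee_fin -[(2 / e)%R]invrK lef_pV2 ?posrE//; last first.
    by rewrite invr_gt0 divr_gt0.
  by rewrite invf_div ltW.
Qed.

End gap_transfer.

(** * The spectral radius on [E] in terms of return probabilities and moments *)

Section return_growth.
Context {R : realType} d {T : measurableType d} {mu : probability T R}.
Variables (W : reversible_walk mu) (Sub : set (T * T)).
Hypotheses (mS : measurable Sub) (eS : is_equivalence Sub).
Local Notation X := (@wdom _ _ _ _ W).
Local Notation ret := (@ret _ _ _ _ W Sub).
Local Notation moment := (@moment _ _ _ _ W Sub).

Let root x k := (ret (2 * k) x `^ (2 * k)%:R^-1)%R.

Lemma ret_decay_of_root x (l t : R) : root x k @[k --> \oo] --> l ->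
  (l < t)%R -> (0 < t)%R -> exists C, forall m, (ret (2 * m) x <= C * (t ^+ 2) ^+ m)%R.
Proof.
move=> xl lt t0; have [N _ HN] := cvgr_lt l xl _ lt.
(* For [m > N] the root is below [t] and the constant 1 suffices; the other entry covers the
   finitely many earlier times, using only that return probabilities are at most 1. *)
exists (Num.max 1 ((t ^+ 2) ^- N.+1))%R => m.
have [Nm|mN] := ltnP N m.
  have m0 : (0 < m)%N by apply: leq_ltn_trans Nm.
  have := HN m (ltnW Nm); rewrite /root /= powR_root_lt ?ret_ge0 ?(ltW t0)// => /ltW h.
  by apply: le_trans h _; rewrite ler_peMl ?exprn_ge0 ?(ltW t0)// le_max lexx.
have t20 : (0 < t ^+ 2)%R by rewrite exprn_gt0.
have [t1|t1] := leP (t ^+ 2)%R 1%R.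
  apply: le_trans (ret_le1 _ _ _ _) _; rewrite -ler_pdivrMr ?exprn_gt0// mul1r.
  rewrite le_max; apply/orP; right; rewrite lef_pV2 ?posrE ?exprn_gt0//.
  by apply: ler_wiXn2l => //; [exact: ltW|exact: leq_trans mN _].
apply: le_trans (ret_le1 _ _ _ _) _; rewrite -[leLHS]mul1r.
apply: ler_pM => //; first by rewrite le_max lexx.
by rewrite exprn_ege1// ltW.
Qed.

Variable E : set T.
Hypotheses (mE : measurable E) (Einv : rel_invariant Sub E).

(** Consider the points of [E] where [ret (2 * k)] is at least [r ^+ k] for all [k >= N]. If for
    some [N] they have positive measure, this measure is the constant [dl]. If they are null for
    every [N], almost every limit root on [E] is at most $\sqrt r<1$. *)
Lemma moment_growth_of_root : (forall s : R, (0 < s)%R -> (s < 1)%R ->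
    ~ {ae mu, forall x, X x -> E x ->
        forall l : R, root x k @[k --> \oo] --> l -> (l <= s)%R}) ->
  forall r : R, (0 < r)%R -> (r < 1)%R -> exists2 dl : R, (0 < dl)%R &
    \forall k \near \oo, (dl * r ^+ k <= moment E (2 * k))%R.
Proof.
move=> big r r0 r1.
have mX : measurable X by exact: wdom_meas.
pose G N := E `&` \bigcap_(k in [set k | (N <= k)%N])
  (X `&` [set x | (r ^+ k <= ret (2 * k) x)%R]).
have mG N : measurable (G N).
  apply: measurableI => //; apply: bigcap_measurable.
    by exists N => /=.
  move=> k _; rewrite (_ : _ `&` _ = X `&` ret (2 * k) @^-1` `[(r ^+ k)%R, +oo[%classic).
    by apply: (measurable_ret mS) => //; exact: measurable_itv.
  by apply/seteqP; split => x [Xx] /=; rewrite in_itv /= andbT.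
have [[N GN]|noN] := pselect (exists N, mu (G N) != 0).
  exists (fine (mu (G N))).
    by rewrite fine_gt0// lt0e GN measure_ge0 /= -ge0_fin_numE ?fin_num_measure.
  exists N => // k Nk /=.
  have GX : G N `<=` X by move=> x [_ /(_ N (leqnn N))[]].
  rewrite -lee_fin (moment_ret W mS eS mE Einv) EFinM fineK ?fin_num_measure// muleC.
  rewrite -[G N](setIidl GX) -integral_indic//.
  rewrite -ge0_integralZl//; last 2 first.
  - by apply/measurable_EFinP; exact: measurable_indic.
  - by rewrite lee_fin exprn_ge0// ltW.
  apply: ge0_le_integral => //.
  - by move=> x _; rewrite -EFinM lee_fin mulr_ge0 ?exprn_ge0// ltW.
  - by apply: measurable_funeM; apply/measurable_EFinP; exact: measurable_indic.
  - by apply/measurable_EFinP; apply: measurable_funM;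
      [apply: (measurable_ret mS)|exact: measurable_indic].
  - move=> x Xx; rewrite -!EFinM lee_fin.
    rewrite !indicE; have [Gx|nGx] := boolP (x \in G N); last first.
      by rewrite mulr0 mulr_ge0 ?ret_ge0.
    have [Ex /(_ k Nk)[_ h]] := set_mem Gx.
    by rewrite mulr1 mem_set// mulr1.
(* A root of order [2 * k] above $\sqrt r$ means a return probability above [r ^+ k]. *)
exfalso; have s0 : (0 < Num.sqrt r)%R by rewrite sqrtr_gt0.
have s1 : (Num.sqrt r < 1)%R by rewrite -[ltRHS]sqrtr1 ltr_sqrt.
apply: (big _ s0 s1).
have : mu.-negligible (\bigcup_N (G N)).
  apply: negligible_bigcup => N; apply/negligibleP => //.
  by apply/eqP; apply: contrapT => /negP ?; apply: noN; exists N.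
apply: negligibleS => x /= /not_implyP[Xx /not_implyP[Ex]].
move=> /existsNP[l /not_implyP[xl /negP]]; rewrite -ltNge => sl.
have [N _ HN] := cvgr_gt l xl _ sl.
exists N.+1 => //; split => // k /= Nk; split => //=.
have := HN k (ltnW Nk); rewrite /= /root powR_root_gt ?sqrtr_ge0 ?ret_ge0//.
  by rewrite sqr_sqrtr ?(ltW r0)// => /ltW.
exact: leq_trans Nk.
Qed.

End return_growth.

Section spectral_radius.
Context {R : realType} d {T : measurableType d} (mu : probability T R).
Variables Rel Sub : set (T * T).
Hypotheses (sT : standard_borel R T) (pmpR : pmp_eqrel mu Rel).
Hypotheses (mS : measurable Sub) (eS : is_equivalence Sub).
Local Notation FG := (full_group mu [set: T] Rel).
Variable nu : FG -> R.
Hypotheses (nuP : countable_prob nu) (nuS : symmetric_prob nu).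
Variables (A : set T) (wA : walk_domain sT pmpR nu A).
Local Notation W := (full_walk nuP nuS wA).
Hypothesis clsA : forall x, A x -> cls Rel x = orbit W x.
Local Notation ret := (ret W Sub).

Lemma ae_rho : {ae mu, forall x, exists2 l : R, (0 <= l <= 1)%R &
  (ret (2 * k) x `^ (2 * k)%:R^-1)%R @[k --> \oo] --> l /\ rho Sub nu x = l%:E}.
Proof.
have := ret_cvg W mS eS; move=> H; apply/(ae_wdom W).
apply: filterS H => x H Ax; have [l l01 xl] := H Ax.
by exists l => //; split => //; exact: (rhoE clsA Ax xl).
Qed.

Variable E : set T.

(** [rho] lies between 0 and 1 almost everywhere, so its essential supremum over [E] differs from 1
    only when some $s<1$ bounds it there. *)
Lemma rho_set1P : rho_set Sub nu E = 1 <-> forall s : R, (0 < s)%R -> (s < 1)%R ->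
  ~ {ae mu, forall x, E x -> rho Sub nu x <= s%:E}.
Proof.
have bound (s : R) : (0 <= s)%R -> {ae mu, forall x, E x -> rho Sub nu x <= s%:E} ->
    rho_set Sub nu E <= s%:E.
  move=> s0 aes; rewrite /rho_set unlock /=.
  case: ifPn => // _; apply/ess_supP; move: aes ae_rho; apply: filterS2 => x xs.
  move=> [l /andP[l0 _] [_ xl]] /=; rewrite xl indicE.
  have [Ex|nEx] := boolP (x \in E); last by rewrite mule0 abse0.
  by rewrite mule1 gee0_abs ?lee_fin// -lee_fin -xl xs//; exact: set_mem.
split=> [rE s s0 s1 aes|H].
  by have := bound s (ltW s0) aes; rewrite rE lee_fin leNgt s1.
apply/eqP; rewrite eq_le; apply/andP; split.
  apply: bound => //; apply: filterS ae_rho => x [l /andP[_ l1] [_ ->]] _.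
  by rewrite lee_fin.
rewrite leNgt; apply/negP => lt1.
have [s [s0 s1 rs]] : exists s : R, [/\ (0 < s)%R, (s < 1)%R & rho_set Sub nu E <= s%:E].
  move: lt1; case: (rho_set Sub nu E) => [r|//|].
    rewrite lte_fin => r1; exists (Num.max 2^-1 r)%R; split.
    - by rewrite lt_max invr_gt0 ltr0n.
    - by rewrite gt_max r1 andbT invf_lt1// ltr1n.
    - by rewrite lee_fin le_max lexx orbT.
  by exists 2^-1%R; split; rewrite ?invr_gt0 ?invf_lt1 ?ltr1n ?ltr0n ?leNye.
apply: (H s s0 s1); move: rs; rewrite /rho_set unlock /=.
rewrite [X in (0 < X)](probability_setT mu) lte01 => /ess_supP.
apply: filterS => x /= + Ex; rewrite indicE mem_set// mule1.
exact: le_trans (lee_abs _).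
Qed.

Lemma moment_growth_of_rho_set (mE : measurable E) (Einv : rel_invariant Sub E) :
  rho_set Sub nu E = 1 ->
  forall r : R, (0 < r)%R -> (r < 1)%R -> exists2 dl : R, (0 < dl)%R &
    \forall k \near \oo, (dl * r ^+ k <= moment W Sub E (2 * k))%R.
Proof.
move=> /rho_set1P H; apply: moment_growth_of_root => // s s0 s1 aes.
apply: (H s s0 s1); apply/(ae_wdom W); move: aes ae_rho; apply: filterS2 => x aes.
by move=> [l _ [xl ->]] Xx Ex; rewrite lee_fin; exact: aes.
Qed.

Lemma ret_decay_of_rho_set : rho_set Sub nu E != 1 ->
  exists2 t : R, (0 < t < 1)%R & {ae mu, forall x, E x ->
    exists C, forall m, (ret (2 * m) x <= C * (t ^+ 2) ^+ m)%R}.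
Proof.
move=> /eqP rE; have : exists s : R, [/\ (0 < s)%R, (s < 1)%R &
    {ae mu, forall x, E x -> rho Sub nu x <= s%:E}].
  apply: contrapT => H; apply: rE; apply/rho_set1P => s s0 s1 aes.
  by apply: H; exists s.
(* The midpoint of [s] and 1 leaves room above the limit root, which is needed for a bound at all
   times. *)
move=> [s [s0 s1 aes]]; exists ((s + 1) / 2)%R; first by apply/andP; split; lra.
move: aes ae_rho; apply: filterS2 => x aes [l _ [xl rl]] Ex.
apply: ret_decay_of_root xl _ _; last lra.
by have := aes Ex; rewrite rl lee_fin; lra.
Qed.

End spectral_radius.

Section nonneg_integral.
Context {R : realType} d {T : measurableType d} (mu : {measure set T -> \bar R}).

(* The integral of a nonnegative function is a supremum over simple functions,
   so it is monotone without measurability assumptions. *)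
Lemma ge0_le_integral_nonmeas (D : set T) (f g : T -> \bar R) :
  (forall x, D x -> 0 <= f x) -> (forall x, D x -> f x <= g x) ->
  \int[mu]_(x in D) f x <= \int[mu]_(x in D) g x.
Proof.
move=> f0 fg; have g0 x : D x -> 0 <= g x.
  by move=> Dx; apply: le_trans (f0 x Dx) (fg x Dx).
rewrite !ge0_integralE//; apply: le_ereal_sup => _ [h /= hf <-].
exists h => //= x; apply: le_trans (hf x) _.
by rewrite !patchE; case: ifPn => // /set_mem; exact: fg.
Qed.

End nonneg_integral.

(** * The restricted relations and Borel functions on their coset space *)

Section restricted_relation.
Context {R : realType} d {T : measurableType d} {mu : probability T R}.
Variables (Rel Sub : set (T * T)).
Hypotheses (mR : measurable Rel) (eR : is_equivalence Rel).
Hypotheses (mS : measurable Sub) (eS : is_equivalence Sub) (SR : Sub `<=` Rel).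
Variables (E : set T) (mE : measurable E).
Hypotheses (Einv : rel_invariant Sub E) (muE : 0 < mu E).
Local Notation P := (mnormalize (mrestr mu mE) mu).
Local Notation RelE := (rel_restrict Rel E).
Local Notation SubE := (rel_restrict Sub E).

Lemma restr_measureE B : measurable B -> P B = mu (B `&` E) * ((fine (mu E))^-1)%:E.
Proof.
move=> mB; rewrite /mnormalize /= /mrestr setTI.
have -> : (mu E == 0) || (mu E == +oo) = false.
  apply/negbTE; rewrite negb_or gt_eqF//=.
  by rewrite -ltey -ge0_fin_numE ?fin_num_measure.
by [].
Qed.

Lemma restr_null B : measurable B -> P B = 0 <-> mu (B `&` E) = 0.
Proof.
move=> mB; rewrite restr_measureE//; split=> [/eqP|->]; last by rewrite mul0e.
rewrite mule_eq0 => /orP[/eqP//|]; rewrite eqe invr_eq0.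
by rewrite fine_eq0 ?fin_num_measure// gt_eqF.
Qed.

Lemma ae_restr (Q : T -> Prop) :
  {ae P, forall x, E x -> Q x} <-> {ae mu, forall x, E x -> Q x}.
Proof.
split=> [[N [mN N0 QN]]|[N [mN N0 QN]]].
  exists (N `&` E); split; first exact: measurableI.
    exact/restr_null.
  by move=> x Qx; split; [exact: QN|apply: contrapT => nE; apply: Qx].
exists N; split => //; apply/restr_null => //.
apply/eqP; rewrite -measure_le0 -N0; apply: le_measure; rewrite ?inE//.
exact: measurableI.
Qed.

Lemma cls_restr y : E y -> cls SubE y = cls Sub y.
Proof.
move=> Ey; apply/seteqP; split => z; first by case.
by move=> yz; split => //; split => //=; exact: Einv yz Ey.
Qed.

Lemma cosets_restr x : E x -> cosets RelE SubE x =
  [set cls Sub y | y in cls Rel x `&` E].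
Proof.
move=> Ex; apply/seteqP; split => [_ [y [xy [_ /= Ey]] <-]|_ [y [xy Ey] <-]].
  by exists y => //; rewrite cls_restr.
by exists y => //; rewrite cls_restr.
Qed.

Lemma coset_space_restr x y : E x -> E y ->
  coset_space E RelE SubE (x, cls SubE y) <-> Rel (x, y).
Proof.
have [rf sy tr] := eS; have [_ _ trR] := eR.
move=> Ex Ey; split=> [[_ [z [xz [_ /= Ez]] e]]|xy]; last first.
  by split => //=; exists y.
rewrite !cls_restr// in e.
have /SR zy : Sub (z, y) by apply/cls_eqP.
exact: trR zy.
Qed.

Lemma measurable_pair_preimage (h1 h2 : T -> T) (Q : set (T * T)) :
  measurable_fun E h1 -> measurable_fun E h2 -> measurable Q ->
  measurable [set x | E x /\ Q (h1 x, h2 x)].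
Proof.
move=> m1 m2 mQ.
pose ext (h : T -> T) x := if `[< E x >] then h x else x.
have mext h : measurable_fun E h -> measurable_fun setT (ext h).
  move=> mh; apply: measurable_fun_if => //.
  - apply: (@measurable_fun_bool _ _ _ _ true).
    rewrite [X in measurable X](_ : _ = E)//.
    by apply/seteqP; split => [x [_ /asboolP]//|x Ex]; split => //; exact/asboolP.
  - by apply: measurable_funS mh => // x [_ /asboolP].
rewrite (_ : mkset _ = E `&` (fun x => (ext h1 x, ext h2 x)) @^-1` Q).
  apply: measurableI => //.
  have mh : measurable_fun setT (fun x => (ext h1 x, ext h2 x)).
    by apply: measurable_fun_pair; exact: mext.
  by rewrite -[_ @^-1` _]setTI; exact: mh.
by apply/seteqP; split => x [Ex]; rewrite /preimage /= /ext asboolT.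
Qed.

Variable W : reversible_walk mu.
Local Notation X := (@wdom _ _ _ _ W).
Hypothesis clsX : forall x, X x -> cls Rel x = orbit W x.

(** [E] is a union of [Sub]-classes, so a class that meets [E] is contained in it. *)
Lemma cosets_orbit x : X x -> E x -> cosets RelE SubE x =
  [set c | orbit_cosets W Sub x c /\ c `<=` E].
Proof.
have [rf sy tr] := eS.
move=> Xx Ex; rewrite cosets_restr// orbit_cosetsE -clsX//.
apply/seteqP; split => [_ [y [xy Ey] <-]|c [[y xy <-] yE]].
  by split; [exists y|move=> z yz; exact: Einv yz Ey].
by exists y => //; split => //; apply: yE; exact: rf.
Qed.

(** For [x] in [A] the coset of [g x] is that of [act (u n) x] for some [n], and the function is
    measurable along each word. Off [A] no word need reach [g x]; there the function is a constant
    times the indicator of the coset of [x], whose level sets are read off from [Sub] directly. *)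
Lemma coset_borel_walk (A : set T) (a : R) (h : T -> set T -> R) (U : set R) :
  measurable A -> A `<=` X ->
  (forall w, word (W := W) w -> measurable_fun A (fun x => h x (cls Sub (act w x)))) ->
  (forall x c, ~ A x -> h x c = a * (x \in c)%:R)%R ->
  measurable U ->
  coset_borel P E RelE SubE (coset_space E RelE SubE `&`
    [set p | U (h p.1 p.2)]).
Proof.
move=> mA AX mh hA mU; have [rf sy tr] := eS.
split=> [p [] //|g].
have [u wu] := word_enum W.
have wun n : word (u n) by rewrite wu; exists n.
have gE x : E x -> E (g x) by move=> Ex; exact: (fa_funS g).
have mg : measurable_fun E g by exact: fa_fun_meas.
pose S n := [set x | E x /\ Sub (act (u n) x, g x)].
have mSn n : measurable (S n).
  by apply: measurable_pair_preimage => //; exact: measurable_funTS (act_meas (wun n)).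
have mRg : measurable [set x | E x /\ Rel (x, g x)].
  by apply: (measurable_pair_preimage (h1 := id)).
have mSg : measurable [set x | E x /\ Sub (g x, x)].
  by apply: (measurable_pair_preimage (h2 := id)).
rewrite (_ : mkset _ =
    (\bigcup_n (S n `&` (A `&` (fun x => h x (cls Sub (act (u n) x))) @^-1` U))) `|`
    ([set x | E x /\ Rel (x, g x)] `\` A) `&`
      ((if `[<U a>] then [set x | E x /\ Sub (g x, x)] else set0) `|`
       (if `[<U 0%R>] then E `\` [set x | E x /\ Sub (g x, x)] else set0))); last first.
  apply/seteqP; split => x.
    move=> [Ex [/(coset_space_restr Ex (gE x Ex)) Rx /=]].
    rewrite cls_restr; last exact: gE.
    have [Ax|nAx] := pselect (A x).
      move=> Uh; left.
      have : orbit W x (g x) by rewrite -clsX//; exact: AX.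
      move=> [w ww wx]; have : word w by []; rewrite wu => -[n _ un].
      exists n => //; split; first by split => //; rewrite un wx; exact: rf.
      by split => //; rewrite /preimage /= un wx.
    rewrite hA// => Uh; right; split => //.
    have [gx|gx] := pselect (Sub (g x, x)).
      left; rewrite mem_set// mulr1 in Uh; by rewrite asboolT.
    right; rewrite memNset// mulr0 in Uh; rewrite asboolT//.
    by split => //; case.
  move=> [[n _ [[Ex Sx] [Ax Ux]]]|[[[Ex Rx] nAx] H]]; split => //; split.
  - apply/(coset_space_restr Ex (gE x Ex)).
    have Xx := AX x Ax; have [_ _ trR] := eR.
    apply: (trR _ (act (u n) x)); last exact: SR.
    by rewrite -[Rel _]/(cls Rel x (act (u n) x)) clsX//; exists (u n).
  - rewrite /= cls_restr; last exact: gE.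
    by move: Sx => /(cls_eqP eS) <-.
  - by apply/(coset_space_restr Ex (gE x Ex)).
  - rewrite /= cls_restr; last exact: gE.
    rewrite hA//; move: H => [|]; case: asboolP => // Ua [_].
      by move=> gx; rewrite mem_set// mulr1.
    by move=> gx; rewrite memNset ?mulr0// => ?; apply: gx.
apply: measurableU.
  apply: bigcupT_measurable => n; apply: measurableI => //.
  exact: (mh _ (wun n)).
apply: measurableI; first exact: measurableD.
by apply: measurableU; case: ifP => // _; exact: measurableD.
Qed.

Lemma esum_indic_cosets x : E x ->
  \esum_(c in cosets RelE SubE x) (((x \in c)%:R : R) ^+ 2)%:E = 1.
Proof.
move=> Ex; have [rf sy tr] := eS; have [rfR _ _] := eR.
rewrite -(esum_eq_support (A := [set cls Sub x])).
- by rewrite esum_set1 mem_set ?expr1n//; exact: rf.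
- by move=> _ ->; rewrite cosets_restr//; exists x => //; split => //; exact: rfR.
- move=> c; rewrite cosets_restr// => -[y [_ Ey] <-] yx.
  rewrite memNset ?expr0n// => H; apply: yx => /=.
  exact/(cls_eqP eS).
Qed.

End restricted_relation.

(** * Coamenability from asymptotically invariant vectors *)

Section coamenable_of_vectors.
Context {R : realType} d {T : measurableType d} {mu : probability T R}.
Variables (Rel Sub : set (T * T)).
Hypotheses (mR : measurable Rel) (eR : is_equivalence Rel).
Hypotheses (mS : measurable Sub) (eS : is_equivalence Sub) (SR : Sub `<=` Rel).
Variables (E : set T) (mE : measurable E).
Hypotheses (Einv : rel_invariant Sub E) (muE : 0 < mu E).
Local Notation P := (mnormalize (mrestr mu mE) mu).
Local Notation RelE := (rel_restrict Rel E).
Local Notation SubE := (rel_restrict Sub E).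
Variable W : reversible_walk mu.
Local Notation X := (@wdom _ _ _ _ W).
Local Notation J := (@letters _ _ _ _ W).
Local Notation step := (@step _ _ _ _ W).
Local Notation csum := (@csum _ _ _ _ W Sub).
Local Notation orbit_cosets := (@orbit_cosets _ _ _ _ W Sub).
Local Notation coset_measurable := (@coset_measurable _ _ _ _ W Sub).
Hypothesis clsX : forall x, X x -> cls Rel x = orbit W x.

Lemma l2norm_real (C : set (set T)) (f : set T -> R) :
  l2norm C (fun c => (f c)%:C%C) = (\esum_(c in C) ((f c) ^+ 2)%:E) `^ 2^-1.
Proof.
rewrite /l2norm; congr (_ `^ _); apply: eq_esum => c _; congr (_%:E).
by rewrite normc_real real_normK ?num_real.
Qed.

Variables (A : set T) (F : nat -> T -> set T -> R).
Lemma ge0_twice_sqr_mul (p q : R) : 0 <= (2 * p ^+ 2)%:E * (q ^+ 2)%:E.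
Proof.
by rewrite -EFinM lee_fin; apply: mulr_ge0; [apply: mulr_ge0|]; rewrite ?sqr_ge0 ?ler0n.
Qed.

Hypotheses (mA : measurable A) (A0 : mu (~` A) = 0) (AX : A `<=` X)
  (Ai : forall i x, J i -> A x -> A (step i x)).
Hypotheses (mF : forall n, coset_measurable (fun x c => (F n x c)%:E))
  (FE : forall n x c, X x -> orbit_cosets x c -> F n x c != 0%R -> c `<=` E).
Let S n x := csum (fun x c => (F n x c ^+ 2)%:E) x.
Hypotheses (Sfin : forall n x, A x -> S n x \is a fin_num)
  (S1 : forall x, A x -> fine (S n x) @[n --> \oo] --> (1 : R)%R)
  (Fconv : forall x y, A x -> orbit W x y ->
    \esum_(c in orbit_cosets x) ((F n y c - F n x c) ^+ 2)%:E
      @[n --> \oo] --> 0).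

Let N n x := fine (S n x).

(** The normalised fibre. Where it cannot be normalised, and off [A], the indicator of the coset of
    [x] is used, so that fibres over [E] have norm 1 without exception. *)
Let xi n x c : R := if `[< A x >] && (0 < N n x)%R
  then (F n x c / Num.sqrt (N n x))%R else (x \in c)%:R%R.

Let mX : measurable X. Proof. exact: wdom_meas. Qed.
Local Hint Resolve mX : core.

Let mN n : measurable_fun A (N n).
Proof.
apply: measurableT_comp; first exact: fine_measurable.
apply: (measurable_funS mX AX); apply: measurable_fun_csum => //.
  by move=> x c; rewrite lee_fin sqr_ge0.
move=> w ww; apply/measurable_EFinP; apply: measurable_funX.
by apply/measurable_EFinP; exact: mF.
Qed.

Let N0 n x : (0 <= N n x)%R.
Proof. by rewrite fine_ge0//; apply: csum_ge0 => {}x c; rewrite lee_fin sqr_ge0. Qed.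

Let mxi n w : word (W := W) w ->
  measurable_fun A (fun x => xi n x (cls Sub (act w x))).
Proof.
move=> ww; apply: (eq_measurable_fun (fun x => if (0 < N n x)%R
  then (F n x (cls Sub (act w x)) / Num.sqrt (N n x))%R
  else fine (diag (R := R) setT x (cls Sub (act w x))))).
  move=> x /set_mem Ax; rewrite /xi asboolT//=; case: ifP => // _.
  by rewrite /diag /= indicT mul1r indicE.
apply: measurable_fun_if => //.
- by apply: measurable_fun_ltr => //; exact: measurable_cst.
- apply: measurable_funM.
    apply/measurable_EFinP; apply: measurable_funS (mF n ww) => //.
    by move=> x [/AX].
  apply: measurable_fun_invr_ge0; first by move=> x; exact: sqrtr_ge0.
  rewrite (_ : (fun x => _) = (@powR R ^~ 2^-1%R) \o N n); last first.
    by apply/funext => x; rewrite -(powR12_sqrt (N0 n x)).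
  by apply: measurableT_comp => //; apply: measurable_funS (mN n) => // x [].
- apply: measurableT_comp; first exact: fine_measurable.
  apply: measurable_funS (coset_measurable_diag mS measurableT ww) => //.
  by move=> x [/AX].
Qed.

Let xi_unit n x : E x -> \esum_(c in cosets RelE SubE x) ((xi n x c) ^+ 2)%:E = 1.
Proof.
move=> Ex; rewrite /xi; case: asboolP => [Ax|_]; last exact: esum_indic_cosets.
have [Nx|_] := boolP (0 < N n x)%R; last exact: esum_indic_cosets.
rewrite (eq_esum (b := fun c => ((N n x)^-1)%:E * (F n x c ^+ 2)%:E)); last first.
  move=> c _; rewrite -EFinM; congr (_%:E).
  by rewrite exprMn exprVn (sqr_sqrtr (N0 n x)) mulrC.
rewrite (cosets_orbit eS Einv clsX (AX Ax))//.
rewrite (esum_eq_support (B := orbit_cosets x)); last 2 first.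
- by move=> c [].
- move=> c xc ncE; have [->|/(FE (AX Ax) xc) cE] := eqVneq (F n x c) 0%R.
    by rewrite expr0n mule0.
  by exfalso; apply: ncE.
rewrite esumZl; last 2 first.
- by rewrite lee_fin invr_ge0.
- by move=> c; rewrite lee_fin sqr_ge0.
rewrite -[X in _ * X]/(S n x) -(fineK (Sfin n Ax)) -/(N n x) -EFinM mulVf//.
by rewrite gt_eqF.
Qed.

Let A_orbit x y : A x -> orbit W x y -> A y.
Proof.
move=> + [w + <-] => {y}; elim: w x => // i w ih x Ax /word_cons[Ji ww].
by apply: ih => //; exact: Ai.
Qed.

Let S_orbit n x y : A x -> orbit W x y ->
  S n y = \esum_(c in orbit_cosets x) (F n y c ^+ 2)%:E.
Proof.
move=> Ax [w ww <-]; rewrite /S /csum !orbit_cosetsE orbit_act//; exact: AX.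
Qed.

(** Normalisation is harmless because the fibre norms at [x] and [y] both tend to 1, so the inverse
    norms have a common limit. *)
Let xi_conv x y : A x -> E x -> orbit W x y ->
  \esum_(c in cosets RelE SubE x) ((xi n x c - xi n y c) ^+ 2)%:E
    @[n --> \oo] --> 0.
Proof.
move=> Ax Ex xy; have Ay := A_orbit Ax xy.
pose a n := Num.sqrt (N n x); pose b n := Num.sqrt (N n y).
have sq z : A z -> (fun n => Num.sqrt (N n z)) @ \oo --> (1 : R)%R.
  move=> Az; rewrite -[X in _ --> X](@sqrtr1 R).
  apply: continuous_cvg; [exact: sqrt_continuous|exact: S1].
have ca := sq _ Ax; have cb := sq _ Ay.
have ia : (a n)^-1%R @[n --> \oo] --> (1 : R)%R.
  by rewrite -[X in _ --> X]invr1; apply: cvgV => //; exact: oner_neq0.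
have ib : (b n)^-1%R @[n --> \oo] --> (1 : R)%R.
  by rewrite -[X in _ --> X]invr1; apply: cvgV => //; exact: oner_neq0.
pose D n := \esum_(c in orbit_cosets x) ((F n y c - F n x c) ^+ 2)%:E.
(* From $pu-qv=p(u-v)+(p-q)v$ with $p,q$ the inverse norms: the first term is small by [Fconv], the
   second because $p-q$ tends to 0. *)
have bound : (2 * (a n)^-1 ^+ 2)%:E * D n +
    (2 * ((a n)^-1 - (b n)^-1) ^+ 2 * N n y)%:E @[n --> \oo] --> 0.
  rewrite -[X in _ --> X]adde0; apply: cvgeD => //.
    rewrite -(mule0 (2 * 1 ^+ 2)%:E); apply: cvgeM => //; last exact: Fconv.
    apply: cvg_EFin; first exact: nearW.
    by apply: cvgM; [exact: cvg_cst|exact: (cvgM ia ia)].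
  apply: cvg_EFin; first exact: nearW.
  rewrite -[X in _ --> X](_ : 2 * (1 - 1) ^+ 2 * 1 = 0)%R; last first.
    by rewrite subrr expr0n/= mulr0 mul0r.
  apply: cvgM; last exact: S1.
  apply: cvgM; first exact: cvg_cst.
  exact: (cvgM (cvgB ia ib) (cvgB ia ib)).
apply: squeeze_cvge (cvg_cst 0) bound.
have Npos z : A z -> \forall n \near \oo, (0 < N n z)%R.
  by move=> Az; apply: (cvgr_gt _ (S1 Az)); exact: ltr01.
apply: filterS2 (Npos x Ax) (Npos y Ay) => n Nx Ny.
apply/andP; split; first by apply: esum_ge0 => c _; rewrite lee_fin sqr_ge0.
apply: (@le_trans _ _ (\esum_(c in orbit_cosets x)
    ((2 * (a n)^-1 ^+ 2)%:E * ((F n y c - F n x c) ^+ 2)%:E +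
     (2 * ((a n)^-1 - (b n)^-1) ^+ 2)%:E * (F n y c ^+ 2)%:E))).
  rewrite (cosets_orbit eS Einv clsX (AX Ax))// esum_mkcond [leRHS]esum_mkcond.
  apply: le_esum => c _.
  have r0 : 0 <= (2 * (a n)^-1 ^+ 2)%:E * ((F n y c - F n x c) ^+ 2)%:E +
      (2 * ((a n)^-1 - (b n)^-1) ^+ 2)%:E * (F n y c ^+ 2)%:E.
    by apply: adde_ge0; exact: ge0_twice_sqr_mul.
  have [cE|ncE] := boolP (c \in [set c | orbit_cosets x c /\ c `<=` E]); last first.
    by case: ifP.
  have [xc _] := set_mem cE; rewrite (mem_set xc).
  rewrite /xi !asboolT//= Nx Ny -!EFinM -EFinD lee_fin -/(a n) -/(b n).
  move: (a n)^-1%R (b n)^-1%R (F n x c) (F n y c) => p q u v.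
  rewrite -subr_ge0 (_ : _ - _ = (p * (v - u) + v * (p - q)) ^+ 2)%R ?sqr_ge0//.
  by ring.
rewrite esumD; last 2 first.
- by move=> c _; exact: ge0_twice_sqr_mul.
- by move=> c _; exact: ge0_twice_sqr_mul.
rewrite !esumZl//; last 4 first.
- by rewrite lee_fin; apply: mulr_ge0; [exact: ler0n|exact: sqr_ge0].
- by move=> c; rewrite lee_fin sqr_ge0.
- by rewrite lee_fin; apply: mulr_ge0; [exact: ler0n|exact: sqr_ge0].
- by move=> c; rewrite lee_fin sqr_ge0.
by rewrite -(S_orbit n Ax xy) -[S n y](fineK (Sfin n Ay)) -EFinM.
Qed.

Lemma coamenable_of_vectors : coamenable P E RelE SubE.
Proof.
have aeA : {ae P, forall x, E x -> A x}.
  apply/(ae_restr mE muE); exists (~` A); split => //; first exact: measurableC.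
  by move=> x /not_implyP[].
exists (fun n x c => (xi n x c)%:C%C); split.
- move=> n; split.
    move=> U mU; split.
      apply: (@coset_borel_walk _ _ _ _ _ _ mR eR mS eS SR _ mE Einv _ clsX A 1%R
        (xi n) U mA AX (mxi n) _ mU).
      by move=> x c nAx; rewrite /xi asboolF//= mul1r.
    apply: (@coset_borel_walk _ _ _ _ _ _ mR eR mS eS SR _ mE Einv _ clsX A 0%R
        (fun _ _ => 0%R) U mA AX _ _ mU) => [w _|x c _]; last by rewrite mul0r.
    exact: measurable_cst.
  rewrite (eq_integral (cst 1)); last first.
    move=> x /set_mem Ex; rewrite -[RHS](xi_unit n Ex); apply: eq_esum => c _.
    by rewrite normc_real real_normK ?num_real.
  rewrite integral_cst// mul1e; apply: le_lt_trans (ltry 1).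
  exact: probability_le1.
- move=> n; apply: nearW => x Ex; rewrite l2norm_real.
  apply/poweR_half1; last exact: xi_unit.
  by apply: esum_ge0 => c _; rewrite lee_fin sqr_ge0.
- have [rf sy tr] := eR.
  (* The exceptional pairs are those whose first point is outside [A]. *)
  exists (RelE `&` (~` A `*` setT)); split.
  + apply: measurableI; first by apply: measurableI => //; exact: measurableX.
    by apply: measurableX => //; exact: measurableC.
  + apply/eqP; rewrite eq_le; apply/andP; split; last exact: integral_ge0.
    (* The number of exceptional partners may be infinite, but only over a null set; comparing it
       with this function avoids proving it measurable. *)
    pose g x : \bar R := if `[< A x >] then 0 else +oo.
    have g0 x : 0 <= g x by rewrite /g; case: ifP.
    apply: (@le_trans _ _ (\int[P]_(x in E) g x)).
      apply: ge0_le_integral_nonmeas => // x Ex; rewrite /g; case: asboolP => Ax.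
        rewrite (_ : _ `&` _ = set0) ?measure0//.
        by apply/seteqP; split => // y [_ [_ [/= ]]].
      exact: leey.
    rewrite (ge0_ae_eq_integral (g := cst 0)) ?integral0//.
    * apply: measurable_fun_if_asbool => //; exact: measurableI.
    * by apply: filterS aeA => x H Ex; rewrite /g asboolT//; exact: H.
  + move=> [x y] [[xy [/= Ex Ey]] nconv]; split; first by [].
    split => //= Ax; apply: nconv => /=.
    under eq_fun do under [X in l2norm _ X]eq_fun do rewrite -rmorphB.
    under eq_fun do rewrite l2norm_real.
    apply/cvg_poweR_half.
      by move=> n; apply: esum_ge0 => c _; rewrite lee_fin sqr_ge0.
    by apply: xi_conv => //; rewrite -clsX//; exact: AX.
Qed.

End coamenable_of_vectors.

(** * Measurability of Borel coset functions along words *)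

Section coset_functions_along_words.
Context {R : realType} d {T : measurableType d} {mu : probability T R}.
Variables (Rel Sub : set (T * T)).
Hypothesis sT : standard_borel R T.
Hypotheses (mR : measurable Rel) (eR : is_equivalence Rel).
Hypotheses (mS : measurable Sub) (eS : is_equivalence Sub) (SR : Sub `<=` Rel).
Variables (E : set T) (mE : measurable E).
Hypotheses (Einv : rel_invariant Sub E).
Variable W : reversible_walk mu.
Local Notation P := (mnormalize (mrestr mu mE) mu).
Local Notation RelE := (rel_restrict Rel E).
Local Notation SubE := (rel_restrict Sub E).
Local Notation X := (@wdom _ _ _ _ W).
Local Notation word := (@word _ _ _ _ W).
Local Notation act := (@act _ _ _ _ W).
Local Notation winv := (@winv _ _ _ _ W).
Hypothesis clsX : forall x, X x -> cls Rel x = orbit W x.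

Let mX : measurable X. Proof. exact: wdom_meas. Qed.
Local Hint Resolve mX : core.

Lemma winvK v : word v -> winv (winv v) = v.
Proof.
move=> wv; rewrite /winv map_rev revK -map_comp -[RHS]map_id.
apply/eq_in_map => i /wv Ji /=; exact: linvK.
Qed.

Lemma act_winvr v x : word v -> X x -> act v (act (winv v) x) = x.
Proof.
by move=> wv Xx; rewrite -{1}(winvK wv) act_winv//; exact: word_winv.
Qed.

Lemma act_cls v x : word v -> X x -> Rel (x, act v x).
Proof.
by move=> wv Xx; rewrite -[Rel _]/(cls Rel x (act v x)) clsX//; exists v.
Qed.

Section swap.
Variables (v : seq (letter W)) (B : set T).
Hypotheses (wv : word v) (mB : measurable B) (BX : B `<=` X) (BE : B `<=` E).
Hypotheses (vE : forall y, B y -> E (act v y)) (vB : forall y, B y -> ~ B (act v y)).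

(** Exchanges [B] with its image under the word and fixes all other points; as [B] is disjoint from
    its image, this is an involution. *)
Definition swap x := if `[< B x >] then act v x
  else if `[< X x /\ B (act (winv v) x) >] then act (winv v) x else x.

Lemma swapK : involutive swap.
Proof.
move=> x; rewrite {2}/swap; case: asboolP => [Bx|nBx].
  have Xx := BX Bx; rewrite /swap asboolF; last exact: vB.
  by rewrite act_winv// asboolT//; split => //; exact: act_wdom.
case: asboolP => [[Xx Bz]|nz]; last by rewrite /swap asboolF// asboolF.
by rewrite /swap asboolT// act_winvr.
Qed.

Lemma swapE x : E x -> E (swap x).
Proof.
rewrite /swap; case: asboolP => [/vE//|_].
by case: asboolP => // -[_ /BE].
Qed.

Lemma measurable_swap : measurable_fun E swap.
Proof.
apply: (measurable_funS measurableT) => //.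
have mw : measurable_fun setT (act (winv v)) by apply: act_meas; exact: word_winv.
apply: measurable_fun_if_asbool; rewrite ?setTI//; first exact: act_meas.
apply: measurable_fun_if_asbool; rewrite ?setTI//.
rewrite (_ : (fun x => _) = X `&` act (winv v) @^-1` B)//.
by apply: measurableI => //; rewrite -[_ @^-1` _]setTI; exact: mw.
Qed.

Lemma swap_rel x : E x -> RelE (x, swap x).
Proof.
have [rf sy tr] := eR; move=> Ex; split; last by split => //; exact: swapE.
rewrite /swap; case: asboolP => [/BX Xx|_]; first exact: act_cls.
by case: asboolP => [[Xx _]|_]; [apply: act_cls => //; exact: word_winv|exact: rf].
Qed.

Definition swap_auto : full_auto P E RelE.
Proof.
refine (@FullAuto _ _ _ P E RelE swap swap swapE swapE (fun x _ => swapK x)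
  (fun x _ => swapK x) measurable_swap measurable_swap _).
by apply: nearW => x; exact: swap_rel.
Defined.

End swap.

Definition id_auto : full_auto P E RelE.
Proof.
refine (@FullAuto _ _ _ P E RelE id id (fun _ => id) (fun _ => id)
  (fun x _ => erefl) (fun x _ => erefl) (@measurable_id _ _ _) (@measurable_id _ _ _) _).
by apply: nearW => x Ex; split => //; have [rf _ _] := eR; exact: rf.
Defined.

(* A measurable bijection between subsets of E extends to an element of the full
   group of E on a piece that it moves off itself; a separating family cuts the
   set of non-fixed points into countably many such pieces. *)
Lemma measurable_coset_word (Q : T -> set T -> Prop) v : word v ->
  coset_borel P E RelE SubE (coset_space E RelE SubE `&` [set p | Q p.1 p.2]) ->
  measurable [set y | [/\ X y, E y, E (act v y) & Q y (cls Sub (act v y))]].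
Proof.
move=> wv [_ bQ]; have [U [mU sepU]] := standard_borel_separated sT.
have mv : measurable_fun setT (act v) by exact: act_meas.
have mvp C : measurable C -> measurable (act v @^-1` C).
  by move=> mC; rewrite -[_ @^-1` _]setTI; exact: mv.
pose B n := (X `&` E `&` act v @^-1` E) `&` (U n `&` ~` (act v @^-1` U n)).
have mB n : measurable (B n).
  apply: measurableI; first by apply: measurableI; [exact: measurableI|exact: mvp].
  by apply: measurableI => //; apply: measurableC; exact: mvp.
have BX n : B n `<=` X by move=> x [[[]]].
have BE n : B n `<=` E by move=> x [[[]]].
have vE n y : B n y -> E (act v y) by move=> [[]].
have vB n y : B n y -> ~ B n (act v y) by move=> [_ [_ nU]] [_ [Uv _]].
pose fixed := X `&` (E `&` [set x | act v x = x]).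
have mfix : measurable fixed.
  apply: measurableI => //.
  have mid : measurable_fun E (id : T -> T) by exact: measurable_id.
  exact: (measurable_pair_preimage mE (measurable_funTS mv) mid (measurable_diagonal sT)).
have Qiff x y : X x -> E x -> E y -> Rel (x, y) ->
    (coset_space E RelE SubE `&` [set p | Q p.1 p.2]) (x, cls SubE y) <-> Q x (cls Sub y).
  move=> Xx Ex Ey xy; rewrite -(cls_restr Einv Ey); split=> [[_]//|Qx]; split => //.
  by apply/(coset_space_restr eR eS SR Einv Ex Ey).
rewrite (_ : mkset _ =
  (fixed `&` [set x | E x /\ (coset_space E RelE SubE `&` [set p | Q p.1 p.2])
     (x, cls SubE (id_auto x))]) `|`
  \bigcup_n (B n `&` [set x | E x /\ (coset_space E RelE SubE `&` [set p | Q p.1 p.2])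
     (x, cls SubE (swap_auto wv (mB n) (@BX n) (@BE n) (vE n) (vB n) x))])).
  apply: measurableU; first by apply: measurableI => //; exact: bQ.
  by apply: bigcupT_measurable => n; apply: measurableI => //; exact: bQ.
have [rf _ _] := eR.
apply/seteqP; split => x.
  move=> [Xx Ex Evx Qx]; have [vx|vx] := pselect (act v x = x).
    left; split; first by [].
    split => //; apply/(Qiff x x) => //; by rewrite -{2}vx.
  right; have [n [Un nUv]] := sepU x (act v x) (fun e => vx (esym e)).
  have Bx : B n x by split => //; split.
  exists n => //; split => //; split => //.
  rewrite /= /swap asboolT//; apply/Qiff => //; exact: act_cls.
move=> [[[Xx [_ vx]] [Ex /(Qiff x x Xx Ex Ex (rf x)) Qx]]|[n _ [Bx [Ex]]]].
  by rewrite /= vx.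
have Xx := BX n x Bx; have Evx := vE n x Bx.
rewrite /= /swap asboolT// => Qx; split => //.
by apply/(Qiff x (act v x)) => //; exact: act_cls.
Qed.

Lemma measurable_normc_coset_word (xi : T -> set T -> R[i]) v : word v ->
  coset_mfun P E RelE SubE xi ->
  measurable_fun [set y | [/\ X y, E y & E (act v y)]]
    (fun y => ComplexField.Normc.normc (xi y (cls Sub (act v y)))).
Proof.
move=> wv mxi.
have mD (f : T -> set T -> R) : (forall U, measurable U ->
    coset_borel P E RelE SubE (coset_space E RelE SubE `&` [set p | U (f p.1 p.2)])) ->
    measurable_fun [set y | [/\ X y, E y & E (act v y)]]
      (fun y => f y (cls Sub (act v y))).
  move=> bf _ U mU.
  have := measurable_coset_word (Q := fun y c => U (f y c)) wv (bf U mU).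
  congr measurable; apply/seteqP; split => y [].
    by move=> ? ? ? ?; split.
  by move=> [? ? ?] ?; split.
have mRe := mD (fun y c => complex.Re (xi y c)) (fun U mU => (mxi U mU).1).
have mIm := mD (fun y c => complex.Im (xi y c)) (fun U mU => (mxi U mU).2).
rewrite (_ : (fun y => _) = (@powR R ^~ 2^-1%R) \o (fun y =>
    (complex.Re (xi y (cls Sub (act v y))) ^+ 2 +
     complex.Im (xi y (cls Sub (act v y))) ^+ 2)%R)); last first.
  apply/funext => y /=; rewrite powR12_sqrt; last by rewrite addr_ge0 ?sqr_ge0.
  by case: (xi _ _).
apply: measurableT_comp => //.
by apply: measurable_funD; exact: measurable_funX.
Qed.

End coset_functions_along_words.

(** * Ergodicity from the gap, and null sets of the relation along words *)

Section saturation.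
Context {R : realType} d {T : measurableType d} {mu : probability T R}.
Variable W : reversible_walk mu.
Local Notation X := (@wdom _ _ _ _ W).
Local Notation J := (@letters _ _ _ _ W).
Local Notation word := (@word _ _ _ _ W).
Local Notation act := (@act _ _ _ _ W).

(** The saturation [Y] of [E] is invariant, so its normalised indicator, taken as a constant
    sequence, must be within any distance of the constant 1. It vanishes off [Y], which makes the
    complement of [Y] null. *)
Lemma gap_ergodic (E : set T) : walk_gap W -> measurable E -> 0 < mu E ->
  {ae mu, forall x, exists2 w, word w & E (act w x)}.
Proof.
move=> gap mE muE; have mX : measurable X by exact: wdom_meas.
have [u wu] := word_enum W.
have wun n : word (u n) by rewrite wu; exists n.
pose Y := X `&` \bigcup_n (act (u n) @^-1` E).
have mY : measurable Y.
  apply: measurableI => //; apply: bigcupT_measurable => n.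
  by rewrite -[_ @^-1` _]setTI; apply: act_meas.
have YP x : X x -> Y x <-> exists2 w, word w & E (act w x).
  move=> Xx; split=> [[_ [n _ En]]|[w]]; first by exists (u n).
  by rewrite wu => -[n _ <-] En; split => //; exists n.
have Yi i x : J i -> X x -> Y (step i x) <-> Y x.
  move=> Ji Xx; have Xs := step_wdom Ji Xx.
  split=> [/(YP _ Xs)[w ww Ew]|/(YP _ Xx)[w ww Ew]].
    by apply/(YP _ Xx); exists (i :: w) => //; apply/word_cons.
  apply/(YP _ Xs); exists (linv i :: w); last by rewrite /act /= step_linv.
  by apply/word_cons; split => //; exact: letters_linv.
have muY : 0 < mu Y.
  rewrite lt0e measure_ge0 andbT; apply/eqP => Y0.
  have : mu E <= mu (Y `|` ~` X).
    apply: le_measure; rewrite ?inE//.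
      by apply: measurableU => //; exact: measurableC.
    move=> x Ex; have [Xx|] := pselect (X x); last by right.
    by left; apply/YP => //; exists [::] => //; exact: word_nil.
  have -> : mu (Y `|` ~` X) = mu Y.
    by apply: measureU0 => //; [exact: measurableC|exact: wdom_full].
  by rewrite [mu Y]Y0 leNgt muE.
pose m := fine (mu Y).
have m0 : (0 < m)%R by rewrite fine_gt0// muY -ge0_fin_numE ?fin_num_measure.
pose f (n : nat) x : R := (\1_Y x / Num.sqrt m)%R.
have mf n : measurable_fun setT (f n).
  by apply: measurable_funM => //; exact: measurable_indic.
have f0 n x : (0 <= f n x)%R by rewrite mulr_ge0// invr_ge0 sqrtr_ge0.
have f1 n : \int[mu]_x ((f n x) ^+ 2)%:E = 1.
  rewrite (eq_integral (fun x => (m^-1)%:E * (\1_Y x)%:E)); last first.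
    move=> x _; rewrite -EFinM; congr (_%:E).
    rewrite /f exprMn exprVn sqr_sqrtr ?(ltW m0)// mulrC indicE.
    by case: (x \in Y); rewrite ?expr1n ?expr0n.
  rewrite ge0_integralZl//; last 2 first.
  - by apply/measurable_EFinP; exact: measurable_indic.
  - by rewrite lee_fin invr_ge0 ltW.
  rewrite integral_indic// setIT [X in _ * X](_ : _ = m%:E); last first.
    by rewrite fineK ?fin_num_measure.
  by rewrite -EFinM mulVf// gt_eqF.
have fs i : J i -> \int[mu]_x ((f n (step i x) - f n x) ^+ 2)%:E @[n --> \oo] --> 0.
  move=> Ji; rewrite (_ : (fun n => _) = cst 0); first exact: cvg_cst.
  apply/funext => n; rewrite (ge0_ae_eq_integral (g := cst 0)) ?integral0//.
  - apply/measurable_EFinP/measurable_funX/measurable_funB => //.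
    by apply: measurableT_comp => //; exact: step_meas.
  - by move=> x _; rewrite lee_fin sqr_ge0.
  - apply/(ae_wdom W); apply: nearW => x Xx _ /=.
    rewrite /f !indicE; have [Yx|nYx] := pselect (Y x).
      by rewrite !mem_set ?subrr ?expr0n//; exact/Yi.
    by rewrite !memNset ?subrr ?expr0n// => /(Yi _ _ Ji Xx).
have small e : (0 < e)%R -> mu (~` Y) <= e%:E.
  move=> e0; have [n _ h] := gap f mf f0 f1 fs e 0%N e0.
  apply: le_trans h; rewrite -[X in mu X]setIT -integral_indic//; last exact: measurableC.
  apply: ge0_le_integral => //.
  - by apply/measurable_EFinP; apply: measurable_indic; exact: measurableC.
  - by apply/measurable_EFinP/measurable_funX/measurable_funB.
  - move=> x _; rewrite lee_fin indicE.
    have [nYx|_] := boolP (x \in ~` Y); last by rewrite sqr_ge0.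
    have -> : f n x = 0%R by rewrite /f indicE memNset ?mul0r//; exact: set_mem.
    by rewrite sub0r sqrrN expr1n.
exists (~` Y); split; first exact: measurableC.
  apply/eqP; rewrite -measure_le0; apply/lee_addgt0Pr => e e0.
  by rewrite add0e; exact: small.
by move=> x /= nE Yx; apply: nE; apply/YP => //; case: Yx.
Qed.

End saturation.

Section negligible_along_words.
Context {R : realType} d {T : measurableType d} {mu : probability T R}.
Variables (Rel : set (T * T)).
Variables (E : set T) (mE : measurable E).
Hypothesis (muE : 0 < mu E).
Local Notation P := (mnormalize (mrestr mu mE) mu).
Local Notation RelE := (rel_restrict Rel E).
Variable W : reversible_walk mu.
Local Notation X := (@wdom _ _ _ _ W).
Local Notation word := (@word _ _ _ _ W).
Local Notation act := (@act _ _ _ _ W).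
Hypothesis clsX : forall x, X x -> cls Rel x = orbit W x.

Lemma counting_ge1 (U : choiceType) (A : set U) y : A y -> 1 <= counting A :> \bar R.
Proof.
move=> Ay; rewrite /counting; case: asboolP => fA; last exact: leey.
rewrite lee_fin ler1n lt0n finmap.cardfs_eq0; apply/negP => /eqP A0.
by move: Ay; rewrite (fset_set_set0 fA A0).
Qed.

(** Wherever the graph of the word meets a set of pairs, the fibre of that set has at least one
    point. The measure of the set therefore dominates that of those base points. *)
Lemma ae_word_of_negligible (Q : set (T * T)) w : word w ->
  (rel_measure P E RelE).-negligible (RelE `&` ~` Q) ->
  {ae mu, forall x, E x -> E (act w x) -> Q (x, act w x)}.
Proof.
move=> ww [N [mN N0 QN]]; have mX : measurable X by exact: wdom_meas.
have ma : measurable_fun E (act w) by apply: measurable_funTS; exact: act_meas.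
pose Z := X `&` act w @^-1` E `&` [set x | E x /\ N (x, act w x)].
have mZ : measurable Z.
  apply: measurableI.
    by apply: measurableI => //; rewrite -[_ @^-1` _]setTI; apply: act_meas.
  have mid : measurable_fun E (id : T -> T) by exact: measurable_id.
  exact: (measurable_pair_preimage mE mid ma mN).
have Z0 : mu (Z `&` E) = 0.
  apply/(restr_null mE muE mZ)/eqP; rewrite -measure_le0 -N0.
  apply: (@le_trans _ _ (\int[P]_(x in E) (\1_Z x)%:E)).
    by rewrite integral_indic// setIidl// => x [_ []].
  apply: ge0_le_integral_nonmeas => // x Ex; rewrite indicE.
  have [/set_mem[[Xx Ewx] [_ Nx]]|_] := boolP (x \in Z); last exact: measure_ge0.
  apply: (@counting_ge1 _ _ (act w x)); split => //; split => //.
  by rewrite -[Rel _]/(cls Rel x (act w x)) clsX//; exists w.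
apply/(ae_wdom W); exists (Z `&` E); split => //; first exact: measurableI.
move=> x /= /not_implyP[Xx /not_implyP[Ex /not_implyP[Ewx nQ]]].
split => //; split => //; split => //; apply: QN; split => //; split => //.
by rewrite -[Rel _]/(cls Rel x (act w x)) clsX//; exists w.
Qed.

End negligible_along_words.

(** * Exponential decay on [E] excludes coamenability *)

Section decay_not_coamenable.
Context {R : realType} d {T : measurableType d} {mu : probability T R}.
Variables (Rel Sub : set (T * T)).
Hypothesis sT : standard_borel R T.
Hypotheses (mR : measurable Rel) (eR : is_equivalence Rel).
Hypotheses (mS : measurable Sub) (eS : is_equivalence Sub) (SR : Sub `<=` Rel).
Variables (E : set T) (mE : measurable E).
Hypotheses (Einv : rel_invariant Sub E) (muE : 0 < mu E).
Local Notation P := (mnormalize (mrestr mu mE) mu).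
Local Notation RelE := (rel_restrict Rel E).
Local Notation SubE := (rel_restrict Sub E).
Local Notation normc := ComplexField.Normc.normc.

Lemma normcB_dist (a b : R[i]) : (`|normc a - normc b| <= normc (a - b)%R)%R.
Proof.
have H (x y : R[i]) : (normc x - normc y <= normc (x - y)%R)%R.
  by rewrite -lecR rmorphB; exact: (@lerB_dist _ R[i]).
rewrite ler_norml H andbT lerNl opprB.
have N (z : R[i]) : normc (- z)%R = normc z by case: z => p q /=; rewrite !sqrrN.
by have := H b a; rewrite -[(b - a)%R]opprB N.
Qed.

(* Absolute values of the given vectors, transported to almost every point along
   the first word that leads into E. *)
Section contradiction.
Variable W : reversible_walk mu.
Local Notation X := (@wdom _ _ _ _ W).
Local Notation J := (@letters _ _ _ _ W).
Local Notation word := (@word _ _ _ _ W).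
Local Notation act := (@act _ _ _ _ W).
Local Notation winv := (@winv _ _ _ _ W).
Local Notation step := (@step _ _ _ _ W).
Local Notation csum := (@csum _ _ _ _ W Sub).
Local Notation orbit_cosets := (@orbit_cosets _ _ _ _ W Sub).
Hypothesis clsX : forall x, X x -> cls Rel x = orbit W x.
Variables (s t : R).
Hypotheses (s0 : (0 < s)%R) (st : (s < t)%R) (t1 : (t < 1)%R).
Hypothesis ret_decay : forall y, X y -> E y ->
  exists C, forall m, (ret W Sub (2 * m) y <= C * (s ^+ 2) ^+ m)%R.
Hypothesis reach : forall x, X x -> exists2 w, word w & E (act w x).
Variable xi : nat -> T -> set T -> R[i].
Hypotheses (mxi : forall n, coset_mfun P E RelE SubE (xi n))
  (xi1 : forall n x, X x -> E x ->
    l2norm (cosets RelE SubE x) (xi n x) = 1)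
  (xi_conv : forall w x, word w -> X x -> E x -> E (act w x) ->
    l2norm (cosets RelE SubE x) (fun c => xi n x c - xi n (act w x) c)%R
      @[n --> \oo] --> 0).

Lemma no_transported_vectors : False.
Proof.
have mX : measurable X by exact: wdom_meas.
have [u wu] := word_enum W.
have wun n : word (u n) by rewrite wu; exists n.
have reach_nat x : X x -> exists n, `[< E (act (u n) x) >].
  by move=> /reach[w]; rewrite wu => -[n _ <-] En; exists n; exact/asboolP.
(* The first index of a word leading from [x] into [E]; the value 0 is taken only where no such word
   exists, which does not happen on the domain. *)
pose idx x := if pselect (exists n, `[< E (act (u n) x) >]) is left e
  then ex_minn e else 0%N.
pose K m := X `&` [set x | idx x = m].
have KE m x : K m x -> X x /\ E (act (u m) x).
  move=> [Xx]; rewrite /= /idx; case: pselect => [e|]; last by have := reach_nat x Xx.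
  by case: ex_minnP => n /asboolP En _ <-.
have mu_E m : measurable (act (u m) @^-1` E).
  by rewrite -[_ @^-1` _]setTI; apply: act_meas.
have mK m : measurable (K m).
  rewrite (_ : K m = X `&` (act (u m) @^-1` E `&`
      \bigcap_(k in [set k | (k < m)%N]) ~` (act (u k) @^-1` E))).
    apply: measurableI => //; apply: measurableI => //.
    case: m => [|m].
      by rewrite (_ : [set k | _] = set0) ?bigcap_set0//; apply/seteqP; split.
    apply: bigcap_measurable; first by exists 0%N.
    by move=> k _; exact: measurableC.
  apply/seteqP; split => x.
    move=> [Xx xm]; split => //; split; first by have [] := KE m x (conj Xx xm).
    move=> k /= km Ek; move: xm; rewrite /= /idx; case: pselect => [e|]; last first.
      by have := reach_nat x Xx.
    case: ex_minnP => n _ /(_ k) H nm; move: km; rewrite -nm ltnNge H//.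
    exact/asboolP.
  move=> [Xx [Em Hm]]; split => //=; rewrite /idx.
  case: pselect => [e|]; last by have := reach_nat x Xx.
  case: ex_minnP => n /asboolP En Hn; apply/eqP; rewrite eqn_leq Hn ?andTb.
    by rewrite leqNgt; apply/negP => nm; exact: (Hm n nm En).
  exact/asboolP.
pose p x := act (u (idx x)) x.
have pX x : X x -> X (p x) by move=> Xx; exact: act_wdom.
have pE x : X x -> E (p x) by move=> Xx; have [] := KE (idx x) x (conj Xx erefl).
have pcos x : X x -> orbit_cosets (p x) = orbit_cosets x.
  by move=> Xx; rewrite !orbit_cosetsE orbit_act.
(* Absolute values, because [no_asymptotically_invariant] concerns nonnegative functions; taking
   them keeps fibre norms and does not increase distances. *)
pose F n x c : R := if `[< c `<=` E >] then normc (xi n (p x) c) else 0%R.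
have [rf _ _] := eS.
have subE y : cls Sub y `<=` E <-> E y.
  by split=> [|Ey z yz]; [apply; exact: rf|exact: Einv yz Ey].
apply: (@no_asymptotically_invariant _ _ _ _ W Sub mS eS E s t s0 st t1 ret_decay F).
- by move=> n x c; rewrite /F; case: ifP => // _; case: (xi _ _ _) => a b; exact: sqrtr_ge0.
- move=> n w ww; apply/measurable_EFinP.
  (* The domain is cut by the first index. On [K m] the function is [xi] at [act (u m) x], read
     along the word that returns to [x] and then follows [w]. *)
  have XK : X = \bigcup_m K m.
    by apply/seteqP; split => [x Xx|x [m _ []]//]; exists (idx x).
  rewrite {1}XK; apply/(measurable_fun_bigcup _ mK) => m.
  have mwE : measurable (act w @^-1` E).
    by rewrite -[_ @^-1` _]setTI; apply: act_meas.
  pose v := winv (u m) ++ w.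
  have wv : word v by apply/word_cat; split => //; exact: word_winv.
  have vE x : X x -> act v (act (u m) x) = act w x.
    by move=> Xx; rewrite /v act_cat act_winv.
  apply: (eq_measurable_fun (fun x => if `[< (act w @^-1` E) x >]
    then normc (xi n (act (u m) x) (cls Sub (act v (act (u m) x)))) else 0%R)).
    move=> x /set_mem Kx; have [Xx xm] := Kx; rewrite /F /p xm vE//.
    by case: asboolP => Ewx; [rewrite asboolT//; exact/subE|
      rewrite asboolF// => /subE].
  apply: measurable_fun_if => //.
  + apply: (@measurable_fun_bool _ _ _ _ true).
    rewrite [X in measurable X](_ : _ = K m `&` act w @^-1` E); first exact: measurableI.
    by apply/seteqP; split => x [Kx /asboolP].
  + have mD : measurable [set y | [/\ X y, E y & E (act v y)]].
      rewrite (_ : mkset _ = X `&` E `&` act v @^-1` E); last first.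
        by apply/seteqP; split => y; [case|case=> -[]].
      apply: measurableI; first exact: measurableI.
      by rewrite -[_ @^-1` _]setTI; apply: act_meas.
    have mg : measurable_fun [set y | [/\ X y, E y & E (act v y)]]
        (fun y => normc (xi n y (cls Sub (act v y)))).
      by apply: measurable_normc_coset_word; [exact: sT|exact: eR|exact: eS|exact: SR|
        exact: Einv|exact: clsX|exact: wv|exact: mxi].
    apply: (measurable_comp (F := [set y | [/\ X y, E y & E (act v y)]])
      (f := fun y => normc (xi n y (cls Sub (act v y)))) (g := act (u m)) mD _ mg);
      last by apply: measurable_funTS; exact: act_meas.
    move=> _ [x [Kx /asboolP Ewx] <-]; have [Xx Eux] := KE m x Kx.
    by split => //; [exact: act_wdom|rewrite vE].
- move=> n x c _ _; rewrite /F; case: asboolP => //; by rewrite eqxx.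
- move=> n x Xx; rewrite /csum -(pcos x Xx).
  have /poweR_half1 <- := xi1 n (pX x Xx) (pE x Xx); last first.
    by apply: esum_ge0 => c _; rewrite lee_fin sqr_ge0.
  rewrite (cosets_orbit eS Einv clsX (pX x Xx) (pE x Xx)).
  rewrite -(esum_eq_support (A := [set c | orbit_cosets (p x) c /\ c `<=` E])
    (B := orbit_cosets (p x))).
  + by apply: eq_esum => c [_ cE]; rewrite /F asboolT.
  + by move=> c [].
  + by move=> c xc ncE; rewrite /F asboolF ?expr0n// => cE; apply: ncE.
- move=> i x Ji Xx; have Xs := step_wdom Ji Xx.
  (* From [p x] back to [x], along the letter [i], then into [E] again: this word joins two points
     of [E], where the convergence of [xi] is known. *)
  pose w := winv (u (idx x)) ++ i :: u (idx (step i x)).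
  have ww : word w.
    apply/word_cat; split; first exact: word_winv.
    by apply/word_cons.
  have wp : act w (p x) = p (step i x) by rewrite /w act_cat /p act_winv.
  have := xi_conv ww (pX x Xx) (pE x Xx).
  rewrite wp => /(_ (pE _ Xs)) /cvg_poweR_half H.
  have {}H := H (fun n => esum_ge0 (fun c _ => _)).
  apply: squeeze_cvge (cvg_cst 0) (H _); last first.
    by move=> n c; rewrite lee_fin sqr_ge0.
  apply: nearW => n; apply/andP; split.
    by apply: esum_ge0 => c _; rewrite lee_fin sqr_ge0.
  rewrite /csum -(pcos x Xx) (cosets_orbit eS Einv clsX (pX x Xx) (pE x Xx)).
  rewrite -(esum_eq_support (A := [set c | orbit_cosets (p x) c /\ c `<=` E])
    (B := orbit_cosets (p x))).
  + apply: le_esum => c [_ cE]; rewrite /F !asboolT// lee_fin.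
    rewrite -real_normK ?num_real//; apply: lerXn2r; rewrite ?nnegrE//.
      by case: (xi _ _ _ - xi _ _ _)%R => a b; exact: sqrtr_ge0.
    by rewrite distrC; exact: normcB_dist.
  + by move=> c [].
  + by move=> c xc ncE; rewrite /F !asboolF ?subrr ?expr0n// => cE; apply: ncE.
Qed.

End contradiction.

(** Unit fibres, convergence along each word, decay on [E] and reachability of [E] hold almost
    everywhere. Countability of the words gives one invariant conull set for all of them, and the
    walk shrunk to it meets the hypotheses of [no_transported_vectors] pointwise. *)
Lemma decay_not_coamenable (W : reversible_walk mu) (s t : R) :
  (forall x, wdom W x -> cls Rel x = orbit W x) -> walk_gap W ->
  (0 < s)%R -> (s < t)%R -> (t < 1)%R ->
  {ae mu, forall x, E x ->
    exists C, forall m, (ret W Sub (2 * m) x <= C * (s ^+ 2) ^+ m)%R} ->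
  ~ coamenable P E RelE SubE.
Proof.
move=> clsX gap s0 st t1 decay [xi [xiL2 xi1 xineg]].
have ae1 : {ae mu, forall x n, E x -> l2norm (cosets RelE SubE x) (xi n x) = 1}.
  by apply: ae_forall_nat => n; apply/(ae_restr mE muE); exact: xi1.
have aew : {ae mu, forall x (w : seq (letter W)), word w -> E x -> E (act w x) ->
    l2norm (cosets RelE SubE x) (fun c => xi n x c - xi n (act w x) c)%R
      @[n --> \oo] --> 0}.
  apply: ae_forall_set; first exact: countable_word.
  move=> w ww.
  have := @ae_word_of_negligible _ _ _ _ Rel E mE muE W clsX _ w ww xineg.
  by apply: filterS => x H; exact: H.
have all4 : {ae mu, forall x,
    ((forall n, E x -> l2norm (cosets RelE SubE x) (xi n x) = 1) /\
     (forall w : seq (letter W), word w -> E x -> E (act w x) ->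
       l2norm (cosets RelE SubE x) (fun c => xi n x c - xi n (act w x) c)%R
         @[n --> \oo] --> 0)) /\
    ((E x -> exists C, forall m, (ret W Sub (2 * m) x <= C * (s ^+ 2) ^+ m)%R) /\
     (exists2 w : seq (letter W), word w & E (act w x)))}.
  exact: (filterI (filterI ae1 aew) (filterI decay (gap_ergodic gap mE muE))).
have [A [mA A0 AX AP Ai]] := ae_invariant W all4.
apply: (@no_transported_vectors (shrink mA A0 AX Ai) _ s t s0 st t1 _ _ xi).
- by move=> x Ax; exact: clsX (AX x Ax).
- by move=> x Ax Ex; have [_ [H _]] := AP x Ax; exact: H.
- by move=> x Ax; have [_ [_ H]] := AP x Ax.
- by move=> n; have [] := xiL2 n.
- by move=> n x Ax Ex; have [[H _] _] := AP x Ax; exact: H.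
- by move=> w x ww Ax Ex Ewx; have [[_ H] _] := AP x Ax; exact: H.
Qed.

End decay_not_coamenable.

Theorem proposition5p2 (R : realType) (d : measure_display)
    (T : measurableType d) (mu : probability T R)
    (Rel Sub : set (T * T))
    (nu : full_group mu [set: T] Rel -> R)
    (E : set T) (mE : measurable E) :
  standard_borel R T ->
  pmp_eqrel mu Rel -> pmp_eqrel mu Sub -> Sub `<=` Rel ->
  countable_prob nu -> symmetric_prob nu -> generates_rel nu ->
  spectral_gap (generated (supp nu)) ->
  rel_invariant Sub E -> 0 < mu E ->
  coamenable (mnormalize (mrestr mu mE) mu) E (rel_restrict Rel E) (rel_restrict Sub E)
  <-> rho_set Sub nu E = 1.
Proof.
move=> sT pmpR pmpS SR nuP nuS nuG sg Einv muE.
have [mR eR _ _] := pmpR; have [mS eS _ _] := pmpS.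
have [A [wA _ clsA]] := full_walk_exists sT pmpR nuP nuS nuG (nearW _ (fun=> Logic.I)).
have gap : walk_gap (full_walk nuP nuS wA) by exact: spectral_gap_walk.
split=> [coam|rho1].
  apply/eqP; apply: contrapT => /negP rho1.
  have [t /andP[t0 t1] decay] := ret_decay_of_rho_set mS eS clsA rho1.
  have tt : (t < (t + 1) / 2)%R by lra.
  have t2 : ((t + 1) / 2 < 1)%R by lra.
  exact: (decay_not_coamenable (W := full_walk nuP nuS wA) sT eR mS eS SR Einv
    muE clsA gap t0 tt t2 decay) coam.
have growth := moment_growth_of_rho_set mS eS clsA mE Einv rho1.
have [B [F [[mB B0 BX Bi] F_ Ffin F1 Fconv]]] :=
  asymptotic_coset_vectors mS eS mE Einv gap growth.
have mF n := let: And3 _ H _ := F_ n in H.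
have FE n := let: And3 _ _ H := F_ n in H.
exact: (coamenable_of_vectors (W := full_walk nuP nuS wA) mR eR mS eS SR mE Einv
  muE clsA mB B0 BX Bi mF FE
  Ffin F1 Fconv).
Qed.
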